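(* Let $f\in C(\mathbb R_+\times D,Y)$, $D_B\supseteq D_A=D$, $\dim\ker A=n<\infty$, and let $\lambda A+B$ be a regular pencil of index $\nu$. Assume that there exist an open set $\widetilde M\subseteq W:=Y_1\dot{+}Y_{2\Sigma}$ and a set $M_{20}\subseteq D_{20}$ such that, with $M_{1,2\Sigma}=\widetilde A^{-1}\widetilde M\subseteq D_1\dot{+}D_{2\Sigma}$, the following conditions hold. 1. For each $t\in\mathbb R_+$ and each $x_1+x_{2\Sigma}\in M_{1,2\Sigma}$ there exists a unique $x_{20}\in M_{20}$ such that $(t,x_1+x_{2\Sigma}+x_{20})\in L_0$. 2. The function $f(t,x)$ satisfies locally a Lipschitz condition with respect to $x$ on $\mathbb R_+\times D$. Moreover, for any fixed $t'$ and $x'=x_1'+x_{2\Sigma}'+x_{20}'$ such that $x_1'+x_{2\Sigma}'\in M_{1,2\Sigma}$, $x_{20}'\in M_{20}$ and $(t',x')\in L_0$, there exist open neighborhoods $U_\delta(t',x_1',x_{2\Sigma}')=U_{\delta_1}(t')\times U_{\delta_2}(x_1')\times U_{\delta_3}(x_{2\Sigma}')\subset\mathbb R_+\times D_1\times D_{2\Sigma}$ and $U_\varepsilon(x_{20}')\subset D_{20}$ and an operator $W_{t',x'}\in\mathrm L(D_{20},Y_{2*})$ having an inverse $W_{t',x'}^{-1}\in\mathrm L(Y_{2*},D_{20})$ such that for each $(t,x_1,x_{2\Sigma})\in U_\delta(t',x_1',x_{2\Sigma}')$ and each $x_{20}^1,x_{20}^2\in U_\varepsilon(x_{20}')$ $$\big\|F_{2*}(t,x_1,x_{2\Sigma},x_{20}^1)-F_{2*}(t,x_1,x_{2\Sigma},x_{20}^2)-W_{t',x'}[x_{20}^1-x_{20}^2]\big\|\le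 q(\delta,\varepsilon)\|x_{20}^1-x_{20}^2\|,$$ where $q(\delta,\varepsilon)$ is such that $\lim_{\delta,\varepsilon\to0}q(\delta,\varepsilon)<\|W_{t',x'}^{-1}\|^{-1}$ (the numbers $\delta,\varepsilon>0$ depend on the choice of $t',x'$). Then for each initial point $(t_0,x_0)\in L_0$ for which $(P_1+P_{2\Sigma})x_0\in M_{1,2\Sigma}$ and $P_{20}x_0\in M_{20}$, there exists $t_{max}\le\infty$ such that the initial value problem $\frac{d}{dt}[Ax]+Bx=f(t,x)$, $x(t_0)=x_0$, has a unique solution $x(t)$ in $M_{1,2\Sigma}\dot{+}M_{20}$ on the maximal interval of existence $[t_0,t_{max})$.
   Context: Notation: $\mathbb R_+=[0,\infty)$; $\mathrm L(E,F)$ is the space of bounded linear operators; $\dot{+}$ is direct sum, and for subsets $M,N$ of two summands $M\dot{+}N=\{m+n\}$. Setting: $X,Y$ are Banach spaces; $A:D_A\to Y$, $B:D_B\to Y$ are closed linear operators with domains dense in $X$; $\operatorname{range}(A)$ is closed; $D=D_A\cap D_B\neq\{0\}$. The abstract differential-algebraic equation (ADAE) is $\frac{d}{dt}[Ax]+Bx=f(t,x)$, $t>0$. A solution on an interval $J\subseteq\mathbb R_+$ is $x\in C(J,X)$ with $Ax\in C^1(J,Y)$ (if $J=\mathbb R_+$: $Ax\in C^1((0,\infty),Y)$), $x(t)\in D$, satisfying the equation for every $t\in J$. An interval $J$ is the maximal interval of existence of $x(t)$ (respectively, of $x(t)$ in a set $S$) if $x$ cannot be extended to a strictly larger interval so that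 it remains a solution (respectively, a solution with values in $S$); solutions are extended only to the right. Regular pencil of index $\nu\in\mathbb N$: there is $R>0$ such that for every complex $\lambda$ with $|\lambda|>R$ the operator $\lambda A+B:D\to Y$ has an inverse in $\mathrm L(Y,X)$, and $(A+\mu B)^{-1}$ has a pole of order $\nu$ at $\mu=0$ (equivalently, $(\lambda A+B)^{-1}$ has at $\lambda=\infty$ a pole of order $\nu-1$, or a removable singularity if $\nu=1$). For real spaces this is understood via complexification. Projectors: let $\{\varphi_i^1\}_{i=1}^n$ be a basis of $\ker A\cap D$, and $\{\varphi_i^j\}_{i=1,\dots,n}^{j=1,\dots,m_i}\subset D$ a canonical system of root vectors of $A+\mu B$ at $\mu=0$: $A\varphi_i^1=0$, $A\varphi_i^j=-B\varphi_i^{j-1}$ ($j=2,\dots,m_i$), $1\le m_i\le\nu$, $\max_i m_i=\nu$; let $q_i^j\in D_{A^*}\cap D_{B^*}$ be functionals with $A^*q_i^{m_i}=0$, $A^*q_i^j=-B^*q_i^{j+1}$ ($j=1,\dots,m_i-1$), $\langle B\varphi_i^j,q_k^l\rangle=\delta_{ik}\delta_{jl}$. Such systems exist and are fixed. Define $P_2=\sum_{i}\sum_{j=1}^{m_i}\langle\cdot,B^*q_i^j\rangle\varphi_i^j$, $P_1=I-P_2$, $Q_2=\sum_i\sum_{j=1}^{m_i}\langle\cdot,q_i^j\rangle B\varphi_i^j$, $Q_1=I-Q_2$, $P_{20}=\sum_i\langle\cdot,B^*q_i^1\rangle\varphi_i^1$, $P_{2\Sigma}=\sum_{i:m_i\ne1}\sum_{j=2}^{m_i}\langle\cdot,B^*q_i^j\rangle\varphi_i^j$,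 $Q_{2*}=\sum_i\langle\cdot,q_i^{m_i}\rangle B\varphi_i^{m_i}$, $Q_{2\Sigma}=\sum_{i:m_i\ne1}\sum_{j=1}^{m_i-1}\langle\cdot,q_i^j\rangle B\varphi_i^j$. These are bounded projectors on $X$ and $Y$ respectively, with $P_2=P_{20}+P_{2\Sigma}$, $Q_2=Q_{2*}+Q_{2\Sigma}$. Put $D_1=P_1D$, $D_{20}=P_{20}D$, $D_{2\Sigma}=P_{2\Sigma}D$, $Y_1=Q_1Y$, $Y_{2*}=Q_{2*}Y$, $Y_{2\Sigma}=Q_{2\Sigma}Y$, so $D=D_1\dot{+}D_{2\Sigma}\dot{+}D_{20}$, $Y=Y_1\dot{+}Y_{2\Sigma}\dot{+}Y_{2*}$. Write $x=x_1+x_{2\Sigma}+x_{20}$ with $x_1=P_1x$, $x_{2\Sigma}=P_{2\Sigma}x$, $x_{20}=P_{20}x$; the norm used is $\|x\|=\|x_1\|+\|x_{2\Sigma}\|+\|x_{20}\|$. $\widetilde A=A+\sum_{i=1}^n\langle\cdot,B^*q_i^1\rangle B\varphi_i^{m_i}:D\to Y$ has an inverse $\widetilde A^{-1}\in\mathrm L(Y,X)$; $\widetilde A$ coincides with $A$ on $D_1\dot{+}D_{2\Sigma}$ and maps it onto $Y_1\dot{+}Y_{2\Sigma}$. $F_{2*}(t,x_1,x_{2\Sigma},x_{20})=Q_{2*}f(t,x_1+x_{2\Sigma}+x_{20})-Q_{2*}B(x_{2\Sigma}+x_{20})$, and $L_0=\{(t,x)\in\mathbb R_+\times D: Q_{2*}[f(t,x)-Bx]=0\}$.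 $f$ satisfies locally a Lipschitz condition with respect to $x$ on $J\times M$ if for each $(t',x')\in J\times M$ there are open neighborhoods $U(t'),\widetilde U(x')$ and $L\ge0$ with $\|f(t,x_1)-f(t,x_2)\|\le L\|x_1-x_2\|$ for $t\in U(t')$, $x_1,x_2\in\widetilde U(x')$. Neighborhoods of an endpoint of a time interval are semi-open intervals.
   Formalization: Added hypothesis: near each point of L_0 lying over M_{1,2Σ} and M_20, all points of L_0 over M_{1,2Σ} lie over M_20 (true e.g. if M_20 is open in D_20); for arbitrary M_20 the unique x_20 can jump and no solution exist. *)

(* Defs.v *)
From HB Require Import structures.
From mathcomp Require Import all_boot all_order all_algebra.
From mathcomp Require Import all_classical all_reals all_analysis.
From mathcomp Require Import complex.
Set Implicit Arguments.
Unset Strict Implicit.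
Unset Printing Implicit Defensive.
Import Order.TTheory GRing.Theory Num.Theory.
Import numFieldNormedType.Exports.
Local Open Scope classical_set_scope.
Local Open Scope ring_scope.
Local Open Scope complex_scope.

(* A Banach space is real or complex; [scal R k] is its field of scalars.  Time
   is always real, and norms are read back in R with [rnorm]. *)
Variant scalar_kind := over_R | over_C.

Definition scal (R : realType) (k : scalar_kind) : numFieldType :=
  match k with over_R => R | over_C => R[i] end.

Definition of_real (R : realType) (k : scalar_kind) : R -> scal R k :=
  match k with over_R => fun a => a | over_C => fun a => a%:C end.

Definition real_part (R : realType) (k : scalar_kind) : scal R k -> R :=
  match k with over_R => fun a => a | over_C => fun a => complex.Re a end.

Definition rnorm (R : realType) (k : scalar_kind)
    (X : normedModType (scal R k)) (x : X) : R := real_part `|x|.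

Definition snorm (R : realType) (k : scalar_kind) (a : scal R k) : R :=
  real_part `|a|.

Section Operators.
Context {R : realType} {K : nzRingType}.
Implicit Types E F : lmodType K.

Definition linear_subspace E (M : set E) : Prop :=
  M 0 /\ forall (a : K) x y, M x -> M y -> M (a *: x + y).

Definition linear_on E F (M : set E) (T : E -> F) : Prop :=
  forall (a : K) x y, M x -> M y -> T (a *: x + y) = a *: T x + T y.

(* T restricted to M belongs to L(M, N), for the norms nE and nF; the values of
   T outside M are irrelevant. *)
Definition in_L E F (nE : E -> R) (nF : F -> R) (M : set E) (N : set F)
    (T : E -> F) : Prop :=
  [/\ linear_on M T, forall x, M x -> N (T x) &
      exists c : R, forall x, M x -> nF (T x) <= c * nE x].

Definition inverse_on (E F : Type) (M : set E) (N : set F) (T : E -> F)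
    (S : F -> E) : Prop :=
  [/\ forall x, M x -> N (T x), forall y, N y -> M (S y),
      forall x, M x -> S (T x) = x & forall y, N y -> T (S y) = y].

End Operators.

Section Complexification.
Context {R : realType}.

Definition cplx (X : lmodType R) : Type := (X * X)%type.

HB.instance Definition _ (X : lmodType R) :=
  GRing.Zmodule.copy (cplx X) (X * X)%type.

(* (x, y) stands for x + i y *)
Definition cplx_scale (X : lmodType R) (l : R[i]) (z : cplx X) : cplx X :=
  (complex.Re l *: z.1 - complex.Im l *: z.2,
   complex.Im l *: z.1 + complex.Re l *: z.2).

Fact cplx_scaleA (X : lmodType R) (a b : R[i]) (z : cplx X) :
  cplx_scale a (cplx_scale b z) = cplx_scale (a * b) z.
Proof.
case: a b z => [a1 a2] [b1 b2] [x y]; rewrite /cplx_scale /=.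
rewrite !scalerBr !scalerDr !scalerBl !scalerDl !scalerA.
congr pair; first by rewrite !opprD addrACA.
by rewrite addrACA [X in X + _]addrC [X in _ + X]addrC.
Qed.

Fact cplx_scale1 (X : lmodType R) : left_id 1 (@cplx_scale X).
Proof. by case=> x y; rewrite /cplx_scale /= !scale1r !scale0r subr0 add0r. Qed.

Fact cplx_scaleDr (X : lmodType R) : right_distributive (@cplx_scale X) +%R.
Proof.
move=> [a b] [x y] [u v]; rewrite /cplx_scale /=; congr pair => /=.
- by rewrite !scalerDr opprD addrACA.
- by rewrite !scalerDr addrACA.
Qed.

Fact cplx_scaleDl (X : lmodType R) (z : cplx X) :
  {morph (@cplx_scale X)^~ z : a b / a + b}.
Proof.
move=> [a b] [c d]; case: z => x y; rewrite /cplx_scale /=; congr pair => /=.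
- by rewrite !scalerDl opprD addrACA.
- by rewrite !scalerDl addrACA.
Qed.

HB.instance Definition _ (X : lmodType R) :=
  GRing.Zmodule_isLmodule.Build R[i] (cplx X)
    (@cplx_scaleA X) (@cplx_scale1 X) (@cplx_scaleDr X) (@cplx_scaleDl X).

(* Taylor's complexification norm: it is R[i]-homogeneous and extends the norm
   of X. *)
Definition cplx_norm (X : normedModType R) (z : cplx X) : R :=
  sup [set `|cos th *: z.1 + sin th *: z.2| | th in [set: R]].

Definition cplx_map (X Y : lmodType R) (T : X -> Y) (z : cplx X) : cplx Y :=
  (T z.1, T z.2).

End Complexification.

Section RegularPencil.
Context {R : realType}.

(* The pole of order nu at mu = 0 is read off the Laurent expansion
   (A + mu B)^-1 = \sum_(j >= - nu) mu ^ j C_(j + nu), C_0 <> 0, which converges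
   in operator norm. *)
Definition regular_pencilC (E F : lmodType R[i]) (nE : E -> R) (nF : F -> R)
    (D : set E) (A B : E -> F) (nu : nat) : Prop :=
  (exists2 r : R, 0 < r & forall l : R[i], r < complex.Re `|l| ->
     exists S : F -> E, in_L nF nE setT setT S /\
       inverse_on D setT (fun x => l *: A x + B x) S) /\
  (exists C : nat -> F -> E,
     [/\ forall j, in_L nF nE setT setT (C j),
         exists y, C 0%N y != 0 &
         exists2 r : R, 0 < r &
           forall mu : R[i], 0 < complex.Re `|mu| -> complex.Re `|mu| < r ->
           exists S : F -> E,
             [/\ in_L nF nE setT setT S,
                 inverse_on D setT (fun x => A x + mu *: B x) S &
                 forall e : R, 0 < e -> exists N0 : nat,
                   forall N : nat, (N0 <= N)%N -> forall y : F,
                   nE (\sum_(0 <= j < N) mu ^ (j%:Z - nu%:Z) *: C j y - S y)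
                     <= e * nF y]]).

Record pencil (k : scalar_kind) (X Y : normedModType (scal R k)) := Pencil {
  dom_A : set X;
  dom_B : set X;
  op_A : X -> Y;
  op_B : X -> Y }.

Definition dom (k : scalar_kind) (X Y : normedModType (scal R k))
    (T : pencil X Y) : set X := dom_A T `&` dom_B T.

Definition regular_pencil (k : scalar_kind) :
    forall X Y : completeNormedModType (scal R k), pencil X Y -> nat -> Prop :=
  match k with
  | over_R => fun X Y T nu =>
      @regular_pencilC (cplx (X : normedModType R)) (cplx (Y : normedModType R))
        (@cplx_norm R X) (@cplx_norm R Y)
        [set z | dom T z.1 /\ dom T z.2]
        (@cplx_map R X Y (op_A T)) (@cplx_map R X Y (op_B T)) nu
  | over_C => fun X Y T nu =>
      @regular_pencilC X Y (@rnorm R over_C X) (@rnorm R over_C Y)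
        (dom T) (op_A T) (op_B T) nu
  end.

End RegularPencil.

Section ADAE.
Context {R : realType} {k : scalar_kind} {X Y : completeNormedModType (scal R k)}.
Implicit Types (T : pencil X Y) (f : R -> X -> Y).

Definition closed_densely_defined (DT : set X) (S : X -> Y) : Prop :=
  [/\ linear_subspace DT, linear_on DT S, dense DT &
      closed [set p : X * Y | DT p.1 /\ p.2 = S p.1]].

Definition dual (Z : normedModType (scal R k)) (p : Z -> scal R k) : Prop :=
  @in_L R _ Z (scal R k)^o (@rnorm R k Z) (@snorm R k) setT setT p.

Definition is_adjoint (DT : set X) (S : X -> Y) (q : Y -> scal R k)
    (p : X -> scal R k) : Prop :=
  dual p /\ forall x, DT x -> p x = q (S x).

Definition adjoint_dom (DT : set X) (S : X -> Y) (q : Y -> scal R k) : Prop :=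
  dual q /\ exists p, is_adjoint DT S q p.

(* S^* q; unique when DT is dense *)
Definition adjoint (DT : set X) (S : X -> Y) (q : Y -> scal R k) :
    X -> scal R k :=
  xget (fun=> 0) [set p | is_adjoint DT S q p].

(* Root vectors rv i j and functionals fn i j are used for 1 <= j <= mult i. *)
Record root_data (n : nat) := RootData {
  mult : 'I_n -> nat;
  rv : 'I_n -> nat -> X;
  fn : 'I_n -> nat -> Y -> scal R k }.

Definition adjA T q := adjoint (dom_A T) (op_A T) q.
Definition adjB T q := adjoint (dom_B T) (op_B T) q.

Definition ker_basis T (n : nat) (e : 'I_n -> X) : Prop :=
  (forall i, dom T (e i) /\ op_A T (e i) = 0) /\
  (forall x, dom T x -> op_A T x = 0 ->
     exists! c : 'I_n -> scal R k, x = \sum_(i < n) c i *: e i).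

Definition root_system T (nu n : nat) (rs : root_data n) : Prop :=
  let m := mult rs in let phi := rv rs in let q := fn rs in
  [/\ ker_basis T (fun i => phi i 1%N),
      (forall i, (1 <= m i <= nu)%N) /\ \max_(i < n) m i = nu,
      forall i j, (1 <= j <= m i)%N -> dom T (phi i j),
      forall i j, (2 <= j <= m i)%N ->
        op_A T (phi i j) = - op_B T (phi i j.-1) &
      [/\ forall i j, (1 <= j <= m i)%N ->
            adjoint_dom (dom_A T) (op_A T) (q i j) /\
            adjoint_dom (dom_B T) (op_B T) (q i j),
          forall i x, adjA T (q i (m i)) x = 0,
          forall i j, (1 <= j < m i)%N ->
            forall x, adjA T (q i j) x = - adjB T (q i j.+1) x &
          forall i i' j l, (1 <= j <= m i)%N -> (1 <= l <= m i')%N ->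
            q i' l (op_B T (phi i j)) = ((i == i') && (j == l))%:R]].

Section Projectors.
Variables (T : pencil X Y) (n : nat) (rs : root_data n).
Let m := mult rs.
Let phi := rv rs.
Let q := fn rs.

Definition P2 (x : X) : X :=
  \sum_(i < n) \sum_(1 <= j < (m i).+1) adjB T (q i j) x *: phi i j.
Definition P1 (x : X) : X := x - P2 x.
Definition P20 (x : X) : X := \sum_(i < n) adjB T (q i 1%N) x *: phi i 1%N.
Definition P2S (x : X) : X :=
  \sum_(i < n | m i != 1%N) \sum_(2 <= j < (m i).+1)
     adjB T (q i j) x *: phi i j.

Definition Q2 (y : Y) : Y :=
  \sum_(i < n) \sum_(1 <= j < (m i).+1) q i j y *: op_B T (phi i j).
Definition Q1 (y : Y) : Y := y - Q2 y.
Definition Q2s (y : Y) : Y :=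
  \sum_(i < n) q i (m i) y *: op_B T (phi i (m i)).
Definition Q2S (y : Y) : Y :=
  \sum_(i < n | m i != 1%N) \sum_(1 <= j < m i) q i j y *: op_B T (phi i j).

Definition D1 : set X := P1 @` dom T.
Definition D20 : set X := P20 @` dom T.
Definition D2S : set X := P2S @` dom T.
Definition Y1 : set Y := range Q1.
Definition Y2s : set Y := range Q2s.
Definition Y2S : set Y := range Q2S.

Definition tildeA (x : X) : Y :=
  op_A T x + \sum_(i < n) adjB T (q i 1%N) x *: op_B T (phi i (m i)).

Definition dnorm (x : X) : R := rnorm (P1 x) + rnorm (P2S x) + rnorm (P20 x).

End Projectors.

Definition dsum (Z : zmodType) (M N : set Z) : set Z :=
  [set z | exists2 a, M a & exists2 b, N b & z = a + b].

Definition open_in (Z : topologicalType) (W M : set Z) : Prop :=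
  exists2 O, open O & M = O `&` W.

Definition Rplus : set R := [set t | 0 <= t].

Definition continuous_rhs T f : Prop :=
  {within [set p : R * X | Rplus p.1 /\ dom T p.2],
    continuous (fun p : R * X => f p.1 p.2)}.

Section Hypotheses.
Variables (T : pencil X Y) (f : R -> X -> Y) (n : nat) (rs : root_data n).
Variables (Mt : set Y) (M20 : set X).

(* tildeA maps dom T bijectively onto Y, so this is tildeA^-1 Mt. *)
Definition M12 : set X := [set x | dom T x /\ Mt (tildeA T rs x)].

Definition L0 (t : R) (x : X) : Prop :=
  [/\ Rplus t, dom T x & Q2s T rs (f t x - op_B T x) = 0].

Definition F2s (t : R) (x1 x2S x20 : X) : Y :=
  Q2s T rs (f t (x1 + x2S + x20)) - Q2s T rs (op_B T (x2S + x20)).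

Definition unique_solvability : Prop :=
  forall t z, Rplus t -> M12 z -> exists! u, M20 u /\ L0 t (z + u).

Definition locally_lipschitz : Prop :=
  forall t' x', Rplus t' -> dom T x' ->
  exists (U : set R) (V : set X) (L : R),
    [/\ open U /\ U t', open V /\ V x', 0 <= L &
        forall t x y, U t -> Rplus t -> V x -> dom T x -> V y -> dom T y ->
          rnorm (f t x - f t y) <= L * dnorm T rs (x - y)].

Definition op_norm (Z Z' : normedModType (scal R k)) (M : set Z)
    (S : Z -> Z') : R :=
  sup [set rnorm (S z) | z in [set z | M z /\ rnorm z <= 1]].

(* The estimate holds for all small radii d = (d1, d2, d3) and e, so that the
   limit of q d e as d, e -> 0 makes sense. *)
Definition approximate_invertibility : Prop :=
  forall t' x1' x2S' x20', D1 T rs x1' -> D2S T rs x2S' ->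
  M12 (x1' + x2S') -> M20 x20' -> L0 t' (x1' + x2S' + x20') ->
  exists (W : X -> Y) (Winv : Y -> X) (q : R * R * R -> R -> R) (d0 e0 l : R),
  [/\ in_L (@rnorm R k X) (@rnorm R k Y) (D20 T rs) (Y2s T rs) W,
      in_L (@rnorm R k Y) (@rnorm R k X) (Y2s T rs) (D20 T rs) Winv,
      inverse_on (D20 T rs) (Y2s T rs) W Winv,
      [/\ 0 < d0, 0 < e0 & forall d1 d2 d3 e : R,
          0 < d1 <= d0 -> 0 < d2 <= d0 -> 0 < d3 <= d0 -> 0 < e <= e0 ->
          forall t x1 x2S u v,
          Rplus t -> `|t - t'| < d1 ->
          D1 T rs x1 -> rnorm (x1 - x1') < d2 ->
          D2S T rs x2S -> rnorm (x2S - x2S') < d3 ->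
          D20 T rs u -> rnorm (u - x20') < e ->
          D20 T rs v -> rnorm (v - x20') < e ->
          rnorm (F2s t x1 x2S u - F2s t x1 x2S v - W (u - v))
            <= q (d1, d2, d3) e * rnorm (u - v)] &
      q p.1 p.2 @[p --> within
          [set p : R * R * R * R |
            [/\ 0 < p.1.1.1, 0 < p.1.1.2, 0 < p.1.2 & 0 < p.2]]
          (nbhs ((0, 0, 0, 0) : R * R * R * R))] --> l /\
      l < (op_norm (Y2s T rs) Winv)^-1].

(* Near a point of L0 lying over M12 and M20, the points of L0 over M12 stay
   over M20.  It holds when M20 is open in D20, and when x20 is unique in all
   of D20.  For an arbitrary set M20 the other hypotheses do not imply it, and
   without it solvability fails: take X = Y = R^2, A = diag(1, 0),
   B = diag(0, 1), f(t, (a, b)) = (- 1, b + (b - a) (b - a - 10)),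
   Mt = ]-1, 1[ x {0}, M20 = {0} x ([0, 1[ `|` ]9, 10[) and x(0) = 0; the only
   candidate, a(t) = - t with b(0) = 0 and b(t) = 10 - t for t > 0, jumps. *)
Definition M20_locally_stable : Prop :=
  forall t' z' u', M12 z' -> M20 u' -> L0 t' (z' + u') ->
  \forall p \near ((t', z' + u') : R * X),
    L0 p.1 p.2 -> M12 (P1 T rs p.2 + P2S T rs p.2) -> M20 (P20 T rs p.2).

End Hypotheses.

(* Where d/dt[Ax] is required: on J = R_+ not at the left endpoint. *)
Definition diff_domain (J : set R) : set R :=
  [set t | J t /\ (J = Rplus -> 0 < t)].

(* One-sided at the endpoints that belong to J *)
Definition derivative_on (J : set R) (g g' : R -> Y) : Prop :=
  forall t, J t ->
  (@of_real R k (s - t))^-1 *: (g s - g t) @[s --> within (J `\ t) (nbhs t)]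
    --> g' t.

Definition is_solution T f (x : R -> X) (J : set R) : Prop :=
  [/\ is_interval J, J `<=` Rplus, {within J, continuous x},
      forall t, J t -> dom T (x t) &
      exists g' : R -> Y,
        [/\ derivative_on (diff_domain J) (fun t => op_A T (x t)) g',
            {within diff_domain J, continuous g'} &
            forall t, diff_domain J t -> g' t + op_B T (x t) = f t (x t)]].

Definition solution_in T f (S : set X) (x : R -> X) (J : set R) : Prop :=
  is_solution T f x J /\ forall t, J t -> S (x t).

(* Only extensions to the right are considered. *)
Definition maximal_solution_in T f (S : set X) (x : R -> X) (J : set R) :
    Prop :=
  solution_in T f S x J /\
  forall (J' : set R) (y : R -> X), solution_in T f S y J' -> J `<=` J' ->
    (forall s, J' s -> exists2 t, J t & t <= s) ->
    (forall t, J t -> y t = x t) -> J' = J.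

Definition from_until (t0 : R) (tmax : \bar R) : set R :=
  [set t | t0 <= t /\ (t%:E < tmax)%E].

(* Uniqueness is stated on [t0, tmax) and on its initial subintervals. *)
Definition ivp_unique_maximal_solution_in T f (S : set X) (t0 : R) (x0 : X) :
    Prop :=
  exists tmax : \bar R, (t0%:E < tmax)%E /\
  exists x : R -> X,
    [/\ x t0 = x0, maximal_solution_in T f S x (from_until t0 tmax) &
        forall (J : set R) (y : R -> X), J t0 -> J `<=` from_until t0 tmax ->
          solution_in T f S y J -> y t0 = x0 -> forall t, J t -> y t = x t].

End ADAE.

(* Main.v *)
(* Proof idea. Write w = Ax. The operator tildeA is a bijection of D onto Y whose
   inverse S, as well as B S, is bounded: this is an open mapping argument applied
   to the closed relation {((x, Bx), tildeA x)}, surjectivity following from the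
   solvability of Ax + mu Bx = y for small mu > 0. A contraction argument on
   u - Winv F2s(t, z, u) makes x20 = u(t, z) a continuous function of (t, z), locally
   Lipschitz in z; local stability of M20 and uniqueness identify it with the given
   solution of the algebraic equation. The problem thus becomes the ordinary
   differential equation w' = f(t, x) - Bx with x = S w + u(t, S w), on a relatively
   open set of the closed subspace Y1 + Y2S, to which Picard iteration and
   continuation apply. A solution on R_+ need not have Ax differentiable at 0; the
   linear growth of w' in w and the closedness of A still make Ax continuous there. *)
Require Import Defs.
From HB Require Import structures.
From mathcomp Require Import all_boot all_order all_algebra.
From mathcomp Require Import all_classical all_reals all_analysis.
From mathcomp Require Import complex ring lra.
Set Implicit Arguments.
Unset Strict Implicit.
Unset Printing Implicit Defensive.
Import Order.TTheory GRing.Theory Num.Theory.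
Import numFieldNormedType.Exports.
Local Open Scope classical_set_scope.
Local Open Scope ring_scope.

(** * Restriction of scalars to the reals *)

Section RealScalars.
Context {R : realType} {k : scalar_kind}.
Local Notation K := (scal R k).
Local Notation rho := (@of_real R k).

(** Norms take values in the scalar field while time increments are real, so both kinds of spaces
    are regarded as real Banach spaces for all analysis; linearity over the scalar field is kept for
    the functionals and projectors. The bound on [x] and [B x] is therefore proved over the range of
    [tildeA], which is closed because that of [A] is. Applied to the solutions of
    [A x + mu B x = y], it keeps [B x] bounded as [mu] tends to 0, and only then is the range seen
    to be everything. The bound on [B x] matters again in the reduced equation. There [f] is
    controlled in the norm of [X] alone, while [B x] appears explicitly and [B] is unbounded in
    general; it splits into [B (S w)] and [B] on the finite-dimensional [D20], both continuous. *)

Lemma of_realD (a b : R) : rho (a + b) = rho a + rho b.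
Proof. by case: k => //=; rewrite rmorphD. Qed.

Lemma of_realM (a b : R) : rho (a * b) = rho a * rho b.
Proof. by case: k => //=; rewrite rmorphM. Qed.

Lemma of_real0 : rho 0 = 0.
Proof. by case: k. Qed.

Lemma of_real1 : rho 1 = 1.
Proof. by case: k. Qed.

Lemma of_realV (a : R) : rho a^-1 = (rho a)^-1.
Proof. by case: k => //=; rewrite fmorphV. Qed.

Lemma ler_of_real (a b : R) : (rho a <= rho b) = (a <= b).
Proof. by case: k => //=; rewrite lecR. Qed.

Lemma ltr_of_real (a b : R) : (rho a < rho b) = (a < b).
Proof. by case: k => //=; rewrite ltcR. Qed.

Lemma norm_of_real (a : R) : `|rho a| = rho `|a|.
Proof. by case: k => //=; rewrite normc_def /= expr0n addr0 sqrtr_sqr. Qed.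

Lemma real_partK (a : K) : 0 <= a -> rho (real_part a) = a.
Proof. by move: a; case: k => //= a a0; rewrite RRe_real// ger0_real. Qed.

Lemma of_realK (a : R) : real_part (rho a) = a.
Proof. by case: k. Qed.

Lemma of_real_rnorm (Z : normedModType K) (x : Z) : rho (rnorm x) = `|x|.
Proof. exact/real_partK/normr_ge0. Qed.
End RealScalars.

(* The Banach space underlying a real or complex one by restriction of scalars;
   its topology is that of X. *)
Definition realify (R : realType) (k : scalar_kind)
  (X : completeNormedModType (scal R k)) : Type := X.

Section Realify.
Context {R : realType} {k : scalar_kind}.
Variable X : completeNormedModType (scal R k).
Local Notation rho := (@of_real R k).
Local Notation XR := (realify X).

HB.instance Definition _ := GRing.Zmodule.copy XR X.
HB.instance Definition _ := Uniform.copy XR X.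
HB.instance Definition _ := isPointed.Build XR (@point X).

Definition realify_scale (a : R) (x : XR) : XR := (rho a *: (x : X)) : X.

Fact realify_scaleA (a b : R) (x : XR) :
  realify_scale a (realify_scale b x) = realify_scale (a * b) x.
Proof. by rewrite /realify_scale scalerA of_realM. Qed.
Fact realify_scale1 : left_id 1 realify_scale.
Proof. by move=> x; rewrite /realify_scale of_real1 scale1r. Qed.
Fact realify_scaleDr : right_distributive realify_scale +%R.
Proof. by move=> a x y; rewrite /realify_scale -scalerDr. Qed.
Fact realify_scaleDl (x : XR) : {morph realify_scale^~ x : a b / a + b}.
Proof. by move=> a b; rewrite /realify_scale of_realD scalerDl. Qed.

HB.instance Definition _ := GRing.Zmodule_isLmodule.Build R XR
  realify_scaleA realify_scale1 realify_scaleDr realify_scaleDl.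

Definition realify_norm (x : XR) : R := rnorm (x : X).

Fact realify_ler_normD (x y : XR) :
  realify_norm (x + y) <= realify_norm x + realify_norm y.
Proof. by rewrite -(@ler_of_real R k) of_realD !of_real_rnorm ler_normD. Qed.

Fact realify_normrZ (a : R) (x : XR) :
  realify_norm (a *: x) = `|a| * realify_norm x.
Proof.
apply: (can_inj (@of_realK R k)).
by rewrite of_realM -norm_of_real !of_real_rnorm normrZ.
Qed.

Fact realify_normr0_eq0 (x : XR) : realify_norm x = 0 -> x = 0.
Proof.
move=> x0; apply: (@normr0_eq0 _ X).
by rewrite -of_real_rnorm -[rnorm _]/(realify_norm x) x0 of_real0.
Qed.

Fact realify_normrMn (x : XR) n : realify_norm (x *+ n) = realify_norm x *+ n.
Proof.
by rewrite -scaler_nat realify_normrZ ger0_norm// mulr_natl.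
Qed.

Fact realify_normrN (x : XR) : realify_norm (- x) = realify_norm x.
Proof. by rewrite -scaleN1r realify_normrZ normrN1 mul1r. Qed.

HB.instance Definition _ := Num.Zmodule_isNormed.Build R XR
  realify_ler_normD realify_normr0_eq0 realify_normrMn realify_normrN.

Let rball (x : XR) (e : R) : set XR := ball_ Num.norm x e.

Fact realify_ball_center (x : XR) (e : R) : 0 < e -> rball x e x.
Proof. by rewrite /rball /ball_/= subrr normr0. Qed.
Fact realify_ball_sym (x y : XR) (e : R) : rball x e y -> rball y e x.
Proof. by rewrite /rball /ball_/= distrC. Qed.
Fact realify_ball_triangle (x y z : XR) (e1 e2 : R) :
  rball x e1 y -> rball y e2 z -> rball x (e1 + e2) z.
Proof.
rewrite /rball /ball_/= => h1 h2; rewrite -(subrKA y).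
by rewrite (le_lt_trans (ler_normD _ _))// ltrD.
Qed.
(** A positive element of the scalar field is real, so balls with radii in the scalar field and
    balls with real radii generate the same uniformity. The topology of [X] is thus kept as it is,
    and closedness and completeness transfer at once. *)
Fact realify_entourageE : (entourage : set_system (XR * XR)) = entourage_ rball.
Proof.
rewrite -[LHS]/(entourage : set_system (X * X)) -entourage_ballE.
rewrite predeqE => A; split=> -[e /= e0 eA].
  exists (real_part e) => /=.
    by rewrite -(@ltr_of_real R k) real_partK ?of_real0// ltW.
  move=> [x y] /= xy; apply: eA => /=; rewrite -ball_normE /= -of_real_rnorm.
  by rewrite -[e]real_partK ?ltr_of_real// ltW.
exists (rho e) => /=; first by rewrite -(@of_real0 R k) ltr_of_real.
move=> [x y] /= xy; apply: eA => /=.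
by move: xy; rewrite -ball_normE /= -of_real_rnorm ltr_of_real.
Qed.

HB.instance Definition _ := Uniform_isPseudoMetric.Build R XR
  realify_ball_center realify_ball_sym realify_ball_triangle realify_entourageE.
HB.instance Definition _ := NormedZmod_PseudoMetric_eq.Build R XR erefl.
HB.instance Definition _ :=
  PseudoMetricNormedZmod_Lmodule_isNormedModule.Build R XR realify_normrZ.
HB.instance Definition _ := Uniform_isComplete.Build XR (@cauchy_cvg X).

End Realify.

(** * Open mapping theorem for closed relations *)

Section HalvingSequences.
Context {R : realType} {V : completeNormedModType R}.

Lemma halving_cvg0 (c : nat -> R) : (forall n, 0 <= c n) ->
  (forall n, c n.+1 <= c n / 2) -> c @ \oo --> 0.
Proof.
move=> c0 cS.
have cle n : c n <= c 0%N * 2^-1 ^+ n.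
  elim: n => [|n ih]; first by rewrite expr0 mulr1.
  by rewrite (le_trans (cS n))// exprSr mulrA ler_pM2r.
apply: (@squeeze_cvgr _ _ _ _ (fun=> 0) (geometric (c 0%N) 2^-1)).
- by near=> n; rewrite c0 /= cle.
- exact: cvg_cst.
- by apply: cvg_geometric; rewrite ger0_norm// invf_lt1// ltr1n.
Unshelve. all: by end_near. Qed.

Lemma halving_steps_cvg (u : nat -> V) (c : nat -> R) :
  (forall n, `|u n.+1 - u n| <= c n) -> (forall n, c n.+1 <= c n / 2) ->
  exists2 l, u @ \oo --> l & forall n, `|l - u n| <= 2 * c n.
Proof.
move=> uS cS.
have c0 n : 0 <= c n by exact: le_trans (normr_ge0 _) (uS n).
(* Subtracting the tail [2 * c (n + m)] makes the induction close: a further step costs at most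
   [c (n + m)], and halving frees at least that much. *)
have ub n m : `|u (n + m)%N - u n| <= 2 * c n - 2 * c (n + m)%N.
  elim: m => [|m ih]; first by rewrite addn0 !subrr normr0.
  rewrite addnS; have := uS (n + m)%N; have := cS (n + m)%N.
  have := ler_normD (u (n + m).+1 - u (n + m)%N) (u (n + m)%N - u n).
  by rewrite subrKA; lra.
have ub' n m : (n <= m)%N -> `|u m - u n| <= 2 * c n.
  move=> nm; rewrite -(subnKC nm); have := ub n (m - n)%N.
  by have := c0 (n + (m - n))%N; lra.
have cu : cvgn u.
  apply: cauchy_cvg; apply: cauchy_exP => e e0.
  have /cvgrPdist_lt /(_ (e / 2)) := halving_cvg0 c0 cS.
  rewrite divr_gt0// => /(_ isT) [N _ Nc]; exists (u N), N => // m /= Nm.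
  rewrite -ball_normE /= distrC (le_lt_trans (ub' _ _ Nm))//.
  have := Nc N (leqnn N); rewrite /= sub0r normrN ger0_norm//; lra.
exists (limn u) => // n.
have cun : `|u m - u n| @[m --> \oo] --> `|limn u - u n|.
  by apply: cvg_norm; apply: cvgB => //; exact: cvg_cst.
rewrite -(cvg_lim _ cun)//; apply: limr_le; first by apply/cvg_ex; exists `|limn u - u n|.
by exists n => // m /= nm; exact: ub'.
Qed.
End HalvingSequences.

Section ClosedRelation.
Context {R : realType} {E1 E2 G : completeNormedModType R}.
Variable Gam : E1 -> E2 -> G -> Prop.
Hypothesis Gam_closed : closed [set p : E1 * E2 * G | Gam p.1.1 p.1.2 p.2].
Hypothesis Gam0 : Gam 0 0 0.
Hypothesis GamD : forall x y z x' y' z',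
  Gam x y z -> Gam x' y' z' -> Gam (x + x') (y + y') (z + z').
Hypothesis GamZ : forall (a : R) x y z,
  Gam x y z -> Gam (a *: x) (a *: y) (a *: z).
Let V : set G := [set z | exists x y, Gam x y z].
Hypothesis V_closed : closed V.

Let S (n : R) (z : G) := exists x y, [/\ Gam x y z, `|x| <= n & `|y| <= n].

Let GamB x y z x' y' z' :
  Gam x y z -> Gam x' y' z' -> Gam (x - x') (y - y') (z - z').
Proof. by move=> h /(GamZ (-1)); rewrite !scaleN1r; exact: GamD. Qed.

Let VB z z' : V z -> V z' -> V (z - z').
Proof.
by move=> [x [y h]] [x' [y' h']]; exists (x - x'), (y - y'); exact: GamB.
Qed.

Let VZ a z : V z -> V (a *: z).
Proof. by move=> [x [y h]]; exists (a *: x), (a *: y); exact: GamZ. Qed.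

(* The Baire theorem of the library is about a whole Banach space; V is only a
   closed subset of one, so nested balls are built by hand. *)
Let baire : exists (n : nat) (z0 : G) (r : R), [/\ V z0, 0 < r &
  forall z, V z -> `|z - z0| < r ->
    forall e, 0 < e -> exists2 s, S n%:R s & `|z - s| < e].
Proof.
apply: contrapT => H.
(* If no [S n] is dense in a relative ball of [V], every such ball contains a smaller one that stays
   away from [S n]. The radius [e / 2] leaves room to the points of [S n], all at distance at least
   [e] from the new centre. *)
have step (n : nat) (zr : G * R) : exists zr' : G * R, V zr.1 -> 0 < zr.2 ->
    [/\ V zr'.1, 0 < zr'.2, zr'.2 <= zr.2 / 2, `|zr'.1 - zr.1| <= zr.2 / 4 &
    forall s, S n%:R s -> zr'.2 < `|zr'.1 - s|].
  case: zr => z r /=; apply: contrapT => nex; apply: H.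
  have [[Vz r0]|nV] := pselect (V z /\ 0 < r); last first.
    by exfalso; apply: nex; exists (0, 0) => Vz r0; exfalso; apply: nV.
  exists n, z, (r / 4); split=> //; first by rewrite divr_gt0.
  move=> z' Vz' z'z e e0; apply: contrapT => ns; apply: nex.
  exists (z', Num.min (r / 2) (e / 2)) => _ _ /=; split=> //.
  - by rewrite lt_min !divr_gt0.
  - by rewrite ge_min lexx.
  - exact: ltW.
  - move=> s Ss; have : e <= `|z' - s|.
      by rewrite leNgt; apply/negP => zs; apply: ns; exists s.
    by rewrite gt_min => h; apply/orP; right; lra.
have [F HF] := choice (fun p : nat * (G * R) => step p.1 p.2).
pose zr := fix zr n := if n is m.+1 then F (m, zr m) else (0 : G, 1 : R).
have V0 : V 0 by exists 0, 0.
have zrP n : V (zr n).1 /\ 0 < (zr n).2.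
  elim: n => [//|n [Vn rn]] /=.
  by have [] := HF (n, zr n) Vn rn.
have zrS n := HF (n, zr n) (zrP n).1 (zrP n).2.
(* Centres move by at most a quarter of the radius, so the limit is within half the radius of every
   centre and avoids each [S n]; yet it lies in the closed set [V], hence in some [S n]. *)
have [l zl lz] := @halving_steps_cvg R G (fun n => (zr n).1)
    (fun n => (zr n).2 / 4) (fun n => let: And5 _ _ _ h _ := zrS n in h)
    (fun n => ltac:(have [_ _ h _ _] := zrS n; rewrite /=; lra)).
have [x [y Gl]] : V l.
  by apply: closed_cvg zl => //; apply: nearW => n; exact: (zrP n).1.
pose m := Num.max `|x| `|y|.
have [n mn] : exists n : nat, m <= n%:R.
  by exists (Num.truncn m).+1; exact/ltW/truncnS_gt.
have [_ _ _ _ /(_ l)] := zrS n.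
have := lz n.+1; have := (zrP n.+1).2; rewrite distrC /= => r0 h h'.
have : S n%:R l.
  by exists x, y; split=> //; apply: le_trans mn; rewrite le_max lexx ?orbT.
by move/h'; lra.
Qed.

(** Differences of points of [S n] near [z0] approximate every small vector of [V], and homogeneity
    does the rest: with [a = r / (2 |z|)] the vector [a z] has norm [r / 2], and a difference of
    size [2 n] divided by [a] has size [4 n |z| / r]. Using [n.+1] keeps the constant positive. *)
Let approx : exists2 C : R, 0 < C & forall z, V z -> forall e, 0 < e ->
  exists2 s, S (C * `|z|) s & `|z - s| < e.
Proof.
have [n [z0 [r [Vz0 r0 H]]]] := baire.
exists (n.+1%:R * 4 / r); first by rewrite !mulr_gt0 ?invr_gt0.
move=> z Vz e e0; have [->|z_neq0] := eqVneq z 0.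
  by exists 0; [exists 0, 0; rewrite !normr0 mulr0 | rewrite subrr normr0].
have nz : 0 < `|z| by rewrite normr_gt0.
pose a := r / (2 * `|z|).
have a0 : 0 < a by rewrite divr_gt0// mulr_gt0.
have [s1 [x1 [y1 [g1 b1 b1']]] h1] : exists2 s : G, S n%:R s &
    `|(z0 + a *: z) - s| < a * e / 2.
  apply: H; last by rewrite divr_gt0// mulr_gt0.
    by rewrite -[a *: z]opprK -scaleNr; apply: VB => //; exact: VZ.
  rewrite addrAC subrr add0r normrZ gtr0_norm// /a invfM mulrA mulfVK ?gt_eqF//.
  by lra.
have [s2 [x2 [y2 [g2 b2 b2']]] h2] : exists2 s : G, S n%:R s & `|z0 - s| < a * e / 2.
  by apply: H => //; rewrite ?subrr ?normr0// divr_gt0// mulr_gt0.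
exists (a^-1 *: (s1 - s2)).
  exists (a^-1 *: (x1 - x2)), (a^-1 *: (y1 - y2)); split.
  - exact/GamZ/GamB.
  - rewrite normrZ gtr0_norm ?invr_gt0// /a invf_div.
    have := ler_normB x1 x2; rewrite -natr1 => h.
    rewrite [leRHS](_ : _ = (2 * `|z|) / r * (2 * (n%:R + 1))); last by field; lra.
    by apply: ler_wpM2l; [rewrite divr_ge0// ltW|lra].
  - rewrite normrZ gtr0_norm ?invr_gt0// /a invf_div.
    have := ler_normB y1 y2; rewrite -natr1 => h.
    rewrite [leRHS](_ : _ = (2 * `|z|) / r * (2 * (n%:R + 1))); last by field; lra.
    by apply: ler_wpM2l; [rewrite divr_ge0// ltW|lra].
have -> : z - a^-1 *: (s1 - s2) = a^-1 *: ((z0 + a *: z - s1) - (z0 - s2)).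
  have -> : z0 + a *: z - s1 - (z0 - s2) = a *: z - (s1 - s2).
    by rewrite opprB -(addrA z0) [LHS]addrC [LHS]addrA (subrK z0) opprB addrCA.
  by rewrite [RHS]scalerBr scalerA mulVf ?gt_eqF// scale1r.
rewrite normrZ gtr0_norm ?invr_gt0// mulrC ltr_pdivrMr//.
have := ler_normB (z0 + a *: z - s1) (z0 - s2); lra.
Qed.

(** Approximate solutions become exact by repeatedly solving for the residual, which is halved each
    time: the corrections have size [C |z| / 2 ^ n] and sum to [2 C |z|], and closedness of [Gam]
    keeps the limit in the relation. Two source components allow two quantities to be bounded at
    once. *)
Theorem closed_relation_open : exists2 C : R, 0 < C &
  forall z, (exists x y, Gam x y z) ->
    exists x y, [/\ Gam x y z, `|x| <= C * `|z| & `|y| <= C * `|z|].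
Proof.
have [C C0 H] := approx; exists (2 * C); first by lra.
move=> z Vz; have [->|z_neq0] := eqVneq z 0.
  by exists 0, 0; rewrite !normr0 mulr0.
have nz : 0 < `|z| by rewrite normr_gt0.
pose c n : R := `|z| * 2^-1 ^+ n.
have c0 n : 0 < c n by rewrite mulr_gt0// exprn_gt0.
have step (n : nat) (p : E1 * E2 * G) : exists q : E1 * E2 * G,
    Gam p.1.1 p.1.2 p.2 -> `|z - p.2| <= c n ->
    [/\ Gam q.1.1 q.1.2 q.2, `|z - q.2| <= c n.+1,
      `|q.1.1 - p.1.1| <= C * c n & `|q.1.2 - p.1.2| <= C * c n].
  case: p => [[x y] s] /=.
  have [G0|nG] := pselect (Gam x y s); last by exists (0,0,0).
  have [s' [x' [y' [G' bx by']]] hs] := H (z - s) (VB Vz (ex_intro _ x (ex_intro _ y G0))) _ (c0 n.+1).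
  exists (x + x', y + y', s + s') => _ b /=; split.
  - exact: GamD.
  - by rewrite opprD addrA ltW.
  - by rewrite addrAC subrr add0r (le_trans bx)// ler_wpM2l// ltW.
  - by rewrite addrAC subrr add0r (le_trans by')// ler_wpM2l// ltW.
have [F HF] := choice (fun p : nat * (E1 * E2 * G) => step p.1 p.2).
pose u := fix u n := if n is m.+1 then F (m, u m) else (0 : E1, 0 : E2, 0 : G).
have uP n : Gam (u n).1.1 (u n).1.2 (u n).2 /\ `|z - (u n).2| <= c n.
  elim: n => [|n [Gn bn]].
    by split=> //=; rewrite subr0 /c expr0 mulr1.
  by have [] := HF (n, u n) Gn bn.
have uS n := HF (n, u n) (uP n).1 (uP n).2.
have cS n : C * c n.+1 <= C * c n / 2 by rewrite /c exprSr !mulrA.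
have [x xl xb] := @halving_steps_cvg R E1 (fun n => (u n).1.1) _
   (fun n => let: And4 _ _ h _ := uS n in h) cS.
have [y yl yb] := @halving_steps_cvg R E2 (fun n => (u n).1.2) _
   (fun n => let: And4 _ _ _ h := uS n in h) cS.
have zl : (fun n => (u n).2) @ \oo --> z.
  apply/cvgrPdist_le => e e0.
  have /cvgrPdist_le /(_ e e0) [N _ HN] : c @ \oo --> 0.
    apply: halving_cvg0 => n; first exact/ltW.
    by rewrite /c exprSr !mulrA.
  exists N => // n /= Nn; rewrite (le_trans (uP n).2)//.
  by have := HN n Nn; rewrite sub0r normrN gtr0_norm.
exists x, y; split.
- suff : [set p : E1 * E2 * G | Gam p.1.1 p.1.2 p.2] (x, y, z) by [].
  apply: (@closed_cvg _ _ \oo _ (fun n => ((u n).1.1, (u n).1.2, (u n).2)) _ Gam_closed).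
    by apply: nearW => n; exact: (uP n).1.
  exact: (cvg_pair (cvg_pair xl yl) zl).
- by have := xb 0%N; rewrite /= /c expr0 mulr1 subr0 mulrA.
- by have := yb 0%N; rewrite /= /c expr0 mulr1 subr0 mulrA.
Qed.
End ClosedRelation.

(** * Calculus in a real Banach space *)

Lemma addrBD (V : zmodType) (a b c d : V) : a + b - (c + d) = (a - c) + (b - d).
Proof. by rewrite opprD addrACA. Qed.

(** Plays the role of compactness of the segment: local information is chained up to [b] without a
    finite subcover. The supremum of the points reached so far is itself reached and cannot lie
    below [b]. *)
Lemma real_induction (R : realType) (a b : R) (P : R -> Prop) : a <= b ->
  P a ->
  (forall t, a <= t -> t < b -> P t ->
     exists2 d : R, 0 < d & forall s, t < s -> s < t + d -> s <= b -> P s) ->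
  (forall t, a < t -> t <= b -> (forall s, a <= s -> s < t -> P s) -> P t) ->
  P b.
Proof.
move=> ab Pa step lim.
pose S := [set t | [/\ a <= t, t <= b & forall s, a <= s -> s <= t -> P s]].
have Sa : S a by split=> // s as_ sa; rewrite (_ : s = a)//; apply/eqP; rewrite eq_le sa.
have supS : has_sup S by split; [exists a | exists b => s []].
have aS : a <= sup S by apply: sup_ubound => //; case: supS.
have Sb : sup S <= b by apply: ge_sup; [exists a | move=> s []].
have below s : a <= s -> s < sup S -> P s.
  move=> as_ sS; have e0 : 0 < sup S - s by rewrite subr_gt0.
  have [t [_ _ Pt]] := sup_adherent e0 supS.
  by rewrite subKr => st; apply: Pt => //; exact: ltW.
have Psup : P (sup S).
  move: aS; rewrite le_eqVlt => /predU1P[<-//|aS].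
  by apply: lim => // s; exact: below.
have [bS|Sltb] := leP b (sup S).
  by have -> : b = sup S by apply/eqP; rewrite eq_le bS.
have [d d0 Pd] := step _ aS Sltb Psup.
pose t := Num.min (sup S + d / 2) b.
have St : S t.
  split.
  - by rewrite /t le_min ab andbT (le_trans aS)// lerDl ltW// divr_gt0.
  - by rewrite /t ge_min lexx orbT.
  - move=> s as_; rewrite /t le_min => /andP[sd sb].
    have [sS|Ss|->//] := ltgtP s (sup S); first exact: below.
    apply: Pd => //; lra.
have : t <= sup S by apply: sup_ubound => //; case: supS.
by rewrite /t ge_min (leNgt b) Sltb orbF => ?; lra.
Qed.

Section VectorCalculus.
Context {R : realType} {E : completeNormedModType R}.
Implicit Types (J : set R) (u g : R -> E) (t : R).

Definition cont_in J u t := forall e : R, 0 < e -> exists2 d : R, 0 < d &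
  forall s, J s -> `|s - t| < d -> `|u s - u t| <= e.

(** Multiplied out, so that [s = t] needs no exclusion, and relative to [J], so that endpoints get
    one-sided derivatives. At a point that is not a limit point of [J] every [v] qualifies. *)
Definition deriv_in J u t (v : E) :=
  forall e : R, 0 < e -> exists2 d : R, 0 < d &
  forall s, J s -> `|s - t| < d ->
    `|u s - u t - (s - t) *: v| <= e * `|s - t|.

Lemma cont_inW J J' u t : J' `<=` J -> cont_in J u t -> cont_in J' u t.
Proof.
by move=> JJ' cu e /cu[d d0 H]; exists d => // s J's; apply: H; exact: JJ'.
Qed.

Lemma deriv_inW J J' u t v : J' `<=` J -> deriv_in J u t v -> deriv_in J' u t v.
Proof.
by move=> JJ' cu e /cu[d d0 H]; exists d => // s J's; apply: H; exact: JJ'.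
Qed.

Lemma cont_inD J u g t : cont_in J u t -> cont_in J g t ->
  cont_in J (fun s => u s + g s) t.
Proof.
move=> cu cg e e0; have e20 : 0 < e / 2 by rewrite divr_gt0.
have [d d0 H] := cu _ e20; have [d' d'0 H'] := cg _ e20.
exists (Num.min d d'); first by rewrite lt_min d0.
move=> s Js; rewrite lt_min => /andP[sd sd'].
rewrite addrBD (le_trans (ler_normD _ _))//.
by have := H s Js sd; have := H' s Js sd'; lra.
Qed.

Lemma cont_inN J u t : cont_in J u t -> cont_in J (fun s => - u s) t.
Proof.
move=> cu e /cu[d d0 H]; exists d => // s Js sd.
by rewrite -opprD normrN; exact: H.
Qed.

Lemma deriv_inD J u g t v w : deriv_in J u t v -> deriv_in J g t w ->
  deriv_in J (fun s => u s + g s) t (v + w).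
Proof.
move=> cu cg e e0; have e20 : 0 < e / 2 by rewrite divr_gt0.
have [d d0 H] := cu _ e20; have [d' d'0 H'] := cg _ e20.
exists (Num.min d d'); first by rewrite lt_min d0.
move=> s Js; rewrite lt_min => /andP[sd sd'].
rewrite addrBD scalerDr addrBD (le_trans (ler_normD _ _))//.
by have := H s Js sd; have := H' s Js sd'; lra.
Qed.

Lemma deriv_inN J u t v : deriv_in J u t v -> deriv_in J (fun s => - u s) t (- v).
Proof.
move=> cu e /cu[d d0 H]; exists d => // s Js sd.
by rewrite scalerN -!opprD normrN; exact: H.
Qed.

Lemma deriv_in_cst J c t : deriv_in J (fun=> c) t 0.
Proof.
move=> e e0; exists 1 => // s _ _.
by rewrite subrr scaler0 subr0 normr0 mulr_ge0// ltW.
Qed.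

Lemma cont_in_cst J c t : cont_in J (fun=> c) t.
Proof. by move=> e e0; exists 1 => // s _ _; rewrite subrr normr0 ltW. Qed.

Lemma deriv_in_cont J u t v : deriv_in J u t v -> cont_in J u t.
Proof.
move=> du e e0; have [d d0 H] := du 1 ltr01.
have nv : 0 < 1 + `|v| by rewrite ltr_wpDr.
exists (Num.min d (e / (1 + `|v|))); first by rewrite lt_min d0 divr_gt0.
move=> s Js; rewrite lt_min ltr_pdivlMr// => /andP[sd se].
rewrite -[u s - u t](subrK ((s - t) *: v)) (le_trans (ler_normD _ _))//.
rewrite normrZ; have := H s Js sd; lra.
Qed.

Lemma norm_le_of_local (u : R -> E) (a b K : R) : a <= b ->
  (forall t, a <= t <= b -> cont_in `[a, b] u t) ->
  (forall t, a <= t -> t < b -> exists2 d : R, 0 < d &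
     forall s, t < s -> s < t + d -> s <= b -> `|u s - u t| <= K * (s - t)) ->
  `|u b - u a| <= K * (b - a).
Proof.
move=> ab cu loc.
apply: (@real_induction _ a b (fun t => `|u t - u a| <= K * (t - a))) => //.
- by rewrite !subrr normr0 mulr0.
- move=> t at_ tb Pt; have [d d0 H] := loc t at_ tb; exists d => // s ts sd sb.
  rewrite -(subrKA (u t)) (le_trans (ler_normD _ _))//.
  by have := H s ts sd sb; lra.
- move=> t at_ tb H; rewrite leNgt; apply/negP => lt.
  (* [e] is a third of the excess. At [t - r / 2] the bound is known; passing from there to [t]
     changes [u] by at most [e] and [K * (t - a)] by at most [e / 2], which cannot produce an excess
     of [3 * e]. *)
  pose e := (`|u t - u a| - K * (t - a)) / 3.
  have e0 : 0 < e by rewrite divr_gt0// subr_gt0.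
  have [|d d0 cd] := cu t _ e e0; first by rewrite (ltW at_).
  have K0 : 0 < `|K| + 1 by rewrite ltr_wpDl.
  pose r := Num.min (Num.min d (t - a)) (e / (`|K| + 1)).
  have r0 : 0 < r by rewrite !lt_min d0 subr_gt0 at_ divr_gt0.
  have : [/\ r <= d, r <= t - a & r <= e / (`|K| + 1)].
    by rewrite /r !ge_min !lexx !orbT.
  rewrite ler_pdivlMr// => -[rd ra re].
  have sin : t - r / 2 \in `[a, b] by rewrite in_itv/=; apply/andP; split; lra.
  have tr : `|t - r / 2 - t| = r / 2.
    by rewrite addrAC subrr add0r normrN gtr0_norm ?divr_gt0.
  have {}H := H (t - r / 2).
  have h1 : `|u (t - r / 2) - u a| <= K * (t - r / 2 - a) by apply: H; lra.
  have h2 : `|u (t - r / 2) - u t| <= e by apply: cd => //; rewrite tr; lra.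
  have h3 : `|u t - u a| <= `|u (t - r / 2) - u t| + `|u (t - r / 2) - u a|.
    by rewrite -(subrKA (u (t - r / 2))) (le_trans (ler_normD _ _))// distrC.
  have h4 : - K <= `|K| by rewrite -normrN ler_norm.
  have h5 : - K * (r / 2) <= `|K| * (r / 2) by rewrite ler_wpM2r// divr_ge0// ltW.
  have : e * 3 = `|u t - u a| - K * (t - a) by rewrite /e divfK.
  move=> h6; lra.
Qed.

(** For vector values no intermediate point realizes the slope, so the inequality is propagated
    along the segment. Derivatives are given in the open interval only: the slope [C + e] is
    obtained on [[c, b]], with [c] close to [a]. *)
Lemma mean_value_le (u : R -> E) (a b C : R) : a <= b ->
  (forall t, a <= t <= b -> cont_in `[a, b] u t) ->
  (forall t, a < t < b -> exists2 v, deriv_in `[a, b] u t v & `|v| <= C) ->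
  `|u b - u a| <= C * (b - a).
Proof.
rewrite le_eqVlt => /predU1P[<-|ab] cu du; first by rewrite !subrr normr0 mulr0.
have C0 : 0 <= C.
  by have [|v _] := du ((a + b) / 2); [lra | exact: le_trans].
have inner e c : 0 < e -> a < c -> c < b -> `|u b - u c| <= (C + e) * (b - c).
  move=> e0 ac cb; have sub : `[c, b] `<=` `[a, b].
    by move=> s /=; rewrite !in_itv/= => /andP[? ->]; rewrite andbT; lra.
  apply: norm_le_of_local; first exact: ltW.
    move=> t /andP[ct tb]; apply: cont_inW sub _; apply: cu.
    by rewrite tb andbT; lra.
  move=> t ct tb; have [|v dv vC] := du t; first by rewrite tb andbT; lra.
  have [d d0 H] := dv e e0; exists d => // s ts sd sb.
  have sab : `[a, b]%classic s by rewrite /= in_itv/= sb andbT; lra.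
  have := H s sab; rewrite gtr0_norm ?subr_gt0// => h.
  have {}h : `|u s - u t - (s - t) *: v| <= e * (s - t) by apply: h; lra.
  rewrite -[u s - u t](subrK ((s - t) *: v)) (le_trans (ler_normD _ _))//.
  rewrite normrZ gtr0_norm ?subr_gt0//.
  have : (s - t) * `|v| <= (s - t) * C by rewrite ler_wpM2l// subr_ge0 ltW.
  lra.
rewrite leNgt; apply/negP => lt.
(* The relaxed slope costs [e * (b - a)] and the gap [[a, c]] costs [e], together a third of the
   excess. *)
pose e := (`|u b - u a| - C * (b - a)) / (3 * (1 + (b - a))).
have ba0 : 0 < b - a by rewrite subr_gt0.
have e0 : 0 < e by rewrite divr_gt0 ?subr_gt0// mulr_gt0// addr_gt0.
have eE : e * (3 * (1 + (b - a))) = `|u b - u a| - C * (b - a).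
  by rewrite /e divfK// gt_eqF// mulr_gt0// addr_gt0.
have [|d d0 cd] := cu a _ e e0; first by rewrite lexx ltW.
pose c := a + Num.min d (b - a) / 2.
have m0 : 0 < Num.min d (b - a) by rewrite lt_min d0.
have md : Num.min d (b - a) <= d by rewrite ge_min lexx.
have mba : Num.min d (b - a) <= b - a by rewrite ge_min lexx orbT.
have ac : a < c by rewrite /c ltrDl divr_gt0.
have cb : c < b by rewrite /c; lra.
have h1 := inner e c e0 ac cb.
have h2 : `|u c - u a| <= e.
  apply: cd; first by rewrite /= in_itv/= !ltW.
  by rewrite gtr0_norm ?subr_gt0// /c; lra.
have h3 : `|u b - u a| <= `|u b - u c| + `|u c - u a|.
  by rewrite -(subrKA (u c)) (le_trans (ler_normD _ _)).
have h4 : (C + e) * (b - c) <= (C + e) * (b - a).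
  by apply: ler_wpM2l; [rewrite addr_ge0// ltW | lra].
nra.
Qed.
End VectorCalculus.

(** Conditionals are split innermost first, so that each comparison introduced is linear and within
    reach of [lra]. *)
Ltac case_minmax := rewrite /Order.max /Order.min;
  repeat match goal with
  | |- context [if (?x < ?y)%R then _ else _] =>
    lazymatch constr:((x, y)) with
    | context [if _ then _ else _] => fail
    | _ => case: (ltP x y) => ?
    end
  end.

(** * Antiderivatives of continuous functions by Riemann sums *)

Section Antiderivative.
Context {R : realType} {E : completeNormedModType R}.
Variables (g : R -> E) (a b : R).
Hypothesis ab : a < b.
Hypothesis cg : forall t, cont_in setT g t.

Let h (n : nat) : R := (b - a) / n.+1%:R.
Let node n (k : nat) : R := a + k%:R * h n.
(* the length of the part of the cell [node k, node k.+1] below t *)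
Let cell n (k : nat) (t : R) : R := Num.max 0 (Num.min (t - node n k) (h n)).
(** Each cell enters with the length of its part below [t], so the sum is piecewise affine in [t]
    and its increments can be estimated between arbitrary points, not only between nodes. *)
Let riemann n (t : R) : E := \sum_(k < n.+1) cell n k t *: g (node n k).

Let h_gt0 n : 0 < h n. Proof. by rewrite divr_gt0// subr_gt0. Qed.

Let cell_le n k x y : x <= y -> cell n k x <= cell n k y.
Proof.
move=> xy; rewrite /cell; have := h_gt0 n; move: (h n) (node n k) => w p w0.
by case_minmax; lra.
Qed.

Let sum_cell n m t : a <= t ->
  \sum_(k < m) cell n k t = Num.min (t - a) (m%:R * h n).
Proof.
move=> at_; elim: m => [|m ih].
  by rewrite big_ord0 mul0r; apply/esym/min_idPr; rewrite subr_ge0.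
rewrite big_ord_recr/= ih /cell /node -natr1 mulrDl mul1r opprD addrA.
have := h_gt0 n; move: (h n) => w w0.
have mw : 0 <= m%:R * w by rewrite mulr_ge0// ltW.
move: (m%:R * w) mw => v v0.
by case_minmax; lra.
Qed.

Let riemann_a n : riemann n a = 0.
Proof.
rewrite /riemann big1// => k _.
suff -> : cell n k a = 0 by rewrite scale0r.
rewrite /cell /node; have : 0 <= k%:R * h n by rewrite mulr_ge0// ltW.
move: (k%:R * _) => w w0; apply/max_idPl.
by rewrite ge_min; apply/orP; left; lra.
Qed.

(** The increment is a combination of values [g (node n k)] with nonnegative weights adding up to
    [y - x]. A weight is nonzero only if the cell meets the interval from [x] to [y], and then its
    node lies between [x - h n] and [y]. *)
Let riemann_local n x y v (e : R) : a <= x -> x <= y -> y <= b ->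
  (forall u : R, x - h n < u -> u < y -> `|g u - v| <= e) ->
  `|riemann n y - riemann n x - (y - x) *: v| <= e * (y - x).
Proof.
move=> ax xy yb H.
have sumE : \sum_(k < n.+1) (cell n k y - cell n k x) = y - x.
  rewrite sumrB !sum_cell//; last exact: le_trans xy.
  rewrite /h mulrC divfK// !minEle !lerD2r (le_trans xy yb) yb.
  by rewrite opprB addrA subrK.
rewrite -[in (y - x) *: v]sumE -[in e * _]sumE scaler_suml mulr_sumr /riemann.
rewrite -!sumrB (le_trans (ler_norm_sum _ _ _))//; apply: ler_sum => k _.
rewrite -scalerBl -scalerBr normrZ ger0_norm ?subr_ge0 ?cell_le// mulrC.
have [->|neq] := eqVneq (cell n k y) (cell n k x); first by rewrite subrr !mulr0.
have lt : cell n k x < cell n k y by rewrite lt_neqAle eq_sym neq cell_le.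
apply: ler_wpM2r; first by rewrite subr_ge0 ltW.
move: lt; rewrite /cell; have := h_gt0 n.
move: H; move: (h n) (node n k) => w p H w0.
rewrite gt_max lt_max ltxx/= lt_min gt_min !lt_max !lt_min ltxx andbF orbF.
by move=> /andP[/andP[yp _] xp]; apply: H; [|lra];
  case/orP: xp => [/orP[|/andP[]]|]; lra.
Qed.

Let h_small (e : R) : 0 < e -> exists N, forall n, (N <= n)%N -> h n < e.
Proof.
move=> e0; exists (Num.truncn ((b - a) / e)) => n Nn.
rewrite /h ltr_pdivrMr// mulrC -ltr_pdivrMr//.
by rewrite (lt_le_trans (truncnS_gt _))// ler_nat.
Qed.

(* A common local estimate for the increments of all fine enough sums; it is
   what makes them converge and identifies the derivative of the limit. *)
Let riemann_near t (e : R) : 0 < e -> exists (d : R) (N : nat), 0 < d /\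
  forall n, (N <= n)%N -> forall x y, a <= x -> x <= y -> y <= b ->
    t - d < x -> y < t + d ->
    `|riemann n y - riemann n x - (y - x) *: g t| <= e * (y - x).
Proof.
move=> e0; have [d d0 H] := cg t e0.
have [N HN] := h_small (e := d / 2) ltac:(by rewrite divr_gt0).
exists (d / 2), N; split; first by rewrite divr_gt0.
move=> n Nn x y ax xy yb tx yt; apply: riemann_local => // u xu uy.
by apply: H => //; have := HN n Nn; rewrite ltr_norml => ?; apply/andP; split; lra.
Qed.

(** All sums vanish at [a], and the local estimate lets the discrepancy of two sums grow with slope
    at most [K], half from each. The threshold [N] may change from point to point, so pointwise
    continuity of [g] suffices. *)
Let riemann_cauchy t (e : R) : a <= t <= b -> 0 < e -> exists N, forall n m,
  (N <= n)%N -> (N <= m)%N -> `|riemann n t - riemann m t| <= e.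
Proof.
move=> /andP[at_ tb] e0; pose K := e / (b - a).
have ba : 0 < b - a by rewrite subr_gt0.
have K0 : 0 < K by rewrite divr_gt0.
suff [N HN] : exists N, forall n m, (N <= n)%N -> (N <= m)%N ->
    `|riemann n t - riemann m t| <= K * (t - a).
  exists N => n m Nn Nm; rewrite (le_trans (HN n m Nn Nm))// /K mulrAC ler_pdivrMr//.
  by rewrite ler_pM2l// lerD2r.
have K20 : 0 < K / 2 by rewrite divr_gt0.
have local s : exists (d : R) (N : nat), 0 < d /\
    forall n m, (N <= n)%N -> (N <= m)%N -> forall x y,
    a <= x -> x <= y -> y <= b -> s - d < x -> y < s + d ->
    `|riemann n x - riemann m x| <= K * (x - a) ->
    `|riemann n y - riemann m y| <= K * (y - a).
  have [d [N [d0 H]]] := riemann_near s K20; exists d, N; split=> //.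
  move=> n m Nn Nm x y ax xy yb sx ys h1.
  have hn := H n Nn x y ax xy yb sx ys; have hm := H m Nm x y ax xy yb sx ys.
  move: (riemann n x) (riemann n y) (riemann m x) (riemann m y) h1 hn hm.
  move=> nx ny mx my h1 hn hm.
  have -> : ny - my = (nx - mx) + ((ny - nx - (y - x) *: g s) - (my - mx - (y - x) *: g s)).
    by rewrite [- (_ - _ *: _)]opprB subrKA addrBD -opprD [RHS]addrC subrK.
  have := ler_normD (nx - mx) ((ny - nx - (y - x) *: g s) - (my - mx - (y - x) *: g s)).
  have := ler_normB (ny - nx - (y - x) *: g s) (my - mx - (y - x) *: g s).
  lra.
apply: (@real_induction _ a t (fun t => exists N, forall n m, (N <= n)%N ->
    (N <= m)%N -> `|riemann n t - riemann m t| <= K * (t - a))) => //.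
- by exists 0%N => n m _ _; rewrite !riemann_a !subrr mulr0 normr0.
- move=> s as_ st [N HN]; have [d [N' [d0 H]]] := local s.
  exists d => // s' ss' s'd s't; exists (maxn N N') => n m.
  rewrite !geq_max => /andP[Nn N'n] /andP[Nm N'm].
  by apply: (H n m N'n N'm s s') => //; try lra; exact: HN.
- move=> s as_ st IH; have [d [N' [d0 H]]] := local s.
  pose x := Num.max a (s - d / 2).
  have ax : a <= x by rewrite le_max lexx.
  have xs : x < s by rewrite gt_max as_/=; lra.
  have sx : s - d / 2 <= x by rewrite le_max lexx orbT.
  have [N HN] := IH x ax xs; exists (maxn N N') => n m.
  rewrite !geq_max => /andP[Nn N'n] /andP[Nm N'm].
  by apply: (H n m N'n N'm x s) => //; try lra; exact: HN.
Qed.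

Lemma antiderivative_global : exists2 G : R -> E, G a = 0 &
  forall t, a <= t <= b -> deriv_in `[a, b] G t (g t).
Proof.
have lim t : exists l : E, a <= t <= b -> (fun n => riemann n t) @ \oo --> l.
  have [tab|ntab] := boolP (a <= t <= b); last by exists 0.
  suff : cvgn (fun n => riemann n t) by move=> /cvg_ex[l hl]; exists l.
  apply: cauchy_cvg; apply: cauchy_exP => e e0.
  have [N HN] := riemann_cauchy tab (e := e / 2) ltac:(by rewrite divr_gt0).
  exists (riemann N t), N => // m /= Nm.
  by rewrite -ball_normE /= (le_lt_trans (HN _ _ _ _))//; lra.
have [G HG] := choice lim; exists G.
  have := HG a; rewrite lexx ltW// => /(_ isT).
  rewrite (_ : (fun n => _) = fun=> 0); last exact/funext/riemann_a.
  by move=> /cvg_lim <-//; rewrite lim_cst.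
move=> t tab e e0; have [d [N [d0 H]]] := riemann_near t e0; exists d => //.
have Glim x y : a <= x -> x <= y -> y <= b -> t - d < x -> y < t + d ->
    `|G y - G x - (y - x) *: g t| <= e * (y - x).
  move=> ax xy yb tx yt.
  have Gx := HG x; rewrite ax (le_trans xy yb) in Gx.
  have Gy := HG y; rewrite yb (le_trans ax xy) in Gy.
  have cv : (fun n => `|riemann n y - riemann n x - (y - x) *: g t|) @ \oo -->
      `|G y - G x - (y - x) *: g t|.
    by apply: cvg_norm; apply: cvgB; [apply: cvgB; [exact: Gy|exact: Gx]|exact: cvg_cst].
  rewrite -(cvg_lim _ cv)//; apply: limr_le; first by apply/cvg_ex; eexists; exact: cv.
  by exists N => // n /= Nn; exact: H.
move=> s /=; rewrite in_itv/= => /andP[as_ sb]; rewrite ltr_norml => std.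
case/andP: tab => at_ tb.
have [st|ts] := leP s t.
  have -> : G s - G t - (s - t) *: g t = - (G t - G s - (t - s) *: g t).
    by rewrite !opprB -(opprB t s) scaleNr opprK addrC.
  by rewrite normrN (distrC s t) ger0_norm ?subr_ge0//; apply: Glim => //; lra.
by rewrite gtr0_norm ?subr_gt0//; apply: Glim => //; lra.
Qed.
End Antiderivative.

Lemma antiderivative (R : realType) (E : completeNormedModType R) (g : R -> E)
    (a b : R) : a < b -> (forall t, a <= t <= b -> cont_in `[a, b] g t) ->
  exists2 G : R -> E, G a = 0 &
    forall t, a <= t <= b -> deriv_in `[a, b] G t (g t).
Proof.
(* The estimates look at [g] slightly to the left of [a]; precomposing with the 1-Lipschitz
   projection onto [[a, b]] supplies continuous values there. *)
move=> ab cg; pose clamp t := Num.max a (Num.min t b).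
have clampP t : a <= clamp t <= b.
  by rewrite /clamp; case_minmax; apply/andP; split; lra.
have clamp_id t : a <= t <= b -> clamp t = t.
  by move=> /andP[at_ tb]; rewrite /clamp (min_idPl tb); apply/max_idPr.
have [|G G0 dG] := @antiderivative_global _ _ (g \o clamp) _ _ ab.
  move=> t e e0; have [d d0 H] := cg _ (clampP t) e e0; exists d => // s _ sd.
  apply: H => /=; first by rewrite in_itv/= clampP.
  apply: le_lt_trans sd; rewrite /clamp.
  have := ler_norm (s - t); have := ler_norm (t - s); rewrite (distrC t s).
  by case_minmax => h1 h2; rewrite ler_norml; apply/andP; split; lra.
by exists G => // t tab; rewrite -[in g t](clamp_id t tab); exact: dG.
Qed.

(** * Ordinary differential equations *)

Section OrdinaryDifferentialEquations.
Context {R : realType} {E : completeNormedModType R}.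
Implicit Types (h : R -> E -> E) (u v : R -> E).

Lemma le_add_halving (x y c : R) :
  (forall n, x <= y + c * 2^-1 ^+ n) -> x <= y.
Proof.
move=> H; have cv : y + c * 2^-1 ^+ n @[n --> \oo] --> y + 0.
  apply: cvgD; first exact: cvg_cst.
  by apply: cvg_geometric; rewrite ger0_norm// invf_lt1// ltr1n.
rewrite -[y]addr0 -(cvg_lim _ cv)//; apply: limr_ge; first by apply/cvg_ex; exists (y + 0).
by apply: nearW.
Qed.

Lemma mean_value_le_sub (u : R -> E) (J : set R) (a b C : R) : a <= b ->
  `[a, b] `<=` J ->
  (forall t, a <= t <= b -> cont_in J u t) ->
  (forall t, a < t < b -> exists2 v, deriv_in J u t v & `|v| <= C) ->
  `|u b - u a| <= C * (b - a).
Proof.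
move=> ab abJ cu du; apply: mean_value_le => //.
  by move=> t tab; apply: cont_inW abJ _; exact: cu.
by move=> t tab; have [v dv vC] := du t tab; exists v => //; exact: deriv_inW dv.
Qed.

Theorem picard h (t0 : R) (y0 : E) (r L : R) : 0 < r -> 0 <= L ->
  (forall t y y', t0 <= t <= t0 + r -> `|y - y0| <= r -> `|y' - y0| <= r ->
     `|h t y - h t y'| <= L * `|y - y'|) ->
  (forall t y, t0 <= t <= t0 + r -> `|y - y0| <= r ->
     cont_in `[t0, t0 + r] (h^~ y) t) ->
  exists (a : R) u, [/\ 0 < a, a <= r, u t0 = y0 &
    forall t, t0 <= t <= t0 + a -> `|u t - y0| <= r /\
      deriv_in `[t0, t0 + a] u t (h t (u t))].
Proof.
move=> r0 L0 lip ch.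
have y0r : `|y0 - y0| <= r by rewrite subrr normr0 ltW.
have [|d d0 hd] := ch t0 y0 _ y0r 1 ltr01; first by rewrite lexx lerDl ltW.
(* Bound of [h] near [t0] on the ball: its value at the centre, at most [1] for the change in time
   at fixed [y0], and [L * r] for the change in [y]. *)
pose M := `|h t0 y0| + 1 + L * r.
have M0 : 0 < M by rewrite ltr_wpDr ?mulr_ge0 ?(ltW r0)// ltr_wpDl.
(* [a <= d / 2] makes the bound [M] valid, [a * M <= r] keeps the iterates in the ball, and
   [L * a <= 1 / 2] makes the Picard operator halve distances. *)
pose a := Num.min (Num.min r (d / 2)) (Num.min (r / M) (2^-1 / (L + 1))).
have L10 : 0 < L + 1 by rewrite ltr_wpDl.
have a0 : 0 < a by rewrite !lt_min r0 !divr_gt0.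
have [ar ad] : a <= r /\ a <= d / 2.
  by split; rewrite /a !ge_min lexx ?orbT.
have aM : a * M <= r by rewrite -ler_pdivlMr// /a !ge_min lexx !orbT.
have aL : L * a <= 2^-1.
  have : a * (L + 1) <= 2^-1 by rewrite -ler_pdivlMr// /a !ge_min lexx !orbT.
  lra.
pose I := `[t0, t0 + a]%classic.
have inI t : I t = (t0 <= t <= t0 + a) by rewrite /I /= in_itv.
have Ir t : I t -> t0 <= t <= t0 + r by rewrite inI => /andP[-> ?] /=; lra.
have sub s : I s -> `[t0, s] `<=` I.
  rewrite inI => /andP[? ?] t /=; rewrite inI in_itv/= => /andP[-> ?] /=.
  lra.
pose good v := forall t, I t -> cont_in I v t /\ `|v t - y0| <= r.
have comp v : good v -> forall t, I t -> cont_in I (fun s => h s (v s)) t.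
  move=> gv t It e e0; have [cv vt] := gv t It.
  have e1 : 0 < e / 2 / (L + 1) by rewrite !divr_gt0.
  have [d1 d10 H1] := cv _ e1.
  have [d2 d20 H2] := ch t (v t) (Ir t It) vt (e / 2) ltac:(by rewrite divr_gt0).
  exists (Num.min d1 d2); first by rewrite lt_min d10.
  move=> s Is; rewrite lt_min => /andP[s1 s2]; rewrite -(subrKA (h s (v t))).
  have h1 := lip s _ _ (Ir s Is) (gv s Is).2 vt.
  have h2 : `|h s (v t) - h t (v t)| <= e / 2.
    by apply: H2 => //=; rewrite in_itv/=; exact: Ir.
  have h3 := H1 s Is s1; rewrite ler_pdivlMr// in h3.
  have := ler_normD (h s (v s) - h s (v t)) (h s (v t) - h t (v t)).
  have := normr_ge0 (v s - v t); nra.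
have bound v : good v -> forall t, I t -> `|h t (v t)| <= M.
  move=> gv t It; have h1 := lip t _ _ (Ir t It) (gv t It).2 y0r.
  have h2 : `|h t y0 - h t0 y0| <= 1.
    apply: hd; first by rewrite /= in_itv/=; exact: Ir.
    by move: It; rewrite inI => /andP[? ?]; rewrite ger0_norm ?subr_ge0//; lra.
  have h3 := (gv t It).2.
  have := ler_normD (h t (v t) - h t y0) (h t y0).
  have := ler_normD (h t y0 - h t0 y0) (h t0 y0).
  have : L * `|v t - y0| <= L * r by rewrite ler_wpM2l.
  by rewrite !subrK /M; lra.
(* The conclusion is conditional on [good v], which lets choice produce a total operator [F]. Only
   the initial value and the derivative of [F v] are known, and they determine it on [I]. *)
have step v : exists w, good v -> w t0 = y0 /\
    forall t, I t -> deriv_in I w t (h t (v t)).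
  have [gv|ngv] := pselect (good v); last by exists v.
  have [||G G0 dG] := @antiderivative R E (fun s => h s (v s)) t0 (t0 + a).
  - by rewrite ltrDl.
  - by move=> t tI; apply: comp => //; rewrite inI.
  exists (fun t => y0 + G t) => _; split; first by rewrite G0 addr0.
  move=> t It; rewrite -[h t _]add0r; apply: deriv_inD; first exact: deriv_in_cst.
  by apply: dG; rewrite -inI.
have [F HF] := choice step.
have goodF v : good v -> good (F v).
  move=> gv t It; have [F0 dF] := HF v gv; split; first exact/deriv_in_cont/dF.
  have ta : t0 <= t <= t0 + a by rewrite -inI.
  rewrite -{1}F0 (le_trans _ aM)// mulrC.
  apply: (@le_trans _ _ (M * (t - t0))); last first.
    by rewrite ler_pM2l//; lra.
  apply: (mean_value_le_sub _ (sub t It)); first by case/andP: ta.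
    by move=> s st; apply/deriv_in_cont/dF/(sub t It); rewrite /= in_itv.
  move=> s /andP[ts st].
  have Is : I s by apply: (sub t It); rewrite /= in_itv/= !ltW.
  by exists (h s (v s)); [exact: dF | exact: bound].
have contract v w c : good v -> good w ->
    (forall t, I t -> `|v t - w t| <= c) ->
    forall t, I t -> `|F v t - F w t| <= c / 2.
  move=> gv gw vw t It; have [Fv0 dFv] := HF v gv; have [Fw0 dFw] := HF w gw.
  have ta : t0 <= t <= t0 + a by rewrite -inI.
  have c0 : 0 <= c by exact: le_trans (vw t It).
  have dD s : I s -> deriv_in I (fun s => F v s - F w s) s (h s (v s) - h s (w s)).
    by move=> Is; apply: deriv_inD; [exact: dFv | exact/deriv_inN/dFw].
  have : `|(F v t - F w t) - (F v t0 - F w t0)| <= L * c * (t - t0).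
    apply: (mean_value_le_sub (u := fun s => F v s - F w s) _ (sub t It)).
    - by case/andP: ta.
    - by move=> s st; apply/deriv_in_cont/dD/(sub t It); rewrite /= in_itv.
    - move=> s /andP[ts st].
      have Is : I s by apply: (sub t It); rewrite /= in_itv/= !ltW.
      exists (h s (v s) - h s (w s)); first exact: dD.
      rewrite (le_trans (lip _ _ _ (Ir s Is) (gv s Is).2 (gw s Is).2))//.
      by rewrite ler_wpM2l// vw.
  rewrite Fv0 Fw0 subrr subr0 => /le_trans; apply.
  apply: (@le_trans _ _ (L * a * c)); last by rewrite mulrC ler_wpM2l.
  by rewrite mulrAC ler_wpM2r// ler_wpM2l//; lra.
pose u := fix u n := if n is m.+1 then F (u m) else (fun=> y0).
have gu n : good (u n).
  elim: n => [|n ih]; last exact: goodF.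
  by move=> t It; split; [exact: cont_in_cst | rewrite subrr normr0 ltW].
pose c n : R := r * 2^-1 ^+ n.
have cS n : c n.+1 = c n / 2 by rewrite /c exprSr mulrA.
have uS n t : I t -> `|u n.+1 t - u n t| <= c n.
  elim: n t => [|n ih] t It; first by rewrite /c expr0 mulr1; exact: (gu 1%N t It).2.
  rewrite cS.
  exact: (contract _ _ _ (gu n.+1) (gu n) ih).
have lim t : exists l : E, I t -> forall n, `|l - u n t| <= 2 * c n.
  have [It|nIt] := pselect (I t); last by exists 0.
  have [l _ Hl] := @halving_steps_cvg _ _ (fun n => u n t) c
    (fun n => uS n t It) (fun n => ltac:(by rewrite cS)).
  by exists l.
have [w Hw] := choice lim.
have c0 n : 0 < c n by rewrite mulr_gt0// exprn_gt0.
have gw : good w.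
  move=> t It; split; last first.
    apply: (@le_add_halving _ _ (2 * r)) => n; rewrite -mulrA -/(c n).
    rewrite -(subrKA (u n t)) (le_trans (ler_normD _ _))// addrC lerD//.
      exact: (gu n t It).2.
    exact: Hw.
  move=> e e0.
  have /cvgrPdist_lt /(_ (e / 6)) := @halving_cvg0 _ c (fun n => ltW (c0 n))
    (fun n => ltac:(by rewrite cS)).
  rewrite divr_gt0// => /(_ isT) [N _ /(_ N (leqnn N)) HN].
  rewrite /= sub0r normrN gtr0_norm// in HN.
  have [d1 d10 H1] := (gu N t It).1 (e / 3) ltac:(by rewrite divr_gt0).
  exists d1 => // s Is sd; have := H1 s Is sd.
  have := Hw t It N; have := Hw s Is N; rewrite (distrC (w t)).
  have := ler_normD (w s - u N s) (u N s - u N t).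
  have := ler_normD (w s - u N t) (u N t - w t).
  by rewrite !subrKA; lra.
have Fw t : I t -> F w t = w t.
  move=> It; apply/eqP; rewrite -subr_eq0 -normr_le0.
  apply: (@le_add_halving _ _ (2 * r)) => n; rewrite add0r -mulrA -/(c n).
  have := contract w (u n) (2 * c n) gw (gu n) (fun t It => Hw t It n) t It.
  have := Hw t It n.+1; rewrite cS (distrC (w t)).
  have := ler_normD (F w t - u n.+1 t) (u n.+1 t - w t).
  by rewrite !subrKA /=; lra.
(* [F w] is taken rather than [w]: the two agree on [I], but the initial value and the derivative of
   [F w] come directly from the construction. *)
exists a, (F w); split=> //; first exact: (HF w gw).1.
move=> t ta; have It : I t by rewrite inI.
by split; [exact: (goodF w gw t It).2 | rewrite (Fw t It); exact: (HF w gw).2].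
Qed.

(** Equality propagates to the right by real induction: at a limit it holds by continuity, and just
    beyond [t] the mean value inequality halves any bound on [u - v], in place of Gronwall's
    inequality. The Lipschitz bound is asked only within [W], since the reduced equation lives on a
    set that need not be open in the whole space. *)
Theorem ode_unique h (W : set E) u v (a b : R) : a <= b -> u a = v a ->
  (forall t, a <= t <= b -> [/\ W (u t), W (v t), cont_in `[a, b] u t &
     cont_in `[a, b] v t]) ->
  (forall t, a < t < b -> deriv_in `[a, b] u t (h t (u t)) /\
     deriv_in `[a, b] v t (h t (v t))) ->
  (forall t, a <= t < b -> exists (r L : R), [/\ 0 < r, 0 <= L &
     forall s y y', t <= s <= t + r -> W y -> W y' ->
       `|y - u t| <= r -> `|y' - u t| <= r ->
       `|h s y - h s y'| <= L * `|y - y'|]) ->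
  u b = v b.
Proof.
move=> ab uva cuv duv lip.
apply: (@real_induction _ a b (fun t => u t = v t)) => //; last first.
  move=> t at_ tb H.
  have [|_ _ cu cv] := cuv t; first by rewrite tb ltW.
  have cD := cont_inD cu (cont_inN cv).
  apply/eqP; rewrite -subr_eq0 -normr_le0; apply/ler_addgt0Pl => e e0; rewrite addr0.
  have [d d0 Hd] := cD e e0.
  pose x := Num.max a (t - d / 2).
  have ax : a <= x by rewrite le_max lexx.
  have xt : x < t by rewrite gt_max at_/=; lra.
  have tx : t - d / 2 <= x by rewrite le_max lexx orbT.
  have := Hd x; rewrite H// subrr sub0r normrN; apply.
    by rewrite /= in_itv/=; apply/andP; split; lra.
  by rewrite ltr_norml; apply/andP; split; lra.
move=> t at_ tb uvt.
have [|r [L [r0 L0 hL]]] := lip t; first by rewrite at_.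
have [|_ _ cu cv] := cuv t; first by rewrite at_ ltW.
have [d1 d10 H1] := cu r r0; have [d2 d20 H2] := cv r r0.
have L10 : 0 < L + 1 by rewrite ltr_wpDl.
pose d := Num.min (Num.min d1 d2) (Num.min r (2^-1 / (L + 1))).
have d0 : 0 < d by rewrite !lt_min d10 d20 r0 divr_gt0.
have [dd1 dd2 dr] : [/\ d <= d1, d <= d2 & d <= r] by rewrite /d !ge_min !lexx !orbT.
have dL : L * d <= 2^-1.
  have : d * (L + 1) <= 2^-1 by rewrite -ler_pdivlMr// /d !ge_min lexx !orbT.
  lra.
exists d => // s ts sd sb.
have mem x : t <= x -> x <= s -> `[a, b]%classic x.
  by move=> tx xs; rewrite /= in_itv/=; apply/andP; split; lra.
have near x : t <= x -> x <= s -> `|u x - u t| <= r /\ `|v x - u t| <= r.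
  move=> tx xs; have xd : `|x - t| < d by rewrite ger0_norm ?subr_ge0//; lra.
  split; first by apply: H1; [exact: mem|lra].
  by rewrite uvt; apply: H2; [exact: mem|lra].
suff H n x : t <= x -> x <= s -> `|u x - v x| <= 2 * r * 2^-1 ^+ n.
  apply/eqP; rewrite -subr_eq0 -normr_le0.
  apply: (@le_add_halving _ _ (2 * r)) => n; rewrite add0r.
  by apply: H => //; exact: ltW.
elim: n x => [|n ih] x tx xs.
  rewrite expr0 mulr1; have [] := near x tx xs.
  by have := ler_normB (u x - u t) (v x - u t); rewrite opprB subrKA; lra.
pose c := 2 * r * 2^-1 ^+ n.
have c0 : 0 <= c by rewrite mulr_ge0 ?exprn_ge0// mulr_ge0// ltW.
have -> : 2 * r * 2^-1 ^+ n.+1 = c / 2 by rewrite exprSr mulrA.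
have : `|(u x - v x) - (u t - v t)| <= L * c * (x - t).
  apply: (mean_value_le_sub (u := fun s => u s - v s) (J := `[a, b])) => //.
  - by move=> y /=; rewrite in_itv/= => /andP[ty yx]; apply: mem; lra.
  - move=> y /andP[ty yx]; have [|_ _ cuy cvy] := cuv y.
      by apply/andP; split; lra.
    by apply: cont_inD => //; exact: cont_inN.
  - move=> y /andP[ty yx]; exists (h y (u y) - h y (v y)).
      have [|duy dvy] := duv y; first by apply/andP; split; lra.
      by apply: deriv_inD => //; exact: deriv_inN.
    have [|Wu Wv _ _] := cuv y; first by apply/andP; split; lra.
    have [uy vy] : `|u y - u t| <= r /\ `|v y - u t| <= r by apply: near; lra.
    rewrite (le_trans (hL y _ _ _ Wu Wv uy vy))//; first by apply/andP; split; lra.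
    by rewrite ler_wpM2l//; apply: ih; lra.
rewrite uvt subrr subr0 => /le_trans; apply.
apply: (@le_trans _ _ (L * d * c)); last by rewrite mulrC ler_wpM2l.
by rewrite mulrAC ler_wpM2r// ler_wpM2l//; lra.
Qed.
End OrdinaryDifferentialEquations.

(** * Bounded operators and closed pencils *)

Section BoundedOperators.
Context {R : realType} {k : scalar_kind}.
Local Notation K := (scal R k).
Implicit Types E F : normedModType K.

Lemma rnormE E (x : E) : @of_real R k (rnorm x) = `|x|.
Proof. exact: of_real_rnorm. Qed.

Lemma snormE (a : K) : @of_real R k (snorm a) = `|a|.
Proof. exact/real_partK/normr_ge0. Qed.

Lemma rnorm_ge0 E (x : E) : 0 <= rnorm x.
Proof. by rewrite -(@ler_of_real R k) rnormE of_real0. Qed.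

Lemma rnorm0 E : rnorm (0 : E) = 0.
Proof. by apply: (can_inj (@of_realK R k)); rewrite rnormE normr0 of_real0. Qed.

Lemma rnorm0_eq0 E (x : E) : rnorm x = 0 -> x = 0.
Proof. by move=> x0; apply: normr0_eq0; rewrite -rnormE x0 of_real0. Qed.

Lemma rnormN E (x : E) : rnorm (- x) = rnorm x.
Proof. by rewrite /rnorm normrN. Qed.

Lemma rdistC E (x y : E) : rnorm (x - y) = rnorm (y - x).
Proof. by rewrite -rnormN opprB. Qed.

Lemma rnormZ E a (x : E) : rnorm (a *: x) = snorm a * rnorm x.
Proof.
by apply: (can_inj (@of_realK R k)); rewrite of_realM snormE !rnormE normrZ.
Qed.

Lemma snorm_of_real (a : R) : snorm (@of_real R k a) = `|a|.
Proof. by apply: (can_inj (@of_realK R k)); rewrite snormE norm_of_real. Qed.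

Lemma ler_rnormD E (x y : E) : rnorm (x + y) <= rnorm x + rnorm y.
Proof. by rewrite -(@ler_of_real R k) of_realD !rnormE ler_normD. Qed.

Lemma ler_rnormB E (x y : E) : rnorm (x - y) <= rnorm x + rnorm y.
Proof. by rewrite -(rnormN y) ler_rnormD. Qed.

Lemma ler_rdistD E (z x y : E) : rnorm (x - y) <= rnorm (x - z) + rnorm (z - y).
Proof. by rewrite -{1}(subrKA z) ler_rnormD. Qed.

Definition bounded_op E F (p : E -> F) : Prop :=
  in_L (@rnorm R k E) (@rnorm R k F) setT setT p.

Section Theory.
Context {E F : normedModType K} {p : E -> F}.
Hypothesis bp : bounded_op p.

Lemma bopP a x y : p (a *: x + y) = a *: p x + p y.
Proof. by case: bp => + _ _; apply. Qed.
Lemma bopD x y : p (x + y) = p x + p y.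
Proof. by have := bopP 1 x y; rewrite !scale1r. Qed.
Lemma bop0 : p 0 = 0.
Proof. by apply: (addrI (p 0)); rewrite -bopD !addr0. Qed.
Lemma bopZ a x : p (a *: x) = a *: p x.
Proof. by have := bopP a x 0; rewrite bop0 !addr0. Qed.
Lemma bopN x : p (- x) = - p x.
Proof. by rewrite -scaleN1r bopZ scaleN1r. Qed.
Lemma bopB x y : p (x - y) = p x - p y.
Proof. by rewrite bopD bopN. Qed.
Lemma bop_sum I r (P : pred I) (G : I -> E) :
  p (\sum_(i <- r | P i) G i) = \sum_(i <- r | P i) p (G i).
Proof. by apply: (big_morph p bopD bop0). Qed.
Lemma bop_bound : exists2 c, 0 < c & forall x, rnorm (p x) <= c * rnorm x.
Proof.
case: bp => _ _ [c hc]; exists (`|c| + 1); first by rewrite ltr_wpDl.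
move=> x; rewrite (le_trans (hc x I))// ler_wpM2r ?rnorm_ge0//.
by rewrite (le_trans (ler_norm c))// lerDl.
Qed.
End Theory.

Lemma bounded_op_id E : bounded_op (@id E).
Proof. by split=> //; exists 1 => x _; rewrite mul1r. Qed.

Lemma bounded_op_zero E F : bounded_op (fun _ : E => 0 : F).
Proof.
split=> //; first by move=> a x y _ _; rewrite scaler0 addr0.
by exists 0 => x _; rewrite rnorm0 mul0r.
Qed.

Lemma bounded_opD E F (p q : E -> F) :
  bounded_op p -> bounded_op q -> bounded_op (fun x => p x + q x).
Proof.
move=> bp bq; split=> //.
  by move=> a x y _ _; rewrite (bopP bp) (bopP bq) scalerDr addrACA.
have [c _ hc] := bop_bound bp; have [d _ hd] := bop_bound bq.
exists (c + d) => x _; rewrite mulrDl (le_trans (ler_rnormD _ _))//.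
by rewrite lerD.
Qed.

Lemma bounded_opN E F (p : E -> F) : bounded_op p -> bounded_op (fun x => - p x).
Proof.
move=> bp; split=> //.
  by move=> a x y _ _; rewrite (bopP bp) opprD scalerN.
by have [c _ hc] := bop_bound bp; exists c => x _; rewrite rnormN.
Qed.

Lemma bounded_opB E F (p q : E -> F) :
  bounded_op p -> bounded_op q -> bounded_op (fun x => p x - q x).
Proof. by move=> bp bq; apply: bounded_opD => //; exact: bounded_opN. Qed.

Lemma bounded_op_rank1 E F (p : E -> K) (v : F) :
  dual p -> bounded_op (fun x => p x *: v).
Proof.
case=> lp _ [c hc]; split=> //.
  by move=> a x y _ _; rewrite lp// scalerDl scalerA.
exists (c * rnorm v) => x _.
by rewrite rnormZ mulrAC ler_wpM2r ?rnorm_ge0// hc.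
Qed.

Lemma bounded_op_sum E F (I : eqType) (r : seq I) (P : pred I) (G : I -> E -> F) :
  (forall i, i \in r -> P i -> bounded_op (G i)) ->
  bounded_op (fun x => \sum_(i <- r | P i) G i x).
Proof.
elim: r => [|i r ih] bG.
  rewrite (_ : (fun _ => _) = fun _ : E => 0 : F); first exact: bounded_op_zero.
  by apply/funext => x; rewrite big_nil.
have {}ih : bounded_op (fun x => \sum_(i <- r | P i) G i x).
  by apply: ih => j jr; apply: bG; rewrite inE jr orbT.
have [Pi|nPi] := boolP (P i).
  rewrite (_ : (fun _ => _) = fun x : E => G i x + \sum_(i <- r | P i) G i x).
    by apply: bounded_opD => //; apply: bG => //; rewrite inE eqxx.
  by apply/funext => x; rewrite big_cons Pi.
rewrite (_ : (fun _ => _) = fun x : E => \sum_(i <- r | P i) G i x)//.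
by apply/funext => x; rewrite big_cons (negbTE nPi).
Qed.
End BoundedOperators.

Lemma bounded_op_continuous (R : realType) (k : scalar_kind)
    (E F : completeNormedModType (scal R k)) (p : E -> F) :
  bounded_op p -> continuous (p : realify E -> realify F).
Proof.
move=> bp x; have [c c0 hc] := bop_bound bp.
apply/cvgrPdist_le => e e0; have ec0 : 0 < e / c by rewrite divr_gt0.
have idx : y @[y --> (x : realify E)] --> (x : realify E) by exact: cvg_id.
have /cvgrPdist_le /(_ _ ec0) := idx.
apply: filterS => y; rewrite ler_pdivlMr// => h.
rewrite (le_trans _ h)// mulrC -[_ - _]/(p x - p y) -(bopB bp).
exact: hc.
Qed.

Section ClosedOperatorPencil.
Context {R : realType} {k : scalar_kind}.
Variables (X Y : completeNormedModType (scal R k)) (T : pencil X Y).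
Local Notation K := (scal R k).
Local Notation A := (op_A T).
Local Notation B := (op_B T).
Local Notation D := (dom T).
Hypothesis HA : closed_densely_defined (dom_A T) A.
Hypothesis HB : closed_densely_defined (dom_B T) B.

Lemma dom_linear a x y : D x -> D y -> D (a *: x + y).
Proof.
by case: HA HB => [[_ lA] _ _ _] [[_ lB] _ _ _] [? ?] [? ?]; split; auto.
Qed.
Lemma dom0 : D 0.
Proof. by case: HA HB => [[? _] _ _ _] [[? _] _ _ _]. Qed.
Lemma domD x y : D x -> D y -> D (x + y).
Proof. by move=> Dx /(dom_linear 1 Dx); rewrite scale1r. Qed.
Lemma domZ a x : D x -> D (a *: x).
Proof. by move=> /(dom_linear a) /(_ dom0); rewrite addr0. Qed.
Lemma domN x : D x -> D (- x).
Proof. by move=> /(domZ (-1)); rewrite scaleN1r. Qed.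
Lemma domB x y : D x -> D y -> D (x - y).
Proof. by move=> Dx Dy; apply/domD/domN. Qed.
Lemma dom_sum I r (P : pred I) (G : I -> X) :
  (forall i, P i -> D (G i)) -> D (\sum_(i <- r | P i) G i).
Proof. by move=> DG; apply: big_ind => //; [exact: dom0 | exact: domD]. Qed.

Lemma opA_linear a x y : D x -> D y -> A (a *: x + y) = a *: A x + A y.
Proof. by case: HA => [_ lA _ _] [? _] [? _]; exact: lA. Qed.
Lemma opB_linear a x y : D x -> D y -> B (a *: x + y) = a *: B x + B y.
Proof. by case: HB => [_ lB _ _] [_ ?] [_ ?]; exact: lB. Qed.

Section LinearOnDom.
Variable S : X -> Y.
Hypothesis lS : forall a x y, D x -> D y -> S (a *: x + y) = a *: S x + S y.
Lemma linD x y : D x -> D y -> S (x + y) = S x + S y.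
Proof. by move=> Dx Dy; have := lS 1 Dx Dy; rewrite !scale1r. Qed.
Lemma lin0 : S 0 = 0.
Proof. by apply: (addrI (S 0)); rewrite -linD ?addr0//; exact: dom0. Qed.
Lemma linZ a x : D x -> S (a *: x) = a *: S x.
Proof. by move=> Dx; have := lS a Dx dom0; rewrite lin0 !addr0. Qed.
Lemma linN x : D x -> S (- x) = - S x.
Proof. by move=> Dx; rewrite -scaleN1r linZ// scaleN1r. Qed.
Lemma linB x y : D x -> D y -> S (x - y) = S x - S y.
Proof. by move=> Dx Dy; rewrite linD ?linN//; exact: domN. Qed.
Lemma lin_sum I r (P : pred I) (G : I -> X) : (forall i, P i -> D (G i)) ->
  S (\sum_(i <- r | P i) G i) = \sum_(i <- r | P i) S (G i).
Proof.
move=> DG; pose Q x y := D x /\ S x = y.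
suff [] : Q (\sum_(i <- r | P i) G i) (\sum_(i <- r | P i) S (G i)) by [].
apply: (big_ind2 Q) => [|x y x' y' [Dx <-] [Dx' <-]|i Pi].
- by split; [exact: dom0 | exact: lin0].
- by split; [exact: domD | exact: linD].
- by split=> //; exact: DG.
Qed.
End LinearOnDom.
End ClosedOperatorPencil.

(** For a real space the complexified equation with right-hand side [(y, 0)] decouples when the
    parameter is real, because a real factor acts on each component separately; the first component
    is the solution. *)
Lemma regular_pencil_surjective (R : realType) (k : scalar_kind)
    (X Y : completeNormedModType (scal R k)) (T : pencil X Y) (nu : nat) :
  regular_pencil T nu ->
  exists r : R, forall a, r < a -> forall y, exists2 x, dom T x &
    @of_real R k a *: op_A T x + op_B T x = y.
Proof.
case: k X Y T => X Y T [[r r0 H] _]; exists r => a ra y.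
  have a0 : 0 <= a by exact/ltW/(lt_trans r0).
  have [|S [_ [_ DS _ HS]]] := H (a%:C)%C.
    by rewrite normc_def /= expr0n addr0 sqrtr_sqr ger0_norm.
  have := HS (y, 0) I; have := DS (y, 0) I.
  case: (S (y, 0)) => x1 x2 [D1 D2] [h1 h2]; exists x1 => //.
  by move: h1; rewrite /= scale0r subr0.
have a0 : 0 <= a by exact/ltW/(lt_trans r0).
have [|S [_ [_ DS _ HS]]] := H (a%:C)%C.
  by rewrite normc_def /= expr0n addr0 sqrtr_sqr ger0_norm.
by exists (S y); [exact: DS | exact: HS].
Qed.

(** * Neighbourhoods, limits and derivatives in terms of the real norm *)

Section Neighborhoods.
Context {R : realType} {k : scalar_kind}.
Implicit Types X : completeNormedModType (scal R k).

Lemma nbhs_rnorm X (x : X) (P : set X) : nbhs x P ->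
  exists2 d : R, 0 < d & forall y, rnorm (y - x) < d -> P y.
Proof.
move=> Px; have : nbhs (x : realify X) P by [].
move=> /nbhs_ballP[d /= d0 dP]; exists d => // y xy.
by apply: dP; rewrite -ball_normE /= -[`|_|]/(rnorm (x - y)) rdistC.
Qed.

Lemma nbhs_pair_rnorm X (t : R) (x : X) (P : R * X -> Prop) :
  nbhs (t, x) P -> exists2 d : R, 0 < d &
    forall s y, `|s - t| < d -> rnorm (y - x) < d -> P (s, y).
Proof.
move=> [[U V] /= [Ut Vx] UVP].
have [d d0 dV] := nbhs_rnorm Vx.
move: Ut => /nbhs_ballP[d' /= d'0 d'U].
exists (Num.min d d'); first by rewrite lt_min d0.
move=> s y; rewrite !lt_min => /andP[_ sd'] /andP[yd _].
by apply: UVP; split; [apply: d'U; rewrite -ball_normE /= distrC | exact: dV].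
Qed.

Lemma cvg_within_rnorm X (J : set R) (u : R -> X) (t : R) (l : X) :
  u @ within J (nbhs t) --> l <-> forall e : R, 0 < e -> exists2 d : R, 0 < d &
    forall s, J s -> `|s - t| < d -> rnorm (u s - l) <= e.
Proof.
split=> [H e e0|H].
  have /cvgrPdist_le /(_ e e0) : (u : R -> realify X) @ within J (nbhs t) --> (l : realify X) by [].
  rewrite near_withinE => /nbhs_ballP[d /= d0 dH]; exists d => // s Js sd.
  by rewrite rdistC; apply: dH => //; rewrite -ball_normE /= distrC.
suff : (u : R -> realify X) @ within J (nbhs t) --> (l : realify X) by [].
apply/cvgrPdist_le => e e0; rewrite near_withinE.
have [d d0 dH] := H e e0; apply/nbhs_ballP; exists d => //= s.
by rewrite -ball_normE /= distrC => sd Js; rewrite distrC; exact: dH.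
Qed.

Lemma continuous_within_rnorm X (J : set R) (u : R -> X) :
  {within J, continuous u} <->
  forall t, J t -> cont_in J (u : R -> realify X) t.
Proof.
split=> [/subspace_continuousP H t Jt|H].
  by apply/cvg_within_rnorm; exact: H.
by apply/subspace_continuousP => t Jt; apply/cvg_within_rnorm; exact: H.
Qed.
End Neighborhoods.

Lemma contraction_fixed_point (R : realType) (V : completeNormedModType R)
    (U : set V) (F : V -> V) (th : R) : closed U -> U !=set0 ->
  (forall x, U x -> U (F x)) -> 0 <= th -> th < 1 ->
  (forall x y, U x -> U y -> `|F x - F y| <= th * `|x - y|) ->
  exists2 x, U x & F x = x.
Proof.
move=> Ucl U0 UF th0 th1 lip.
have [|x Ux xE] := @banach_fixed_point _ _ U (mkfun_fun UF) _ Ucl U0; last by exists x.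
exists (NngNum th0); split=> // -[x y] [/= Ux Uy].
exact: lip.
Qed.

Lemma bop_realify (R : realType) (k : scalar_kind)
    (E F : completeNormedModType (scal R k)) (p : E -> F) (a : R)
    (x y z : realify E) : bounded_op p ->
  p (x - y - a *: z) = (p x : realify F) - p y - a *: (p z : realify F).
Proof.
move=> bp; rewrite -[LHS]/(p ((x : E) - y - of_real k a *: (z : E))).
by rewrite !(bopB bp) (bopZ bp).
Qed.

Lemma deriv_in_bop (R : realType) (k : scalar_kind)
    (E F : completeNormedModType (scal R k)) (p : E -> F) (J : set R)
    (u : R -> realify E) (t : R) (v : realify E) : bounded_op p ->
  deriv_in J u t v -> deriv_in J (p \o u : R -> realify F) t (p v).
Proof.
move=> bp du; have [c c0 hp] := bop_bound bp.
move=> e e0; have ec0 : 0 < e / c by rewrite divr_gt0.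
have [d d0 H] := du _ ec0; exists d => // s Js sd.
rewrite /= -(bop_realify _ _ _ _ bp) -[`|_|]/(rnorm (p _)) (le_trans (hp _))//.
by rewrite mulrC -ler_pdivlMr// mulrAC; exact: H.
Qed.


Lemma derivative_onP (R : realType) (k : scalar_kind)
    (Y : completeNormedModType (scal R k)) (J : set R) (g g' : R -> Y) :
  derivative_on J g g' <->
  forall t, J t -> deriv_in J (g : R -> realify Y) t (g' t).
Proof.
have quot s t : s != t -> rnorm ((of_real k (s - t))^-1 *: (g s - g t) - g' t) * `|s - t| =
    `|(g s : realify Y) - g t - (s - t) *: (g' t : realify Y)|.
  move=> st; have st0 : of_real k (s - t) != 0.
    by rewrite -normr_eq0 norm_of_real -(of_real0 (k := k)) (can_eq (@of_realK R k)) normr_eq0 subr_eq0.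
  rewrite mulrC -(snorm_of_real (k := k)) -rnormZ scalerBr scalerA divff// scale1r.
  by [].
split=> [H t Jt e e0|H t Jt].
  have [d d0 Hd] := (cvg_within_rnorm _ _ _ _).1 (H t Jt) e e0.
  exists d => // s Js sd; have [->|st] := eqVneq s t.
    by rewrite !subrr scale0r subr0 !normr0 mulr0.
  rewrite -quot// ler_wpM2r//; apply: Hd => //; split=> //.
  by apply/eqP.
apply/cvg_within_rnorm => e e0; have [d d0 Hd] := H t Jt e e0.
exists d => // s [Js /eqP st] sd.
have st0 : 0 < `|s - t| by rewrite normr_gt0 subr_eq0.
by rewrite -(ler_pM2r st0) quot//; exact: Hd.
Qed.

(** * Gluing of derivatives and limits under linear growth *)

Section DerivativesOnSegments.
Context {R : realType} {E : completeNormedModType R}.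
Implicit Types (J : set R) (u v : R -> E).

Lemma deriv_in_local J J' u v t l (d : R) : 0 < d -> u t = v t ->
  (forall s, J' s -> `|s - t| < d -> J s /\ v s = u s) ->
  deriv_in J u t l -> deriv_in J' v t l.
Proof.
move=> d0 uvt H du e e0; have [d' d'0 Hd] := du e e0.
exists (Num.min d d'); first by rewrite lt_min d0.
move=> s J's; rewrite lt_min => /andP[sd sd'].
by have [Js ->] := H s J's sd; rewrite -uvt; exact: Hd.
Qed.

Lemma deriv_in_glue J J' J'' u t l :
  (forall s, J s -> J' s \/ J'' s) ->
  deriv_in J' u t l -> deriv_in J'' u t l -> deriv_in J u t l.
Proof.
move=> JJ du du' e e0; have [d d0 H] := du e e0; have [d' d'0 H'] := du' e e0.
exists (Num.min d d'); first by rewrite lt_min d0.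
move=> s /JJ[J's|J's]; rewrite lt_min => /andP[sd sd']; first exact: H.
exact: H'.
Qed.

Lemma bounded_on_segment u (a b : R) : a <= b ->
  (forall t, a <= t <= b -> cont_in `[a, b] u t) ->
  exists M : R, forall t, a <= t <= b -> `|u t| <= M.
Proof.
move=> ab cu.
have [|c _ H] := @EVT_max R (fun t => `|u t|) a b ab.
  apply/subspace_continuousP => t; rewrite /= in_itv/= => tab.
  apply/cvgrPdist_le => e e0; have [d d0 Hd] := cu t tab e e0.
  rewrite near_withinE; apply/nbhs_ballP; exists d => //= s.
  rewrite -ball_normE /= distrC => sd sab.
  by rewrite (le_trans (ler_dist_dist _ _))// distrC; exact: Hd.
by exists `|u c| => t tab; apply: H; rewrite in_itv.
Qed.

(* The bound on w comes from iterating the mean value inequality on [s, tau],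
   where kap * (tau - a) <= 1/2. *)
Lemma linear_growth_limit (w w' : R -> E) (a b H kap : R) : a < b -> 0 <= H ->
  0 <= kap ->
  (forall t, a < t <= b -> deriv_in `]a, b] w t (w' t)) ->
  (forall t, a < t <= b -> `|w' t| <= H + kap * `|w t|) ->
  exists (l : E) (b' C : R), [/\ a < b', b' <= b, 0 <= C &
    forall s, a < s <= b' -> `|w s - l| <= C * (s - a)].
Proof.
move=> ab H0 kap0 dw bw.
have k10 : 0 < kap + 1 by rewrite ltr_wpDl.
pose d : R := Num.min (b - a) (2^-1 / (kap + 1)).
have d0 : 0 < d by rewrite lt_min subr_gt0 ab divr_gt0.
have [dba dk] : d <= b - a /\ d <= 2^-1 / (kap + 1) by rewrite /d !ge_min !lexx orbT.
have kd : kap * d <= 2^-1.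
  by move: dk; rewrite ler_pdivlMr//; lra.
pose tau := a + d.
have mem (x y z : R) : a < x -> y <= tau -> x <= z <= y -> a < z <= b.
  by move=> ax yt /andP[xz zy]; apply/andP; split; rewrite /tau in yt; lra.
have memJ (x y : R) : a < x -> y <= tau -> `[x, y] `<=` `]a, b].
  by move=> ax yt z /=; rewrite !in_itv/= => h; exact: (mem x y).
have mvt x y M : a < x -> x <= y -> y <= tau ->
    (forall z, x <= z <= y -> `|w' z| <= M) -> `|w y - w x| <= M * (y - x).
  move=> ax xy yt hM; apply: (mean_value_le_sub (J := `]a, b])) => //.
  - exact: memJ.
  - by move=> z xzy; apply: deriv_in_cont (dw z _); exact: (mem x y).
  - move=> z /andP[xz zy]; have xzy : x <= z <= y by rewrite !ltW.
    by exists (w' z); [exact/dw/(mem x y) | exact: hM].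
(* Fixed point of [v |-> |w tau| + H d + v / 2], the map given by one use of the mean value
   inequality. The starting bound [M] depends on [s], but its share is halved in each round. *)
pose C : R := 2 * (`|w tau| + H * d).
have C0 : 0 <= C by rewrite mulr_ge0// addr_ge0// mulr_ge0// ltW.
have bound s : a < s <= tau -> `|w s| <= C.
  move=> /andP[as_ st].
  have [|M HM] := @bounded_on_segment w s tau st.
    move=> t tst; apply: (@cont_inW _ _ `]a, b]); first exact: memJ.
    by apply/deriv_in_cont/dw/(mem s tau).
  suff geo (n : nat) (u : R) : s <= u <= tau -> `|w u| <= C + M * 2^-1 ^+ n.
    by apply: (@le_add_halving _ _ _ M) => n; apply: geo; rewrite lexx.
  elim: n u => [|n ih] u su; first by rewrite expr0 mulr1 (le_trans (HM u su))// lerDr.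
  case/andP: su => su ut.
  have h1 : `|w tau - w u| <= (H + kap * (C + M * 2^-1 ^+ n)) * (tau - u).
    apply: mvt => //; first exact: lt_le_trans su.
    move=> z /andP[uz zt]; have sz : s <= z <= tau by rewrite zt (le_trans su).
    rewrite (le_trans (bw z (mem _ _ _ as_ (lexx tau) sz)))// lerD2l ler_wpM2l//.
    exact: ih.
  have CM0 : 0 <= C + M * 2^-1 ^+ n by apply: le_trans (normr_ge0 (w u)) (ih u _); rewrite su.
  have h2 : (H + kap * (C + M * 2^-1 ^+ n)) * (tau - u) <= (H + kap * (C + M * 2^-1 ^+ n)) * d.
    by rewrite ler_wpM2l ?addr_ge0 ?mulr_ge0// /tau; lra.
  have h3 : kap * d * (C + M * 2^-1 ^+ n) <= 2^-1 * (C + M * 2^-1 ^+ n) by rewrite ler_wpM2r.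
  have h4 : `|w u| <= `|w tau| + `|w tau - w u|.
    by rewrite -{1}[w u](subKr (w tau)) (le_trans (ler_normB _ _)).
  have -> : M * 2^-1 ^+ n.+1 = M * 2^-1 ^+ n / 2 by rewrite exprSr mulrA.
  move: (M * 2^-1 ^+ n) CM0 h1 h2 h3 => v CM0 h1 h2 h3.
  have CE : C = 2 * (`|w tau| + H * d) by [].
  lra.
pose C' : R := H + kap * C.
have C'0 : 0 <= C' by rewrite addr_ge0// mulr_ge0.
have lip s t : a < s -> s <= t -> t <= tau -> `|w t - w s| <= C' * (t - s).
  move=> as_ st tt; apply: mvt => // z szt; have azb := mem s t z as_ tt szt.
  rewrite (le_trans (bw z azb))// lerD2l ler_wpM2l// bound//.
  by case/andP: azb => -> _; case/andP: szt => _ /le_trans; exact.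
(* [w] is Lipschitz on []a, tau]]. Its limit at [a] is found along a sequence whose gaps halve, and
   the same Lipschitz bound then compares every [s] with that sequence. *)
pose sn n := a + d * 2^-1 ^+ n.
have sn_gt n : a < sn n by rewrite ltrDl mulr_gt0// exprn_gt0.
have snS n : sn n - sn n.+1 = d * 2^-1 ^+ n / 2.
  by rewrite /sn exprSr; field.
have sn_le n : sn n <= tau.
  by rewrite lerD2l -[leRHS]mulr1 ler_pM2l// exprn_ile1// invf_le1// ler1n.
have half_gt0 n : 0 <= d * 2^-1 ^+ n / 2 :> R by rewrite !mulr_ge0 ?exprn_ge0// ltW.
have [|n|l _ Hl] := @halving_steps_cvg _ _ (fun n => w (sn n)) (fun n => C' * d * 2^-1 ^+ n).
- move=> n; rewrite distrC (le_trans (lip _ _ (sn_gt _) _ (sn_le _)))//.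
    by rewrite -subr_ge0 snS.
  rewrite snS -!mulrA ler_wpM2l// ler_wpM2l ?(ltW d0)//.
  by rewrite ler_pdivrMr// ler_peMr ?exprn_ge0// ler1n.
- by rewrite exprSr !mulrA.
exists l, tau, C'; split=> //; [by rewrite ltrDl | by rewrite /tau; lra |].
move=> s /andP[as_ st]; apply: (@le_add_halving _ _ _ (3 * (C' * d))) => n.
have h1 : `|w s - w (sn n)| <= C' * (s - a + d * 2^-1 ^+ n).
  have dn : 0 <= d * 2^-1 ^+ n by rewrite mulr_ge0 ?exprn_ge0// ltW.
  have [ss|ss] := leP (sn n) s.
    rewrite (le_trans (lip _ _ (sn_gt n) ss st))// ler_wpM2l//.
    by rewrite /sn; lra.
  rewrite distrC (le_trans (lip _ _ as_ (ltW ss) (sn_le n)))// ler_wpM2l//.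
  by rewrite /sn; lra.
have := Hl n; rewrite distrC -(subrKA (w (sn n)) (w s)) => h2.
rewrite (le_trans (ler_normD _ _))//.
move: h1 h2; rewrite -!mulrA; move: (d * 2^-1 ^+ n) => v; lra.
Qed.
End DerivativesOnSegments.

(** * Root systems *)

Section RootSystem.
Context {R : realType} {k : scalar_kind}.
Variables (X Y : completeNormedModType (scal R k)) (T : pencil X Y).
Variables (nu n : nat) (rs : @root_data R k X Y n).
Local Notation K := (scal R k).
Local Notation A := (op_A T).
Local Notation B := (op_B T).
Local Notation D := (dom T).
Local Notation m := (mult rs).
Local Notation phi := (rv rs).
Local Notation q := (fn rs).
Local Notation b i j := (adjB T (q i j)).
Local Notation P2 := (P2 T rs).
Local Notation P1 := (P1 T rs).
Local Notation P20 := (P20 T rs).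
Local Notation P2S := (P2S T rs).
Local Notation Q2 := (Q2 T rs).
Local Notation Q1 := (Q1 T rs).
Local Notation Q2s := (Q2s T rs).
Local Notation Q2S := (Q2S T rs).
Local Notation tA := (tildeA T rs).
Hypothesis HA : closed_densely_defined (dom_A T) A.
Hypothesis HB : closed_densely_defined (dom_B T) B.
Hypothesis HAcl : closed (A @` dom_A T).
Hypothesis HAB : dom_A T `<=` dom_B T.
Hypothesis Hreg : regular_pencil T nu.
Hypothesis Hroot : root_system T nu rs.

Lemma domE x : D x <-> dom_A T x.
Proof. by split=> [[]//|Ax]; split=> //; exact: HAB. Qed.

Lemma mult_gt0 i : (1 <= m i)%N.
Proof. by case: Hroot => _ [/(_ i)/andP[]]. Qed.

Lemma adjointP DT (S : X -> Y) f : adjoint_dom DT S f ->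
  is_adjoint DT S f (adjoint DT S f).
Proof. by case=> _ [p hp]; rewrite /adjoint; case: xgetP => [x -> //|/(_ p)]. Qed.

Lemma adjB_is_adjoint i j : (1 <= j <= m i)%N -> is_adjoint (dom_B T) B (q i j) (b i j).
Proof. case: Hroot => _ _ _ _ [H _ _ _] ji; exact: adjointP (H _ _ ji).2. Qed.

Lemma adjA_is_adjoint i j : (1 <= j <= m i)%N ->
  is_adjoint (dom_A T) A (q i j) (adjA T (q i j)).
Proof. case: Hroot => _ _ _ _ [H _ _ _] ji; exact: adjointP (H _ _ ji).1. Qed.

Lemma b_dual i j : (1 <= j <= m i)%N -> dual (b i j).
Proof. by case/adjB_is_adjoint. Qed.

Lemma q_dual i j : (1 <= j <= m i)%N -> dual (q i j).
Proof. by case: Hroot => _ _ _ _ [H _ _ _] /H[[]]. Qed.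

Lemma bE i j x : (1 <= j <= m i)%N -> D x -> b i j x = q i j (B x).
Proof. by move=> /adjB_is_adjoint[_ H] [_ ?]; exact: H. Qed.

Lemma b1_dual i : dual (b i 1%N).
Proof. by apply: b_dual; rewrite mult_gt0. Qed.

Lemma qm_dual i : dual (q i (m i)).
Proof. by apply: q_dual; rewrite mult_gt0 leqnn. Qed.

Lemma q_last_A i x : D x -> q i (m i) (A x) = 0.
Proof.
move=> [Dx _]; have [|_ H] := @adjA_is_adjoint i (m i).
  by rewrite mult_gt0 leqnn.
by rewrite -H//; case: Hroot => _ _ _ _ [_ -> _ _].
Qed.

Lemma q_A i j x : (1 <= j < m i)%N -> D x -> q i j (A x) = - b i j.+1 x.
Proof.
move=> jm [Dx _]; have [|_ H] := @adjA_is_adjoint i j.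
  by case/andP: jm => -> /ltnW.
by rewrite -H//; case: Hroot => _ _ _ _ [_ _ H' _]; exact: H'.
Qed.

Lemma dom_phi i j : (1 <= j <= m i)%N -> D (phi i j).
Proof. by case: Hroot => _ _ H _ _; exact: H. Qed.

Lemma biorth i i' j l : (1 <= j <= m i)%N -> (1 <= l <= m i')%N ->
  q i' l (B (phi i j)) = ((i == i') && (j == l))%:R.
Proof. by case: Hroot => _ _ _ _ [_ _ _ H]; exact: H. Qed.

Lemma biorthX i i' j l : (1 <= j <= m i)%N -> (1 <= l <= m i')%N ->
  b i' l (phi i j) = ((i == i') && (j == l))%:R.
Proof. by move=> ji li; rewrite bE ?biorth//; exact: dom_phi. Qed.

Lemma dom_phi1 i : D (phi i 1%N).
Proof. by apply: dom_phi; rewrite mult_gt0. Qed.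

Lemma A_phi1 i : A (phi i 1%N) = 0.
Proof. by case: Hroot => -[/(_ i)[]]. Qed.

Lemma kerA x : D x -> A x = 0 -> exists c : 'I_n -> K, x = \sum_(i < n) c i *: phi i 1%N.
Proof. by case: Hroot => -[_ H] _ _ _ _ Dx /(H x Dx)[c [? _]]; exists c. Qed.

Section Dual.
Variables (Z : normedModType K) (p : Z -> K).
Hypothesis dp : dual p.
Lemma dualP a x y : p (a *: x + y) = a * p x + p y.
Proof. by case: dp => + _ _; apply. Qed.
Lemma dualD x y : p (x + y) = p x + p y.
Proof. by have := dualP 1 x y; rewrite scale1r mul1r. Qed.
Lemma dual0 : p 0 = 0.
Proof. by apply: (addrI (p 0)); rewrite -dualD !addr0. Qed.
Lemma dualZ a x : p (a *: x) = a * p x.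
Proof. by have := dualP a x 0; rewrite dual0 !addr0. Qed.
Lemma dualN x : p (- x) = - p x.
Proof. by rewrite -scaleN1r dualZ mulN1r. Qed.
Lemma dualB x y : p (x - y) = p x - p y.
Proof. by rewrite dualD dualN. Qed.
Lemma dual_sum I r (P : pred I) (G : I -> Z) :
  p (\sum_(i <- r | P i) G i) = \sum_(i <- r | P i) p (G i).
Proof. exact: (big_morph p dualD dual0). Qed.
End Dual.

Lemma range_index i j : (j \in index_iota 1 (m i).+1) -> (1 <= j <= m i)%N.
Proof. by rewrite mem_index_iota ltnS. Qed.

Lemma bounded_P20 : bounded_op P20.
Proof. by apply: bounded_op_sum => i _ _; exact/bounded_op_rank1/b1_dual. Qed.

Lemma bounded_P2 : bounded_op P2.
Proof.
apply: bounded_op_sum => i _ _; apply: bounded_op_sum => j /range_index ji _.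
exact/bounded_op_rank1/b_dual.
Qed.

Lemma bounded_P2S : bounded_op P2S.
Proof.
apply: bounded_op_sum => i _ _; apply: bounded_op_sum => j jm _.
apply/bounded_op_rank1/b_dual; move: jm; rewrite mem_index_iota ltnS.
by case/andP => /ltnW -> ->.
Qed.

Lemma bounded_P1 : bounded_op P1.
Proof. by apply: bounded_opB; [exact: bounded_op_id | exact: bounded_P2]. Qed.

Lemma bounded_Q2s : bounded_op Q2s.
Proof. by apply: bounded_op_sum => i _ _; exact/bounded_op_rank1/qm_dual. Qed.

Lemma biorth_sum (G : 'I_n -> nat -> K) i l : (1 <= l <= m i)%N ->
  \sum_(i' < n) \sum_(1 <= j < (m i').+1) G i' j * ((i' == i) && (j == l))%:R = G i l.
Proof.
move=> li; rewrite (bigD1 i)//= [X in _ + X]big1 ?addr0; last first.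
  by move=> i' /negbTE ->; rewrite big1// => j _; rewrite mulr0.
rewrite (bigD1_seq l) ?iota_uniq//=; last by rewrite mem_index_iota ltnS.
rewrite !eqxx mulr1 big1 ?addr0// => j /negbTE ->.
by rewrite mulr0.
Qed.

Lemma b_P2 i j x : (1 <= j <= m i)%N -> b i j (P2 x) = b i j x.
Proof.
move=> ji; rewrite (dual_sum (b_dual ji)) -[RHS](biorth_sum (fun i j => b i j x) ji).
apply: eq_bigr => i' _; rewrite (dual_sum (b_dual ji)).
rewrite !big_nat; apply: eq_bigr => j' j'i; rewrite (dualZ (b_dual ji)).
by rewrite biorthX// -ltnS.
Qed.

Lemma q_Q2 i j y : (1 <= j <= m i)%N -> q i j (Q2 y) = q i j y.
Proof.
move=> ji; rewrite (dual_sum (q_dual ji)) -[RHS](biorth_sum (fun i j => q i j y) ji).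
apply: eq_bigr => i' _; rewrite (dual_sum (q_dual ji)).
rewrite !big_nat; apply: eq_bigr => j' j'i; rewrite (dualZ (q_dual ji)).
by rewrite biorth// -ltnS.
Qed.

Lemma b_P20 i x : b i 1%N (P20 x) = b i 1%N x.
Proof.
rewrite (dual_sum (b1_dual i)) (bigD1 i)//= [X in _ + X]big1 ?addr0.
  by rewrite (dualZ (b1_dual i)) biorthX ?mult_gt0// !eqxx mulr1.
move=> i' /negbTE ne; rewrite (dualZ (b1_dual i)) biorthX ?mult_gt0//.
by rewrite ne mulr0.
Qed.

Lemma q_Q2s i y : q i (m i) (Q2s y) = q i (m i) y.
Proof.
have mm j : (1 <= m j <= m j)%N by rewrite mult_gt0 leqnn.
rewrite (dual_sum (qm_dual i)) (bigD1 i)//= [X in _ + X]big1 ?addr0.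
  by rewrite (dualZ (qm_dual i)) biorth// !eqxx mulr1.
move=> i' /negbTE ne; rewrite (dualZ (qm_dual i)) biorth//.
by rewrite ne mulr0.
Qed.

Lemma q_Q2S i y : q i (m i) (Q2S y) = 0.
Proof.
rewrite (dual_sum (qm_dual i)) big1// => i' _.
rewrite (dual_sum (qm_dual i)) big_nat big1// => j /andP[j1 jm].
rewrite (dualZ (qm_dual i)) biorth ?mult_gt0 ?leqnn//; last by rewrite j1 ltnW.
case: eqP => [ii|]; last by rewrite mulr0.
by rewrite -ii ltn_eqF// mulr0.
Qed.

Lemma P2_split x : P2 x = P20 x + P2S x.
Proof.
rewrite /P2S big_mkcond -big_split/=; apply: eq_bigr => i _.
rewrite [LHS]big_ltn ?ltnS ?mult_gt0//; congr (_ + _).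
by case: eqP => //= ->; rewrite big_geq.
Qed.

Lemma Q2_split y : Q2 y = Q2S y + Q2s y.
Proof.
rewrite /Q2S big_mkcond -big_split/=; apply: eq_bigr => i _.
rewrite big_nat_recr ?mult_gt0//=; congr (_ + _).
by case: eqP => //= ->; rewrite big_geq.
Qed.

Lemma P_split x : P1 x + P2S x = x - P20 x.
Proof. by rewrite /P1 P2_split opprD addrA subrK. Qed.

Lemma dom_P20 x : D (P20 x).
Proof. by apply: (dom_sum HA HB) => i _; apply: (domZ HA HB); exact: dom_phi1. Qed.

Lemma dom_P2S x : D (P2S x).
Proof.
apply: (dom_sum HA HB) => i _; rewrite big_nat; apply: (dom_sum HA HB) => j.
rewrite ltnS => /andP[j2 jm]; apply/(domZ HA HB)/dom_phi.
by rewrite jm ltnW.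
Qed.

Lemma A_P20 x : A (P20 x) = 0.
Proof.
rewrite (lin_sum HA HB (opA_linear HA)) => [|i _]; last exact/(domZ HA HB)/dom_phi1.
rewrite big1// => i _.
by rewrite (linZ HA HB (opA_linear HA)) ?A_phi1 ?scaler0//; exact: dom_phi1.
Qed.

Lemma P20K x : P20 (P20 x) = P20 x.
Proof. by rewrite [LHS]/Defs.P20; apply: eq_bigr => i _; rewrite b_P20. Qed.

Lemma P20_phi1 i : P20 (phi i 1%N) = phi i 1%N.
Proof.
rewrite /Defs.P20 (bigD1 i)//= biorthX ?mult_gt0// !eqxx scale1r big1 ?addr0//.
by move=> i' /negbTE ne; rewrite biorthX ?mult_gt0// eq_sym ne scale0r.
Qed.

Lemma D20E u : D20 T rs u <-> P20 u = u.
Proof.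
split=> [[x _ <-]|Pu]; first exact: P20K.
by exists (P20 u) => //; [exact: dom_P20 | rewrite P20K].
Qed.

Lemma Q2sK y : Q2s (Q2s y) = Q2s y.
Proof. by rewrite [LHS]/Defs.Q2s; apply: eq_bigr => i _; rewrite q_Q2s. Qed.

Lemma Q2s_A x : D x -> Q2s (A x) = 0.
Proof.
by move=> Dx; rewrite /Defs.Q2s big1// => i _; rewrite q_last_A// scale0r.
Qed.

Lemma Q2s_eq0 y : Q2s y = 0 <-> forall i, q i (m i) y = 0.
Proof.
split=> [y0 i|H]; first by rewrite -q_Q2s y0 (dual0 (qm_dual i)).
by rewrite /Defs.Q2s big1// => i _; rewrite H scale0r.
Qed.

Lemma P20_eq0 x : P20 x = 0 <-> forall i, b i 1%N x = 0.
Proof.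
split=> [y0 i|H]; first by rewrite -b_P20 y0 (dual0 (b1_dual i)).
by rewrite /Defs.P20 big1// => i _; rewrite H scale0r.
Qed.

(** The sum is the kernel of the bounded projector [Q2s], and [y - Q2s y] projects onto it;
    membership is handled in this form from here on. *)
Lemma Y1_Y2S_E y : dsum (Y1 T rs) (Y2S T rs) y <-> Q2s y = 0.
Proof.
have mm i : (1 <= m i <= m i)%N by rewrite mult_gt0 leqnn.
split=> [[_ [a _ <-] [_ [c _ <-] ->]]|y0].
  apply/Q2s_eq0 => i; rewrite (dualD (qm_dual i)) q_Q2S addr0.
  by rewrite (dualB (qm_dual i)) q_Q2// subrr.
exists (Q1 y); first by exists y.
by exists (Q2S y); [exists y | rewrite /Defs.Q1 Q2_split y0 addr0 subrK].
Qed.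

(** On [D] the functional [q i (m i) \o B] is [b i (m i)], which vanishes on the range of [P1]. This
    is why [F2s] contains [B] only on the components [x2S] and [x20]. *)
Lemma Q2s_B_P1 x : D x -> Q2s (B (P1 x)) = 0.
Proof.
move=> Dx; apply/Q2s_eq0 => i; have mm : (1 <= m i <= m i)%N by rewrite mult_gt0 leqnn.
rewrite -bE//; first by rewrite (dualB (b_dual mm)) b_P2// subrr.
apply: (domB HA HB) => //; rewrite P2_split.
by apply: (domD HA HB); [exact: dom_P20 | exact: dom_P2S].
Qed.

(** * The operator [tildeA] and its bounded inverse *)

Lemma tildeA_linear a x y : D x -> D y -> tA (a *: x + y) = a *: tA x + tA y.
Proof.
move=> Dx Dy; rewrite /tildeA (opA_linear HA)// scalerDr addrACA; congr (_ + _).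
rewrite scaler_sumr -big_split/=; apply: eq_bigr => i _.
by rewrite (dualP (b1_dual i)) scalerDl scalerA.
Qed.

(** [q i (m i)] annihilates the range of [A] and is biorthogonal to the vectors of the finite rank
    term, so the coordinates of [P20 x] can be read off [tA x]. *)
Lemma q_tildeA i x : D x -> q i (m i) (tA x) = b i 1%N x.
Proof.
have mm j : (1 <= m j <= m j)%N by rewrite mult_gt0 leqnn.
move=> Dx; rewrite (dualD (qm_dual i)) q_last_A// add0r.
rewrite (dual_sum (qm_dual i)) (bigD1 i)//= [X in _ + X]big1 ?addr0.
  by rewrite (dualZ (qm_dual i)) biorth// !eqxx mulr1.
move=> i' /negbTE ne; rewrite (dualZ (qm_dual i)) biorth//.
by rewrite ne mulr0.
Qed.

Lemma tildeA_P20_0 x : P20 x = 0 -> tA x = A x.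
Proof.
move=> /P20_eq0 x0; rewrite /tildeA big1 ?addr0// => i _.
by rewrite x0 scale0r.
Qed.

Lemma Q2s_tildeA_eq0 x : D x -> Q2s (tA x) = 0 <-> P20 x = 0.
Proof.
move=> Dx; split=> [/Q2s_eq0 H|/P20_eq0 H].
  by apply/P20_eq0 => i; rewrite -q_tildeA.
by apply/Q2s_eq0 => i; rewrite q_tildeA.
Qed.

(** [tA x = 0] forces [P20 x = 0], hence [A x = 0]; then [x] lies in the kernel of [A], on which
    [P20] is the identity. *)
Lemma tildeA_inj x : D x -> tA x = 0 -> x = 0.
Proof.
move=> Dx t0; have P0 : P20 x = 0.
  by apply/Q2s_tildeA_eq0 => //; rewrite t0 (bop0 bounded_Q2s).
have [|c xE] := kerA Dx; first by rewrite -tildeA_P20_0.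
rewrite -P0 {1}xE [in RHS]xE (bop_sum bounded_P20).
apply: eq_bigr => i _; rewrite (bopZ bounded_P20); congr (_ *: _).
by rewrite P20_phi1.
Qed.

(** The range becomes the preimage of the range of [A] under a bounded map, so it is closed before
    surjectivity is known. *)
Lemma range_tildeA y :
  (exists2 x, D x & tA x = y) <-> (A @` dom_A T) (y - Q2s y).
Proof.
split=> [[x Dx <-]|[x /domE Dx Ax]].
  exists x; first exact/domE.
  rewrite /tildeA (bopD bounded_Q2s) Q2s_A// add0r.
  rewrite (_ : \sum_(i < n) _ = Q2s (tA x)) ?Q2sK ?addrK//.
  by apply: eq_bigr => i _; rewrite q_tildeA.
(* Adding kernel vectors leaves [A x] alone and shifts the coordinates [b i 1] freely, so they can
   be set to the prescribed [q i (m i) y]. *)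
pose c i := q i (m i) y - b i 1%N x.
pose u := \sum_(i < n) c i *: phi i 1%N.
have Du : D u by apply: (dom_sum HA HB) => i _; exact/(domZ HA HB)/dom_phi1.
have Au : A u = 0.
  rewrite (lin_sum HA HB (opA_linear HA)) => [|i _]; last exact/(domZ HA HB)/dom_phi1.
  rewrite big1// => i _.
  by rewrite (linZ HA HB (opA_linear HA)) ?A_phi1 ?scaler0//; exact: dom_phi1.
have bu i : b i 1%N u = c i.
  rewrite (dual_sum (b1_dual i)) (bigD1 i)//= [X in _ + X]big1 ?addr0.
    by rewrite (dualZ (b1_dual i)) biorthX ?mult_gt0// !eqxx mulr1.
  move=> i' /negbTE ne; rewrite (dualZ (b1_dual i)) biorthX ?mult_gt0//.
  by rewrite ne mulr0.
exists (x + u); first exact: (domD HA HB).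
rewrite /tildeA (linD (opA_linear HA))// Au addr0 Ax -[RHS](subrK (Q2s y)).
congr (_ + _); apply: eq_bigr => i _.
by rewrite (dualD (b1_dual i)) bu addrC subrK.
Qed.

Lemma bounded_tildeA_correction :
  bounded_op (fun x => \sum_(i < n) b i 1%N x *: B (phi i (m i))).
Proof. by apply: bounded_op_sum => i _ _; exact/bounded_op_rank1/b1_dual. Qed.

Lemma tildeA_bound : exists2 c : R, 0 < c & forall x, D x ->
  rnorm x <= c * rnorm (tA x) /\ rnorm (B x) <= c * rnorm (tA x).
Proof.
pose Gam (x : realify X) (z y : realify Y) := [/\ D x, z = B x & y = tA x].
have GamP a x z y x' z' y' : Gam x z y -> Gam x' z' y' ->
    Gam (of_real k a *: (x : X) + x') (of_real k a *: (z : Y) + z')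
      (of_real k a *: (y : Y) + y').
  move=> [Dx -> ->] [Dx' -> ->]; split.
  - exact: (dom_linear HA HB).
  - by rewrite (opB_linear HB).
  - by rewrite tildeA_linear.
have Gam0 : Gam 0 0 0.
  split; first exact: (dom0 HA HB).
    by rewrite (lin0 HA HB (opB_linear HB)).
  by rewrite (lin0 HA HB tildeA_linear).
have [|||||C C0 H] := @closed_relation_open _ (realify X) (realify Y) (realify Y) Gam.
- pose F := (fun x : realify X => (\sum_(i < n) b i 1%N x *: B (phi i (m i)) : realify Y)).
  have cF : continuous F by exact: (bounded_op_continuous bounded_tildeA_correction).
  (* The relation is cut out by the closed graphs of [A] and [B]: moving the finite rank term [F] to
     the side of [y] leaves [y - F x = A x], and the middle component is [B x]. *)
  have -> : [set p | Gam p.1.1 p.1.2 p.2] =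
     ((fun p : realify X * realify Y * realify Y => (p.1.1, p.2 - F p.1.1)) @^-1`
        [set p : X * Y | dom_A T p.1 /\ p.2 = A p.1]) `&`
     ((fun p : realify X * realify Y * realify Y => p.1) @^-1`
        [set p : X * Y | dom_B T p.1 /\ p.2 = B p.1]).
    apply/seteqP; split=> -[[x z] y] /=.
      move=> [[DAx DBx] -> ->]; split=> //; split=> //.
      exact: addrK.
    move=> [[DAx yE] [DBx ->]]; split=> //.
    by rewrite /tildeA -yE; exact/esym/subrK.
  apply: closedI; apply: closed_comp.
  + move=> p _; apply: cvg_pair; first by apply: (cvg_comp fst fst); exact: cvg_fst.
    apply: cvgB; first exact: cvg_snd.
    apply: (@cvg_comp _ _ _ (fun p : realify X * realify Y * realify Y => p.1.1) F); last exact: cF.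
    by apply: (cvg_comp fst fst); exact: cvg_fst.
  + by case: HA.
  + by move=> p _; exact: cvg_fst.
  + by case: HB.
- exact: Gam0.
- move=> x z y x' z' y' G G'; have := GamP 1 _ _ _ _ _ _ G G'.
  by rewrite of_real1 !scale1r.
- move=> a x z y G; have := GamP a _ _ _ _ _ _ G Gam0.
  by rewrite !addr0.
- have -> : [set y | exists x z, Gam x z y] =
      (fun y : realify Y => (y - Q2s y : realify Y)) @^-1` (A @` dom_A T).
    apply/seteqP; split=> y /=.
      by move=> [x [z [Dx _ ->]]]; apply/range_tildeA; exists x.
    by move/range_tildeA => [x Dx <-]; exists x, (B x).
  apply: closed_comp => //.
  move=> y _; apply: cvgB; first exact: cvg_id.
  exact: (bounded_op_continuous bounded_Q2s).
exists C => // x Dx; have [|x' [z' [[Dx' z'E tE] h1 h2]]] := H (tA x).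
  by exists x, (B x).
(* The open mapping argument yields some solution with the bounds; injectivity identifies it with
   [x]. *)
suff xx' : x' = x.
  by rewrite xx' in h1 z'E; split; [exact: h1 | rewrite -z'E; exact: h2].
apply/eqP; rewrite -subr_eq0; apply/eqP/tildeA_inj; first exact: (domB HA HB).
by rewrite (linB HA HB tildeA_linear)// -tE subrr.
Qed.

(* Perturbation argument: for mu = 1 / a small, A x + mu B x = y is solvable,
   x has no component along the root vectors, and B x stays bounded. *)
Lemma range_A_of_annihilated y :
  (forall i j, (1 <= j <= m i)%N -> q i j y = 0) -> (A @` dom_A T) y.
Proof.
move=> y0; have [c c0 Hc] := tildeA_bound.
have [r Hr] := regular_pencil_surjective Hreg.
pose rho := of_real k : R -> K.
have sol a : r < a -> 0 < a -> exists2 x, D x & A x + (rho a)^-1 *: B x = y /\ P20 x = 0.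
  move=> ra a0; have [x Dx xE] := Hr a ra (rho a *: y).
  have ra0 : rho a != 0 by rewrite -(of_real0 (k := k)) gt_eqF// ltr_of_real.
  exists x => //; have yE : A x + (rho a)^-1 *: B x = y.
    by apply: (scalerI ra0); rewrite -xE scalerDr scalerA divff// scale1r.
  split=> //; apply/P20_eq0.
  (* The functionals kill the components along each chain from its end: [q i (m i)] gives
     [b i (m i) x = 0], and [q i j] gives [b i j x = a * b i j.+1 x]. At [j = 1] this says
     [P20 x = 0]. *)
  have last i : b i (m i) x = 0.
    have mm : (1 <= m i <= m i)%N by rewrite mult_gt0 leqnn.
    have := y0 i (m i) mm; rewrite -yE (dualD (q_dual mm)) q_last_A// add0r.
    rewrite (dualZ (q_dual mm)) -bE// => /eqP; rewrite mulf_eq0 invr_eq0 (negbTE ra0).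
    by move/eqP.
  have step i j : (1 <= j < m i)%N -> b i j.+1 x = 0 -> b i j x = 0.
    move=> jm bj; have mm : (1 <= j <= m i)%N by case/andP: jm => -> /ltnW.
    have := y0 i j mm; rewrite -yE (dualD (q_dual mm)) q_A// bj oppr0 add0r.
    rewrite (dualZ (q_dual mm)) -bE// => /eqP; rewrite mulf_eq0 invr_eq0 (negbTE ra0).
    by move/eqP.
  move=> i; have {}H d : (d < m i)%N -> b i (m i - d)%N x = 0.
    elim: d => [|d ih] dm; first by rewrite subn0.
    apply: step; first by rewrite subn_gt0 dm/= ltn_subrL mult_gt0.
    by rewrite subnSK//; [exact: ih (ltnW dm) | exact: ltnW].
  have := H (m i).-1; rewrite prednK ?mult_gt0// leqnn => /(_ isT).
  by rewrite -subn1 subKn// mult_gt0.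
suff : closure (A @` dom_A T : set (realify Y)) y by move/HAcl.
move=> U /nbhs_ballP[e /= e0 eU].
(* [r + 1] gives solvability. [2 * c] absorbs half of [B x] in [|B x| <= c (|y| + |B x| / a)], so
   that [|B x| <= 2 c |y|]. The last entry then makes [|y - A x| = |B x| / a] smaller than [e]. *)
pose a := Num.max (r + 1) (Num.max (2 * c) (2 * c * rnorm y / e + 1)).
have [a1 a2 a3] : [/\ r + 1 <= a, 2 * c <= a & 2 * c * rnorm y / e + 1 <= a].
  by rewrite /a !le_max !lexx !orbT.
have a0 : 0 < a by apply: lt_le_trans a2; rewrite mulr_gt0.
have [|x Dx [yE P0]] := sol a _ a0; first lra.
exists (A x); split; first by exists x => //; exact/domE.
apply: eU; rewrite -ball_normE /= -[`|_|]/(rnorm (y - A x)) -yE addrC addKr.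
rewrite rnormZ -/rho /rho -of_realV snorm_of_real gtr0_norm ?invr_gt0//.
rewrite mulrC ltr_pdivrMr//.
have [_] := Hc x Dx; rewrite tildeA_P20_0// => hB.
have : rnorm (A x) <= rnorm y + a^-1 * rnorm (B x).
  rewrite -[A x](addrK ((rho a)^-1 *: B x)) yE (le_trans (ler_rnormB _ _))//.
  by rewrite rnormZ /rho -of_realV snorm_of_real gtr0_norm ?invr_gt0.
have a3' : 2 * c * rnorm y < a * e.
  by rewrite -ltr_pdivrMr//; lra.
have : c * (a^-1 * rnorm (B x)) <= rnorm (B x) / 2.
  rewrite mulrA mulrC ler_wpM2l ?rnorm_ge0// ler_pdivrMr//; lra.
move=> h1 h2; have h3 : c * rnorm (A x) <= c * (rnorm y + a^-1 * rnorm (B x)).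
  by rewrite ler_pM2l.
lra.
Qed.

Lemma tildeA_surjective y : exists2 x, D x & tA x = y.
Proof.
apply/range_tildeA.
pose S z := exists2 x, D x & A x = z.
have S0 : S 0 by exists 0; [exact: (dom0 HA HB) | exact: (lin0 HA HB (opA_linear HA))].
have SD z z' : S z -> S z' -> S (z + z').
  move=> [x Dx <-] [x' Dx' <-]; exists (x + x'); first exact: (domD HA HB).
  exact: (linD (opA_linear HA)).
have SZ a z : S z -> S (a *: z).
  move=> [x Dx <-]; exists (a *: x); first exact: (domZ HA HB).
  exact: (linZ HA HB (opA_linear HA)).
suff [x /domE Dx <-] : S (y - Q2s y) by exists x.
(* The first summand is annihilated by all [q i j]. The second is a combination of vectors
   [B (phi i j)] with [j < m i], and these are [- A (phi i j.+1)] by the chain relations. *)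
have -> : y - Q2s y = (y - Q2 y) + Q2S y by rewrite Q2_split [Q2S y + _]addrC opprD addrA subrK.
apply: (SD).
  have [i j ji|x /domE Dx <-] := @range_A_of_annihilated (y - Q2 y); last by exists x.
  by rewrite (dualB (q_dual ji)) q_Q2// subrr.
rewrite /Defs.Q2S; apply: (@big_ind _ S _ _ S0 SD) => i _.
rewrite big_nat; apply: (@big_ind _ S _ _ S0 SD) => j /andP[j1 jm].
apply: (SZ); exists (- phi i j.+1); first exact/(domN HA HB)/dom_phi.
rewrite (linN HA HB (opA_linear HA)); last exact: dom_phi.
by case: Hroot => _ _ _ AE _; rewrite AE ?opprK// ltnS j1.
Qed.

Lemma tildeA_inverse : exists S : Y -> X, [/\ bounded_op S,
  bounded_op (B \o S), forall y, D (S y) /\ tA (S y) = y &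
  forall x, D x -> S (tA x) = x].
Proof.
have [S HS] := choice (fun y => let: ex_intro2 x Dx xE := tildeA_surjective y in
  ex_intro (fun x => D x /\ tA x = y) x (conj Dx xE)).
have [c c0 Hc] := tildeA_bound.
have SK x : D x -> S (tA x) = x.
  move=> Dx; apply/eqP; rewrite -subr_eq0; apply/eqP/tildeA_inj.
    by apply: (domB HA HB) => //; case: (HS (tA x)).
  have [DS tS] := HS (tA x).
  by rewrite (linB HA HB tildeA_linear)// tS subrr.
have SP a y z : S (a *: y + z) = a *: S y + S z.
  have [Dy ty] := HS y; have [Dz tz] := HS z.
  by rewrite -{1}ty -{1}tz -tildeA_linear// SK//; exact: (dom_linear HA HB).
exists S; split=> //.
- split=> //.
  exists c => y _; have [Dy ty] := HS y; have [h _] := Hc _ Dy.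
  by rewrite ty in h.
- split=> //.
    move=> a y z _ _ /=; rewrite SP (opB_linear HB)//; [by case: (HS y)|by case: (HS z)].
  exists c => y _; have [Dy ty] := HS y; have [_ h] := Hc _ Dy.
  by rewrite ty in h.
Qed.

Lemma BP20_E u : P20 u = u -> B u = \sum_(i < n) b i 1%N u *: B (phi i 1%N).
Proof.
move=> {1}<-; rewrite (lin_sum HA HB (opB_linear HB)) => [|i _].
  by apply: eq_bigr => i _; rewrite (linZ HA HB (opB_linear HB))//; exact: dom_phi1.
exact/(domZ HA HB)/dom_phi1.
Qed.

Lemma bounded_BP20 : bounded_op (B \o P20).
Proof.
rewrite (_ : _ \o _ = fun x => \sum_(i < n) b i 1%N x *: B (phi i 1%N)).
  by apply: bounded_op_sum => i _ _; exact/bounded_op_rank1/b1_dual.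
apply/funext => x /=; rewrite BP20_E ?P20K//.
by apply: eq_bigr => i _; rewrite b_P20.
Qed.

Lemma bounded_BP2S : bounded_op (B \o P2S).
Proof.
rewrite (_ : _ \o _ = fun x => \sum_(i < n | m i != 1%N) \sum_(2 <= j < (m i).+1)
    b i j x *: B (phi i j)).
  apply: bounded_op_sum => i _ _; apply: bounded_op_sum => j jm _.
  apply/bounded_op_rank1/b_dual; move: jm; rewrite mem_index_iota ltnS.
  by case/andP => /ltnW -> ->.
have Dj i j : (2 <= j < (m i).+1)%N -> D (phi i j).
  by rewrite ltnS => /andP[/ltnW j1 jm]; apply: dom_phi; rewrite j1.
apply/funext => x; rewrite /= /Defs.P2S (lin_sum HA HB (opB_linear HB)) => [|i _].
  apply: eq_bigr => i _; rewrite !big_nat (lin_sum HA HB (opB_linear HB)) => [|j jm].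
    by apply: eq_bigr => j jm; rewrite (linZ HA HB (opB_linear HB))//; exact: Dj.
  exact/(domZ HA HB)/Dj.
by rewrite big_nat; apply: (dom_sum HA HB) => j jm; exact/(domZ HA HB)/Dj.
Qed.

(** * The implicit function *)

Section ImplicitFunction.
Variables (f : R -> X -> Y) (Mt : set Y) (M20 : set X).
Local Notation M12 := (M12 T rs Mt).
Local Notation L0 := (L0 T f rs).
Hypothesis Hf : continuous_rhs T f.
Hypothesis HMt : open_in (dsum (Y1 T rs) (Y2S T rs)) Mt.
Hypothesis HM20 : M20 `<=` D20 T rs.
Hypothesis Huniq : unique_solvability T f rs Mt M20.
Hypothesis Hlip : locally_lipschitz T f rs.
Hypothesis Happrox : approximate_invertibility T f rs Mt M20.
Hypothesis Hstab : M20_locally_stable T f rs Mt M20.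

Lemma rhs_cont t x : 0 <= t -> D x -> forall e : R, 0 < e ->
  exists2 d : R, 0 < d & forall s y, 0 <= s -> D y -> `|s - t| < d ->
    rnorm (y - x) < d -> rnorm (f s y - f t x) <= e.
Proof.
move=> t0 Dx e e0; have /subspace_continuousP /(_ (t, x)) := Hf.
move=> /(_ (conj t0 Dx)) H.
have {H} /cvgrPdist_le /(_ e e0) :
  (fun p : R * X => f p.1 p.2 : realify Y) @ within [set p : R * X | Rplus p.1 /\ D p.2] (nbhs (t, x)) -->
    (f t x : realify Y) by exact: H.
rewrite near_withinE => /nbhs_pair_rnorm[d d0 dH]; exists d => // s y s0 Dy st yx.
by rewrite rdistC; apply: (dH s y st yx).
Qed.

Lemma rhs_lip t x : 0 <= t -> D x -> exists d L : R, [/\ 0 < d, 0 <= L &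
  forall s y z, 0 <= s -> `|s - t| < d -> D y -> rnorm (y - x) < d ->
    D z -> rnorm (z - x) < d -> rnorm (f s y - f s z) <= L * rnorm (y - z)].
Proof.
move=> t0 Dx; have [U [V [L [[oU Ut] [oV Vx] L0 H]]]] := Hlip t0 Dx.
have [d d0 dV] := nbhs_rnorm (open_nbhs_nbhs (conj oV Vx)).
have /nbhs_ballP[d' /= d'0 d'U] := open_nbhs_nbhs (conj oU Ut).
have [c1 c10 h1] := bop_bound bounded_P1.
have [c2 c20 h2] := bop_bound bounded_P2S.
have [c3 c30 h3] := bop_bound bounded_P20.
exists (Num.min d d'), (L * (c1 + c2 + c3)); split.
- by rewrite lt_min d0.
- by rewrite mulr_ge0// !addr_ge0// ltW.
- move=> s y z s0; rewrite !lt_min => /andP[_ st] Dy /andP[yd _] Dz /andP[zd _].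
  apply: le_trans (H s y z _ s0 (dV _ yd) Dy (dV _ zd) Dz) _.
    by apply: d'U; rewrite -ball_normE /= distrC.
  rewrite -mulrA ler_wpM2l// !mulrDl /dnorm.
  by rewrite !lerD ?h1 ?h2 ?h3.
Qed.

Lemma M12_dom z : M12 z -> D z. Proof. by case. Qed.

Lemma Mt_Q2s y : Mt y -> Q2s y = 0.
Proof. by case: HMt => O _ -> [_]; move/Y1_Y2S_E. Qed.

Lemma M12_P20 z : M12 z -> P20 z = 0.
Proof. by move=> [Dz /Mt_Q2s]; move/Q2s_tildeA_eq0; exact. Qed.

Lemma M12_split z : M12 z -> P1 z + P2S z = z.
Proof. by move=> Mz; rewrite P_split M12_P20// subr0. Qed.

Lemma M20_P20 u : M20 u -> P20 u = u.
Proof. by move/HM20; move/D20E. Qed.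

Lemma dom_D20 u : P20 u = u -> D u.
Proof. by move=> <-; exact: dom_P20. Qed.

(** On [M12] the pair of arguments [x1], [x2S] carries the same information as their sum [z]. *)
Let G t z u : Y := F2s T f rs t (P1 z) (P2S z) u.

Lemma G_L0 t z u : M12 z -> P20 u = u -> G t z u = Q2s (f t (z + u) - B (z + u)).
Proof.
move=> Mz Pu; have Dz := M12_dom Mz; have Du := dom_D20 Pu.
rewrite /G /F2s M12_split// (bopB bounded_Q2s); congr (_ - _).
have DP : D (P1 z) by apply: (domB HA HB) => //; rewrite P2_split;
  apply: (domD HA HB); [exact: dom_P20 | exact: dom_P2S].
rewrite -{2}(M12_split Mz) -addrA (linD (opB_linear HB) DP).
  by rewrite (bopD bounded_Q2s) Q2s_B_P1// add0r.
by apply: (domD HA HB) => //; exact: dom_P2S.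
Qed.

Lemma G_solution t z u : 0 <= t -> M12 z -> P20 u = u -> L0 t (z + u) <-> G t z u = 0.
Proof.
move=> t0 Mz Pu; rewrite G_L0//; split=> [[]//|H]; split=> //.
by apply: (domD HA HB); [exact: M12_dom | exact: dom_D20].
Qed.

Lemma Y2s_E y : Y2s T rs y <-> Q2s y = y.
Proof. by split=> [[w _ <-]|H]; [exact: Q2sK | exists y]. Qed.

Lemma G_Y2s t z u : Q2s (G t z u) = G t z u.
Proof. by rewrite /G /F2s (bopB bounded_Q2s) !Q2sK. Qed.

(** At a fixed [u] the term [B u] cancels, and [B] remains only on the finite-dimensional range of
    [P2S], where it is bounded. Continuity in [z] thus reduces to that of [f]. *)
Lemma G_diff s t z z' u : M12 z -> M12 z' -> P20 u = u ->
  G s z u - G t z' u = Q2s (f s (z + u) - f t (z' + u)) - Q2s (B (P2S (z - z'))).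
Proof.
move=> Mz Mz' Pu; have Du := dom_D20 Pu; have Dz := @dom_P2S z; have Dz' := @dom_P2S z'.
have -> : B (P2S (z - z')) = B (P2S z + u) - B (P2S z' + u).
  rewrite (bopB bounded_P2S).
  rewrite -(linB HA HB (opB_linear HB) (domD HA HB Dz Du) (domD HA HB Dz' Du)).
  by rewrite addrBD subrr addr0.
rewrite /G /F2s (M12_split Mz) (M12_split Mz') !(bopB bounded_Q2s).
by rewrite addrBD -opprD.
Qed.

(** Simplified Newton method with the derivative frozen at the base point. As [Winv] inverts [W] on
    [D20], the difference of two images is [- Winv] of the defect [G u - G v - W (u - v)], whose
    norm is at most [q] times that of [u - v]; the limit condition on [q] makes the product with the
    norm of [Winv] less than 1. *)
Lemma newton_contraction t' z' u' : 0 <= t' -> M12 z' -> M20 u' -> L0 t' (z' + u') ->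
  exists (Winv : Y -> X) (r th c : R), [/\ 0 < r, 0 <= th, th < 1, 0 < c & [/\
    (forall y, Q2s y = y -> P20 (Winv y) = Winv y),
    (forall y, Q2s y = y -> Winv y = 0 -> y = 0),
    (forall y, Q2s y = y -> rnorm (Winv y) <= c * rnorm y) &
    forall t z u v, 0 <= t -> `|t - t'| < r -> M12 z -> rnorm (z - z') < r ->
      P20 u = u -> rnorm (u - u') < r -> P20 v = v -> rnorm (v - u') < r ->
      rnorm ((u - Winv (G t z u)) - (v - Winv (G t z v))) <= th * rnorm (u - v)]].
Proof.
move=> t0 Mz' Mu' L0'.
have Dz' := M12_dom Mz'.
have D1z z : M12 z -> D1 T rs (P1 z) by move=> Mz; exists z => //; exact: M12_dom.
have D2z z : M12 z -> D2S T rs (P2S z) by move=> Mz; exists z => //; exact: M12_dom.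
have [||W [Winv [qf [d0 [e0 [l [LW LWi Winvs [d00 e00 Hq] [ql lop]]]]]]]] :=
  @Happrox t' (P1 z') (P2S z') u' (D1z _ Mz') (D2z _ Mz') _ Mu' _.
- by rewrite M12_split.
- by rewrite M12_split.
case: LW => lW WY _; case: LWi => lWi WiX [c0 hc0].
case: Winvs => _ _ WiW WWi.
pose op := op_norm (Y2s T rs) Winv.
have Y0 : Y2s T rs 0 by apply/Y2s_E; rewrite (bop0 bounded_Q2s).
have YD x y : Y2s T rs x -> Y2s T rs y -> Y2s T rs (x + y).
  by move=> /Y2s_E hx /Y2s_E hy; apply/Y2s_E; rewrite (bopD bounded_Q2s) hx hy.
have YZ a x : Y2s T rs x -> Y2s T rs (a *: x).
  by move=> /Y2s_E hx; apply/Y2s_E; rewrite (bopZ bounded_Q2s) hx.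
have YN x : Y2s T rs x -> Y2s T rs (- x).
  by move=> hx; rewrite -scaleN1r; exact: YZ.
have Wi0 : Winv 0 = 0.
  by have := lWi 1 0 0 Y0 Y0; rewrite !scale1r addr0 => h; apply: (addrI (Winv 0)); rewrite addr0.
have D0 : D20 T rs 0 by apply/D20E; rewrite (bop0 bounded_P20).
have W0 : W 0 = 0.
  by have := lW 1 0 0 D0 D0; rewrite !scale1r addr0 => h; apply: (addrI (W 0)); rewrite addr0.
have WiZ a x : Y2s T rs x -> Winv (a *: x) = a *: Winv x.
  by move=> hx; have := lWi a x 0 hx Y0; rewrite Wi0 !addr0.
have WiB x y : Y2s T rs x -> Y2s T rs y -> Winv (x - y) = Winv x - Winv y.
  move=> hx hy; have := lWi (-1) y x hy hx.
  by rewrite !scaleN1r addrC => ->; rewrite addrC.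
pose c := `|c0| + 1.
have cgt0 : 0 < c by rewrite ltr_wpDl.
have hc y : Y2s T rs y -> rnorm (Winv y) <= c * rnorm y.
  move=> hy; rewrite (le_trans (hc0 y hy))// ler_wpM2r ?rnorm_ge0//.
  by rewrite (le_trans (ler_norm c0))// lerDl.
have opS : has_sup [set rnorm (Winv z) | z in [set z | Y2s T rs z /\ rnorm z <= 1]].
  split; first by exists (rnorm (Winv 0)), 0 => //; split=> //; rewrite rnorm0.
  exists c => _ [y [hy y1] <-]; rewrite (le_trans (hc y hy))//.
  by rewrite -[leRHS]mulr1 ler_pM2l.
have op0 : 0 <= op.
  rewrite -(rnorm0 X) -Wi0; apply: sup_ubound; first by case: opS.
  by exists 0 => //; split=> //; rewrite rnorm0.
have hop y : Y2s T rs y -> rnorm (Winv y) <= op * rnorm y.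
  move=> hy; have [y0|y0] := eqVneq (rnorm y) 0.
    by rewrite (rnorm0_eq0 y0) Wi0 !rnorm0 mulr0.
  have ny : 0 < rnorm y by rewrite lt_neqAle eq_sym y0 rnorm_ge0.
  rewrite -ler_pdivrMr// mulrC -[X in X * _](gtr0_norm (x := (rnorm y)^-1)) ?invr_gt0//.
  rewrite -(snorm_of_real (k := k)) -rnormZ -WiZ//; apply: sup_ubound; first by case: opS.
  exists (of_real k (rnorm y)^-1 *: y) => //; split; first exact: YZ.
  by rewrite rnormZ snorm_of_real gtr0_norm ?invr_gt0// mulVf.
have [r [r0 rd re qr]] : exists r : R, [/\ 0 < r, r <= d0, r <= e0 & qf (r, r, r) r < op^-1].
  have dl : 0 < op^-1 - l by rewrite subr_gt0.
  move/cvgrPdist_lt : ql => /(_ _ dl); rewrite near_withinE.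
  move=> /nbhs_ballP[d /= d'0 H].
  pose r := Num.min (d / 2) (Num.min d0 e0).
  have r0 : 0 < r by rewrite !lt_min divr_gt0// d00.
  have [rd rd0 re0] : [/\ r <= d / 2, r <= d0 & r <= e0].
    by rewrite /r !ge_min !lexx !orbT.
  exists r; split=> //.
  have := H (r, r, r, r) _ _ => /(_ _ _) h.
  have {h} : `|l - qf (r, r, r) r| < op^-1 - l.
    apply: h; last by split.
    have b0 : ball (0 : R) d r by rewrite -ball_normE /= sub0r normrN gtr0_norm//; lra.
    by split; [split; [split|]|].
  by rewrite distrC => /(le_lt_trans (ler_norm _)); lra.
(* The values of [qf] may be negative, hence the maximum with [0]. If [op = 0], then [op^-1 = 0]
   says nothing useful, but [th = 0]. *)
pose th := Num.max 0 (op * qf (r, r, r) r).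
have [c1 c10 h1] := bop_bound bounded_P1.
have [c2 c20 h2] := bop_bound bounded_P2S.
(* Closeness of [z] to [z'] has to yield closeness of both projections, whose operators are bounded
   by [c1] and [c2]. *)
pose r' := Num.min r (Num.min (r / c1) (r / c2)).
have r'0 : 0 < r' by rewrite !lt_min r0 !divr_gt0.
have [r'r r'1 r'2] : [/\ r' <= r, r' <= r / c1 & r' <= r / c2].
  by rewrite /r' !ge_min !lexx !orbT.
exists Winv, r', th, c; split=> //.
- by rewrite /th le_max lexx.
- rewrite /th gt_max ltr01/=; move: op0; rewrite le_eqVlt => /predU1P[<-|opgt].
    by rewrite mul0r.
  by rewrite mulrC -ltr_pdivlMr// div1r.
split.
- by move=> y /Y2s_E hy; apply/D20E/WiX.
- by move=> y /Y2s_E hy Wy; rewrite -(WWi y hy) Wy W0.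
- by move=> y /Y2s_E; exact: hc.
move=> t z u v tt0 tr Mz zr Pu ur Pv vr.
have D20u : D20 T rs u by apply/D20E.
have D20v : D20 T rs v by apply/D20E.
have D20uv : D20 T rs (u - v).
  by apply/D20E; rewrite (bopB bounded_P20) Pu Pv.
have Yu : Y2s T rs (G t z u) by apply/Y2s_E; exact: G_Y2s.
have Yv : Y2s T rs (G t z v) by apply/Y2s_E; exact: G_Y2s.
have YW := WY _ D20uv.
have -> : u - Winv (G t z u) - (v - Winv (G t z v)) =
    - Winv (G t z u - G t z v - W (u - v)).
  have Yuv : Y2s T rs (G t z u - G t z v) by apply: (YD) => //; exact: (YN).
  rewrite (WiB _ _ Yuv YW) (WiB _ _ Yu Yv) WiW// [RHS]opprB [LHS]addrBD.
  by rewrite -opprD.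
rewrite rnormN; have Yall : Y2s T rs (G t z u - G t z v - W (u - v)).
  by apply: (YD); [apply: (YD) => //; exact: (YN) | exact: (YN)].
apply: le_trans (hop _ Yall) _.
have bnd : rnorm (G t z u - G t z v - W (u - v)) <= qf (r, r, r) r * rnorm (u - v).
  apply: Hq => //; rewrite ?r0 ?rd ?re//.
  - exact: lt_le_trans r'r.
  - exact: D1z.
  - rewrite -(bopB bounded_P1) (le_lt_trans (h1 _))// mulrC -ltr_pdivlMr//.
    exact: lt_le_trans r'1.
  - exact: D2z.
  - rewrite -(bopB bounded_P2S) (le_lt_trans (h2 _))// mulrC -ltr_pdivlMr//.
    exact: lt_le_trans r'2.
  - exact: lt_le_trans r'r.
  - exact: lt_le_trans r'r.
rewrite (le_trans (ler_wpM2l op0 bnd))// mulrA ler_wpM2r ?rnorm_ge0//.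
by rewrite /th le_max lexx orbT.
Qed.

(** [u] is an arbitrary solution over [z] in [M20], not assumed near [u']; nearness is the
    conclusion, inherited from the fixed point produced inside the ball of radius [e1]. *)
Lemma implicit_cont t' z' u' : 0 <= t' -> M12 z' -> M20 u' -> L0 t' (z' + u') ->
  forall e : R, 0 < e -> exists2 d : R, 0 < d & forall t z u, 0 <= t ->
    `|t - t'| < d -> M12 z -> rnorm (z - z') < d -> M20 u -> L0 t (z + u) ->
    rnorm (u - u') <= e.
Proof.
move=> t'0 Mz' Mu' L0' e e0.
have Pu' := M20_P20 Mu'.
have [Winv [r [th [c [r0 th0 th1 c0 [WiP Wi0 Wic contr]]]]]] :=
  newton_contraction t'0 Mz' Mu' L0'.
have [ds ds0 stab] := nbhs_pair_rnorm (Hstab Mz' Mu' L0').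
have [cQ cQ0 hQ] := bop_bound bounded_Q2s.
have [cB cB0 hB] := bop_bound bounded_BP2S.
(* Limited by the requested accuracy, by the domain of the contraction, and by the stability
   neighbourhood, of which [z] and [u] each get a share. *)
pose e1 := Num.min e (Num.min (r / 2) (ds / 4)).
have e10 : 0 < e1 by rewrite !lt_min e0 !divr_gt0.
have [e1e e1r e1d] : [/\ e1 <= e, e1 <= r / 2 & e1 <= ds / 4].
  by rewrite /e1 !ge_min !lexx !orbT.
(* Tolerance for the two variations in [G_diff], tuned so that the map moves the centre [u'] by at
   most [(1 - th) * e1]. Together with the contraction bound [th * e1] this maps the ball of radius
   [e1] into itself. *)
pose k1 := (1 - th) * e1 / (2 * c * cQ).
have k10 : 0 < k1 by rewrite divr_gt0 ?mulr_gt0// subr_gt0.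
have Dz' := M12_dom Mz'; have Du' := dom_D20 Pu'.
have [d1 d10 hf] := rhs_cont t'0 (domD HA HB Dz' Du') k10.
pose d := Num.min (Num.min r (ds / 4)) (Num.min d1 (k1 / cB)).
have d0 : 0 < d by rewrite !lt_min r0 d10 (divr_gt0 k10 cB0) divr_gt0.
have [dr dds dd1 dk] : [/\ d <= r, d <= ds / 4, d <= d1 & d <= k1 / cB].
  by rewrite /d !ge_min !lexx !orbT.
exists d => // t z u tt0 td Mz zd Mu L0u.
have Dz := M12_dom Mz.
have rlt x y : x <= r / 2 -> y <= x -> y < r by lra.
pose F (v : realify X) : realify X := (v : X) - Winv (G t z v).
pose U : set (realify X) := [set v | P20 v = v /\ rnorm (v - u') <= e1].
have Uu' : U u' by split=> //; rewrite subrr rnorm0 ltW.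
have contrU x y : U x -> U y -> `|F x - F y| <= th * `|x - y|.
  move=> [Px xe] [Py ye]; apply: contr => //; try exact: lt_le_trans dr; lra.
have small : rnorm (Winv (G t z u')) <= (1 - th) * e1.
  apply: le_trans (Wic _ (G_Y2s _ _ _)) _.
  have G0 : G t' z' u' = 0 by apply/G_solution.
  rewrite -[G t z u']subr0 -G0 (G_diff _ _ Mz Mz' Pu').
  have b1 : rnorm (f t (z + u') - f t' (z' + u')) <= k1.
    apply: hf => //; [exact: (domD HA HB) | lra |].
    by rewrite addrBD subrr addr0; lra.
  have b2 : rnorm (B (P2S (z - z'))) <= k1.
    rewrite (le_trans (hB _))// mulrC -ler_pdivlMr//; lra.
  have b3 := ler_rnormB (Q2s (f t (z + u') - f t' (z' + u'))) (Q2s (B (P2S (z - z')))).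
  have b4 : rnorm (Q2s (f t (z + u') - f t' (z' + u'))) <= cQ * k1.
    by rewrite (le_trans (hQ _))// ler_pM2l.
  have b5 : rnorm (Q2s (B (P2S (z - z')))) <= cQ * k1.
    by rewrite (le_trans (hQ _))// ler_pM2l.
  have -> : (1 - th) * e1 = c * (cQ * k1 + cQ * k1).
    by rewrite /k1; field; rewrite !gt_eqF.
  by rewrite ler_pM2l//; lra.
have [|||v [Pv ve] vE] := @contraction_fixed_point _ (realify X) U F th _ _ _ th0 th1 contrU.
- have -> : U = ((fun v : realify X => (P20 v : realify X) - v) @^-1` [set 0]) `&`
      ((fun v : realify X => `|v - (u' : realify X)|) @^-1` [set x | x <= e1]).
    apply/seteqP; split=> v /= [Pv ve]; split=> //.
      by apply/eqP; rewrite subr_eq0; apply/eqP.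
    by apply/eqP; rewrite -subr_eq0; apply/eqP.
  apply: closedI; apply: closed_comp.
  + move=> v _; apply: cvgB; last exact: cvg_id.
    exact: (bounded_op_continuous bounded_P20).
  + exact: (accessible_closed_set1 (hausdorff_accessible (@norm_hausdorff _ _))).
  + by move=> v _; apply: cvg_norm; apply: cvgB; [exact: cvg_id | exact: cvg_cst].
  + exact: closed_le.
- by exists u'.
- move=> x [Px xe]; split.
    by rewrite /F (bopB bounded_P20) Px WiP//; exact: G_Y2s.
  rewrite -(subrKA (F u')) (le_trans (ler_rnormD _ _))//.
  have h1 : rnorm ((F x : X) - F u') <= th * e1.
    have := contrU _ _ (conj Px xe) Uu'.
    move=> /le_trans; apply; rewrite ler_wpM2l//.
  have h2 : rnorm ((F u' : X) - u') <= (1 - th) * e1.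
    by rewrite /F addrAC subrr add0r rnormN.
  lra.
have Gv : G t z v = 0.
  apply: (Wi0 _ (G_Y2s _ _ _)); apply: oppr_inj; rewrite oppr0.
  by apply: (addrI (v : X)); rewrite addr0; exact: vE.
have L0v : L0 t (z + v) by apply/G_solution.
have PE : P20 (z + v) = v by rewrite (bopD bounded_P20) (M12_P20 Mz) add0r.
have Mv : M20 v.
  have := stab t (z + v) _ _ L0v; rewrite P_split PE addrK; apply => //; first lra.
  by rewrite addrBD (le_lt_trans (ler_rnormD _ _))//; lra.
have [w [_ wU]] := Huniq tt0 Mz.
by rewrite -(wU u (conj Mu L0u)) (wU v (conj Mv L0v)); lra.
Qed.

(** Over [z], the solution [u] is a fixed point of the contraction, while [w] is displaced by
    [Winv (G t z w)]. Since [G t v w = 0], that displacement is of order [z - v], and dividing by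
    [1 - th] transfers the bound to [u - w]. *)
Lemma implicit_lip t' z' u' : 0 <= t' -> M12 z' -> M20 u' -> L0 t' (z' + u') ->
  exists d L : R, [/\ 0 < d, 0 <= L & forall t z v u w, 0 <= t -> `|t - t'| < d ->
    M12 z -> rnorm (z - z') < d -> M12 v -> rnorm (v - z') < d ->
    M20 u -> L0 t (z + u) -> M20 w -> L0 t (v + w) ->
    rnorm (u - w) <= L * rnorm (z - v)].
Proof.
move=> t'0 Mz' Mu' L0'.
have [Winv [r [th [c [r0 th0 th1 c0 [WiP Wi0 Wic contr]]]]]] :=
  newton_contraction t'0 Mz' Mu' L0'.
have [cQ cQ0 hQ] := bop_bound bounded_Q2s.
have [cB cB0 hB] := bop_bound bounded_BP2S.
have Dz' := M12_dom Mz'; have Du' := dom_D20 (M20_P20 Mu').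
have [dl [Lf [dl0 Lf0 hf]]] := rhs_lip t'0 (domD HA HB Dz' Du').
pose e := Num.min (r / 2) (dl / 2).
have e0 : 0 < e by rewrite lt_min !divr_gt0.
have [er ed] : e <= r / 2 /\ e <= dl / 2 by rewrite /e !ge_min !lexx orbT.
have [d1 d10 hc] := implicit_cont t'0 Mz' Mu' L0' e0.
pose d := Num.min r (Num.min d1 (dl / 2)).
have d0 : 0 < d by rewrite !lt_min r0 d10 divr_gt0.
have [dr dd1 ddl] : [/\ d <= r, d <= d1 & d <= dl / 2].
  by rewrite /d !ge_min !lexx !orbT.
have th10 : 0 < 1 - th by rewrite subr_gt0.
exists d, (c * (cQ * (Lf + cB)) / (1 - th)); split=> //.
  rewrite divr_ge0 ?(ltW th10)// mulr_ge0 ?(ltW c0)// mulr_ge0 ?(ltW cQ0)//.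
  by rewrite addr_ge0// ltW.
move=> t z v u w t0 td Mz zd Mv vd Mu L0u Mw L0w.
have Pu := M20_P20 Mu; have Pw := M20_P20 Mw.
have ue : rnorm (u - u') <= e by apply: (hc t z u) => //; lra.
have we : rnorm (w - u') <= e by apply: (hc t v w) => //; lra.
have Gu : G t z u = 0 by apply/G_solution.
have Gw : G t v w = 0 by apply/G_solution.
have Gz : rnorm (G t z w) <= cQ * (Lf + cB) * rnorm (z - v).
  rewrite -[G t z w]subr0 -Gw (G_diff _ _ Mz Mv Pw) -(bopB bounded_Q2s).
  rewrite (le_trans (hQ _))// -mulrA ler_pM2l// mulrDl (le_trans (ler_rnormB _ _))//.
  apply: lerD; last exact: hB.
  have -> : z - v = (z + w) - (v + w) by rewrite addrBD subrr addr0.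
  have Dw := dom_D20 Pw.
  apply: hf => //.
  - lra.
  - by apply: (domD HA HB) => //; exact: M12_dom.
  - by rewrite addrBD (le_lt_trans (ler_rnormD _ _))//; lra.
  - by apply: (domD HA HB) => //; exact: M12_dom.
  - by rewrite addrBD (le_lt_trans (ler_rnormD _ _))//; lra.
have h : rnorm (u - Winv (G t z u) - (w - Winv (G t z w))) <= th * rnorm (u - w).
  by apply: contr => //; lra.
have W0 : Winv 0 = 0.
  apply: rnorm0_eq0; apply/eqP; rewrite eq_le rnorm_ge0 andbT.
  by have := Wic 0; rewrite (bop0 bounded_Q2s) rnorm0 mulr0; apply.
rewrite Gu W0 subr0 in h.
have h2 := ler_rnormB (u - (w - Winv (G t z w))) (Winv (G t z w)).
have uw : u - (w - Winv (G t z w)) - Winv (G t z w) = u - w.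
  by rewrite opprB addrA addrAC addrK.
rewrite uw in h2.
have h3 := Wic _ (G_Y2s t z w).
have h4 : c * rnorm (G t z w) <= c * (cQ * (Lf + cB) * rnorm (z - v)).
  by rewrite ler_pM2l.
by rewrite mulrAC ler_pdivlMr//; lra.
Qed.

Definition implicit t z : X := xget 0 [set u | M20 u /\ L0 t (z + u)].

Lemma implicitP t z : 0 <= t -> M12 z ->
  M20 (implicit t z) /\ L0 t (z + implicit t z).
Proof.
move=> t0 Mz; rewrite /implicit; case: xgetP => [u _ //|H].
by have [u [hu _]] := Huniq t0 Mz; case: (H u).
Qed.

Lemma implicit_unique t z u : 0 <= t -> M12 z -> M20 u -> L0 t (z + u) ->
  u = implicit t z.
Proof.
move=> t0 Mz Mu Lu; have [v [_ vU]] := Huniq t0 Mz.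
by rewrite -(vU _ (implicitP t0 Mz)) (vU u).
Qed.

(** * The reduced equation *)

Section ReducedEquation.
Variable S : Y -> X.
Hypothesis bS : bounded_op S.
Hypothesis bBS : bounded_op (B \o S).
Hypothesis tS : forall y, D (S y) /\ tA (S y) = y.
Hypothesis St : forall x, D x -> S (tA x) = x.

(** For [t >= 0], the inverse of [x |-> A x] on the points of [L0] over [M12] and [M20] at time
    [t]. *)
Definition reconstruct t w : X := S w + implicit t (S w).
Definition field t w : Y := f t (reconstruct t w) - B (reconstruct t w).

Lemma M12_S w : Mt w -> M12 (S w).
Proof. by move=> Mw; have [DS tE] := tS w; split=> //; rewrite tE. Qed.

Lemma reconstruct_dom t w : 0 <= t -> Mt w -> D (reconstruct t w).
Proof.
move=> t0 Mw; have [Mu _] := implicitP t0 (M12_S Mw).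
by apply: (domD HA HB); [case: (tS w) | exact/dom_D20/M20_P20].
Qed.

(** [P20] fixes the implicit value and is inserted on purpose: [B] then occurs only through the
    bounded operators [B \o S] and [B \o P20]. *)
Lemma B_reconstruct t w : 0 <= t -> Mt w ->
  B (reconstruct t w) = B (S w) + B (P20 (implicit t (S w))).
Proof.
move=> t0 Mw; have [Mu _] := implicitP t0 (M12_S Mw).
rewrite (M20_P20 Mu) (linD (opB_linear HB))//; first by case: (tS w).
exact/dom_D20/M20_P20.
Qed.

Lemma Q2s_field t w : 0 <= t -> Mt w -> Q2s (field t w) = 0.
Proof. by move=> t0 Mw; have [_ [_ _ ->]] := implicitP t0 (M12_S Mw). Qed.

Lemma implicit_S_cont t w : 0 <= t -> Mt w -> forall e : R, 0 < e ->
  exists2 d : R, 0 < d & forall s v, 0 <= s -> `|s - t| < d -> Mt v ->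
    rnorm (v - w) < d -> rnorm (implicit s (S v) - implicit t (S w)) <= e.
Proof.
move=> t0 Mw e e0; have [Mu Lu] := implicitP t0 (M12_S Mw).
have [d d0 H] := implicit_cont t0 (M12_S Mw) Mu Lu e0.
have [c c0 hS] := bop_bound bS.
exists (Num.min d (d / c)); first by rewrite lt_min d0 divr_gt0.
move=> s v s0; rewrite !lt_min => /andP[sd _] Mv /andP[_ vd].
have [Mv' Lv'] := implicitP s0 (M12_S Mv).
apply: (H s (S v)) => //; first exact: M12_S.
rewrite -(bopB bS) (le_lt_trans (hS _))//.
by rewrite mulrC -ltr_pdivlMr.
Qed.

Lemma reconstruct_cont t w : 0 <= t -> Mt w -> forall e : R, 0 < e ->
  exists2 d : R, 0 < d & forall s v, 0 <= s -> `|s - t| < d -> Mt v ->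
    rnorm (v - w) < d -> rnorm (reconstruct s v - reconstruct t w) <= e.
Proof.
move=> t0 Mw e e0; have e20 : 0 < e / 2 by rewrite divr_gt0.
have [d d0 H] := implicit_S_cont t0 Mw e20.
have [c c0 hS] := bop_bound bS.
exists (Num.min d (e / 2 / c)); first by rewrite lt_min d0 divr_gt0.
move=> s v s0; rewrite !lt_min => /andP[sd _] Mv /andP[vd ve].
rewrite /reconstruct addrBD (le_trans (ler_rnormD _ _))//.
have := H s v s0 sd Mv vd; rewrite -(bopB bS); have := hS (v - w).
by move: ve; rewrite ltr_pdivlMr//; lra.
Qed.

Lemma field_cont t w : 0 <= t -> Mt w -> forall e : R, 0 < e ->
  exists2 d : R, 0 < d & forall s v, 0 <= s -> `|s - t| < d -> Mt v ->
    rnorm (v - w) < d -> rnorm (field s v - field t w) <= e.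
Proof.
move=> t0 Mw e e0; have e30 : 0 < e / 3 by rewrite divr_gt0.
have [d1 d10 h1] := rhs_cont t0 (reconstruct_dom t0 Mw) e30.
have [d2 d20 h2] := reconstruct_cont t0 Mw (e := d1 / 2) ltac:(by rewrite divr_gt0).
have [c c0 hBS] := bop_bound bBS.
have [c' c'0 hBP] := bop_bound bounded_BP20.
have [d3 d30 h3] := implicit_S_cont t0 Mw (e := e / 3 / c') ltac:(by rewrite divr_gt0).
exists (Num.min (Num.min d1 d2) (Num.min d3 (e / 3 / c))).
  by rewrite !lt_min d10 d20 d30 divr_gt0.
move=> s v s0; rewrite !lt_min => /andP[/andP[s1 s2] /andP[s3 _]] Mv.
move=> /andP[/andP[v1 v2] /andP[v3 v4]].
have b1 : rnorm (f s (reconstruct s v) - f t (reconstruct t w)) <= e / 3.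
  apply: h1 => //; first exact: reconstruct_dom.
  by have := h2 s v s0 s2 Mv v2; lra.
have b2 : rnorm (B (S v) - B (S w)) <= e / 3.
  have := bopB bBS v w; rewrite /= => <-; rewrite (le_trans (hBS _))//.
  by rewrite mulrC -ler_pdivlMr// ltW.
have b3 : rnorm (B (P20 (implicit s (S v))) - B (P20 (implicit t (S w)))) <= e / 3.
  have := bopB bounded_BP20 (implicit s (S v)) (implicit t (S w)).
  rewrite /= => <-; rewrite (le_trans (hBP _))//.
  by rewrite mulrC -ler_pdivlMr//; exact: h3.
rewrite /field !B_reconstruct// addrBD -opprD (le_trans (ler_rnormB _ _))//.
by rewrite addrBD; have := ler_rnormD (B (S v) - B (S w))
  (B (P20 (implicit s (S v))) - B (P20 (implicit t (S w)))); lra.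
Qed.

Lemma field_lip t w : 0 <= t -> Mt w -> exists d L : R, [/\ 0 < d, 0 <= L &
  forall s v v', 0 <= s -> `|s - t| < d -> Mt v -> rnorm (v - w) < d ->
    Mt v' -> rnorm (v' - w) < d ->
    rnorm (field s v - field s v') <= L * rnorm (v - v')].
Proof.
move=> t0 Mw; have [Mu Lu] := implicitP t0 (M12_S Mw).
have [d1 [L1 [d10 L10 h1]]] := rhs_lip t0 (reconstruct_dom t0 Mw).
have [d2 d20 h2] := reconstruct_cont t0 Mw (e := d1 / 2) ltac:(by rewrite divr_gt0).
have [c c0 hBS] := bop_bound bBS.
have [c' c'0 hBP] := bop_bound bounded_BP20.
have [c'' c''0 hS] := bop_bound bS.
have [d3 [L3 [d30 L30 h3]]] := implicit_lip t0 (M12_S Mw) Mu Lu.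
exists (Num.min (Num.min d1 d2) (Num.min d3 (d3 / c''))).
exists (L1 * (c'' + L3 * c'') + (c + c' * (L3 * c''))); split.
- by rewrite !lt_min d10 d20 d30 divr_gt0.
- have [? ? ?] := And3 (ltW c0) (ltW c'0) (ltW c''0).
  by rewrite ?(addr_ge0, mulr_ge0).
move=> s v v' s0; rewrite !lt_min => /andP[/andP[s1 s2] /andP[s3 _]] Mv.
move=> /andP[/andP[v1 v2] /andP[v3 v4]] Mv' /andP[/andP[v'1 v'2] /andP[v'3 v'4]].
have bi : rnorm (implicit s (S v) - implicit s (S v')) <= L3 * c'' * rnorm (v - v').
  have [M1 L1'] := implicitP s0 (M12_S Mv); have [M2 L2'] := implicitP s0 (M12_S Mv').
  apply: le_trans (h3 s (S v) (S v') _ _ s0 s3 (M12_S Mv) _ (M12_S Mv') _ M1 L1' M2 L2') _.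
  - by rewrite -(bopB bS) (le_lt_trans (hS _))// mulrC -ltr_pdivlMr.
  - by rewrite -(bopB bS) (le_lt_trans (hS _))// mulrC -ltr_pdivlMr.
  - by rewrite -mulrA ler_wpM2l// -(bopB bS).
have br : rnorm (reconstruct s v - reconstruct s v') <= (c'' + L3 * c'') * rnorm (v - v').
  rewrite /reconstruct addrBD (le_trans (ler_rnormD _ _))// mulrDl lerD//.
  by rewrite -(bopB bS).
have b1 : rnorm (f s (reconstruct s v) - f s (reconstruct s v')) <=
    L1 * (c'' + L3 * c'') * rnorm (v - v').
  apply: le_trans (h1 s _ _ s0 s1 (reconstruct_dom s0 Mv) _ (reconstruct_dom s0 Mv') _) _.
  - by have := h2 s v s0 s2 Mv v2; lra.
  - by have := h2 s v' s0 s2 Mv' v'2; lra.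
  - by rewrite -mulrA ler_wpM2l.
have b2 : rnorm (B (S v) - B (S v')) <= c * rnorm (v - v').
  by have := bopB bBS v v'; rewrite /= => <-; exact: hBS.
have b3 : rnorm (B (P20 (implicit s (S v))) - B (P20 (implicit s (S v')))) <=
    c' * (L3 * c'') * rnorm (v - v').
  have := bopB bounded_BP20 (implicit s (S v)) (implicit s (S v')).
  rewrite /= => <-; rewrite (le_trans (hBP _))// -mulrA ler_pM2l//.
rewrite /field !B_reconstruct// addrBD -opprD (le_trans (ler_rnormB _ _))//.
by rewrite addrBD; have := ler_rnormD (B (S v) - B (S v'))
  (B (P20 (implicit s (S v))) - B (P20 (implicit s (S v')))); lra.
Qed.

(** [Mt] is open only relative to the kernel of [Q2s], so a nearby point of [Y] is first projected
    there; [1 + c] bounds the projection. *)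
Lemma Mt_open w : Mt w -> exists2 d : R, 0 < d &
  forall y, rnorm (y - w) < d -> Mt (y - Q2s y).
Proof.
move=> Mw; have Qw := Mt_Q2s Mw; case: HMt => O oO ME.
have Ow : O w by move: Mw; rewrite ME => -[].
have [d d0 dO] := nbhs_rnorm (open_nbhs_nbhs (conj oO Ow)).
have [c c0 hQ] := bop_bound bounded_Q2s.
have c10 : 0 < 1 + c by rewrite addr_gt0.
exists (d / (1 + c)); first by rewrite divr_gt0.
move=> y; rewrite ltr_pdivlMr// => yw; rewrite ME; split.
  apply: dO; have -> : y - Q2s y - w = (y - w) - Q2s (y - w).
    by rewrite (bopB bounded_Q2s) Qw subr0 addrAC.
  by rewrite (le_lt_trans (ler_rnormB _ _))//; have := hQ (y - w); lra.
by apply/Y1_Y2S_E; rewrite (bopB bounded_Q2s) Q2sK subrr.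
Qed.

Lemma field_solution_exists t0 w0 : 0 <= t0 -> Mt w0 ->
  exists (a : R) (w : R -> realify Y), [/\ 0 < a, w t0 = w0 &
    forall t, t0 <= t <= t0 + a ->
      Mt (w t) /\ deriv_in `[t0, t0 + a] w t (field t (w t))].
Proof.
move=> t00 Mw0; have Qw0 := Mt_Q2s Mw0.
pose Pi (y : Y) : Y := y - Q2s y.
have bPi : bounded_op Pi by apply: bounded_opB; [exact: bounded_op_id | exact: bounded_Q2s].
have [c c0 hPi] := bop_bound bPi.
have Piw0 : Pi w0 = w0 by rewrite /Pi Qw0 subr0.
have [d1 d10 h1] := Mt_open Mw0.
have [d2 [L [d20 L0 h2]]] := field_lip t00 Mw0.
pose r := Num.min (d1 / 2) (Num.min (d2 / 2) (d2 / 2 / c)).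
have r0 : 0 < r by rewrite !lt_min !divr_gt0.
have [rd1 rd2 rd2c] : [/\ r <= d1 / 2, r <= d2 / 2 & r <= d2 / 2 / c].
  by rewrite /r !ge_min !lexx !orbT.
have MPi y : rnorm (y - w0) <= r -> Mt (Pi y) by move=> yr; apply: h1; lra.
have nearPi y : rnorm (y - w0) <= r -> rnorm (Pi y - w0) < d2.
  move=> yr; rewrite -{1}Piw0 -(bopB bPi) (le_lt_trans (hPi _))//.
  have : rnorm (y - w0) <= d2 / 2 / c by lra.
  by rewrite ler_pdivlMr//; lra.
have time t : t0 <= t <= t0 + r -> 0 <= t /\ `|t - t0| < d2.
  by move=> /andP[h h']; rewrite ger0_norm ?subr_ge0//; split; lra.
(* Picard iteration runs in the whole of [Y], with [field] extended by the projection [Pi]. The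
   solution is [Pi \o u]: [field] takes values in the kernel of [Q2s], so [Pi] does not change the
   derivative. *)
have [|||a [u [a0 ar u0 Hu]]] := @picard R (realify Y)
    (fun t y => field t (Pi y)) t0 w0 r (L * c) r0.
- by rewrite mulr_ge0// ltW.
- move=> t y y' /time[t0' td] yr y'r.
  apply: le_trans (h2 t (Pi y) (Pi y') t0' td _ _ _ _) _.
  + exact: MPi.
  + exact: nearPi.
  + exact: MPi.
  + exact: nearPi.
  + by rewrite -mulrA ler_wpM2l// -(bopB bPi); exact: hPi.
- move=> t y /time[t0' td] yr e e0.
  have [d d0 H] := field_cont t0' (MPi y yr) e0.
  exists d => // s; rewrite /= in_itv/= => /time[s0' sd] std.
  by apply: H => //; [exact: MPi | rewrite subrr rnorm0].
exists a, (fun t => Pi (u t)); split=> //; first by rewrite u0 Piw0.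
move=> t ta; have [ur du] := Hu t ta; split; first exact: MPi.
have [tt0 _] : 0 <= t /\ `|t - t0| < d2.
  by apply: time; case/andP: ta => -> /=; lra.
have -> : field t (Pi (u t)) = Pi (field t (Pi (u t))).
  by rewrite [RHS]/Pi Q2s_field ?subr0//; exact: MPi.
exact: deriv_in_bop du.
Qed.

(** * Solutions of the original equation and of the reduced one *)

Local Notation Sol := (dsum M12 M20).

Lemma solution_coordinates x : Sol x ->
  [/\ D x, Mt (A x), x = S (A x) + P20 x & M20 (P20 x)].
Proof.
move=> [z Mz [u Mu ->]].
have Pu := M20_P20 Mu; have Pz := M12_P20 Mz; have Dz := M12_dom Mz.
have Du := dom_D20 Pu.
have Au : A u = 0 by rewrite -Pu A_P20.
have AE : A (z + u) = tA z by rewrite (linD (opA_linear HA))// Au addr0 tildeA_P20_0.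
have PE : P20 (z + u) = u by rewrite (bopD bounded_P20) Pu Pz add0r.
split; rewrite ?AE ?PE//; first exact: (domD HA HB).
  by case: Mz.
by rewrite St.
Qed.

Lemma A_reconstruct t w : 0 <= t -> Mt w -> A (reconstruct t w) = w.
Proof.
move=> t0 Mw; have Mz := M12_S Mw; have [Mu _] := implicitP t0 Mz.
have [DS tE] := tS w.
rewrite (linD (opA_linear HA))//; last exact/dom_D20/M20_P20.
by rewrite -(M20_P20 Mu) A_P20 addr0 -tildeA_P20_0//; exact: M12_P20.
Qed.

Lemma reconstruct_Sol t w : 0 <= t -> Mt w -> Sol (reconstruct t w).
Proof.
move=> t0 Mw; have Mz := M12_S Mw; have [Mu _] := implicitP t0 Mz.
by exists (S w) => //; exists (implicit t (S w)).
Qed.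

(* The component of the equation in the range of Q2s is algebraic, because
   Q2s A = 0. *)
Lemma solution_field (J : set R) (y : R -> X) (t : R) (v : Y) :
  (forall s, J s -> D (y s)) -> J t -> 0 <= t -> Sol (y t) ->
  (forall d : R, 0 < d -> exists s, [/\ J s, s != t & `|s - t| < d]) ->
  deriv_in J (fun s => A (y s) : realify Y) t v ->
  v + B (y t) = f t (y t) ->
  y t = reconstruct t (A (y t)) /\ v = field t (A (y t)).
Proof.
move=> Dy Jt t0 Sy lim dA eq.
have [Dyt Mw yE Mu] := solution_coordinates Sy.
have dQ := deriv_in_bop bounded_Q2s dA.
have Qv : Q2s v = 0.
  apply: rnorm0_eq0; apply/eqP; rewrite eq_le rnorm_ge0 andbT.
  apply/ler_addgt0Pl => e e0; rewrite addr0.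
  (* Since [Q2s (A (y s))] is zero throughout, a single [s] different from [t] turns the derivative
     estimate into the bound [e] on the norm of [Q2s v]. *)
  have [d d0 Hd] := dQ e e0; have [s [Js st sd]] := lim d d0.
  have st0 : 0 < `|s - t| by rewrite normr_gt0 subr_eq0.
  have := Hd s Js sd; rewrite /= !Q2s_A//; last exact: Dy.
  by rewrite subrr sub0r normrN normrZ mulrC ler_pM2r.
have L0y : L0 t (y t).
  by split=> //; rewrite -eq addrK Qv.
have uE : P20 (y t) = implicit t (S (A (y t))).
  by apply: implicit_unique => //; [exact: M12_S | rewrite -yE].
have rE : y t = reconstruct t (A (y t)) by rewrite /reconstruct -uE -yE.
by split=> //; rewrite /field -rE -eq addrK.
Qed.

Lemma interval_limit_point (J : set R) (a b : R) : is_interval J -> J a -> J b ->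
  a < b -> forall d : R, 0 < d -> exists s, [/\ J s, s != b & `|s - b| < d].
Proof.
move=> iJ Ja Jb ab d d0; pose m := Num.min d (b - a).
have m0 : 0 < m by rewrite lt_min d0 subr_gt0.
have [md mba] : m <= d /\ m <= b - a by rewrite /m !ge_min !lexx orbT.
exists (b - m / 2); split.
- by apply: (iJ a b) => //; apply/andP; split; lra.
- by apply/eqP => h; lra.
- by rewrite addrAC subrr add0r normrN gtr0_norm ?divr_gt0//; lra.
Qed.

(** The derivative is claimed only after [t0], because for [J = Rplus] and [t0 = 0] a solution need
    not have one there. Continuity of [A y] at [t0] is claimed nevertheless, as uniqueness needs a
    common initial value. *)
Lemma solution_reduced (J : set R) (y : R -> X) (t0 t1 : R) :
  solution_in T f Sol y J -> J t0 -> J t1 -> t0 < t1 ->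
  (forall t, t0 <= t <= t1 ->
     Mt (A (y t)) /\ cont_in `[t0, t1] (fun s => A (y s) : realify Y) t) /\
  (forall t, t0 < t <= t1 -> y t = reconstruct t (A (y t)) /\
     deriv_in `[t0, t1] (fun s => A (y s) : realify Y) t (field t (A (y t)))).
Proof.
move=> [[iJ JR cy Dy [g' [/derivative_onP dg _ eqg]]] Sy] Jt0 Jt1 t01.
have t00 : 0 <= t0 := JR _ Jt0.
have mem t : t0 <= t <= t1 -> J t by apply: iJ.
have memd t : t0 < t <= t1 -> diff_domain J t.
  by move=> /andP[h h']; split; [apply: mem; rewrite h' ltW | move=> _; lra].
pose w t : realify Y := A (y t).
have dw t : t0 < t <= t1 -> deriv_in `[t0, t1] w t (g' t).
  move=> tt; have := dg t (memd t tt); case/andP: tt => tt0 tt1.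
  apply: (deriv_in_local (d := t - t0)) => //; first by rewrite subr_gt0.
  move=> s; rewrite /= in_itv/= ltr_norml => /andP[s0 s1] /andP[sd _]; split=> //.
  by apply: memd; rewrite s1 andbT; lra.
have cyt := (continuous_within_rnorm _ _).1 cy.
have cyt01 t : t0 <= t <= t1 -> cont_in `[t0, t1] (y : R -> realify X) t.
  move=> tt; apply: cont_inW (cyt t (mem t tt)).
  by move=> s /=; rewrite in_itv; exact: mem.
have red t : t0 < t <= t1 -> y t = reconstruct t (A (y t)) /\ g' t = field t (A (y t)).
  move=> tt; have /andP[tt0 tt1] := tt; have Jt := mem t; rewrite (ltW tt0) tt1 in Jt.
  apply: (solution_field (J := `[t0, t1])).
  - by move=> s; rewrite /= in_itv/= => h; exact/Dy/mem.
  - by rewrite /= in_itv/= ltW.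
  - by rewrite (le_trans t00)// ltW.
  - exact/Sy/Jt.
  - apply: (@interval_limit_point _ t0 t) => //.
    + exact: interval_is_interval.
    + by rewrite /= in_itv/= lexx ltW.
    + by rewrite /= in_itv/= ltW.
  - exact: dw.
  - exact/eqg/memd.
split=> [t tt|t tt]; last by have [h <-] := red t tt; split=> //; exact: dw.
have [Dyt Mw _ _] := solution_coordinates (Sy _ (mem t tt)); split=> //.
have [t_t0|tnt0] := eqVneq t t0; last first.
  by apply: deriv_in_cont (dw t _); case/andP: tt => h ->; rewrite andbT lt_neqAle eq_sym tnt0.
rewrite t_t0 {t tt t_t0 Dyt Mw}.
have Jt0' : t0 <= t0 <= t1 by rewrite lexx ltW.
have [D0 Mw0 y0E _] := solution_coordinates (Sy _ (mem t0 Jt0')).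
(* By w' = f t y - B (P20 y) - B (S w), w' grows at most linearly in w near t0;
   the limit of w at t0 is then identified by applying S. *)
have [c c0 hBP] := bop_bound bounded_BP20.
have [kap kap0 hBS] := bop_bound bBS.
have [cS cS0 hS] := bop_bound bS.
have [cP cP0 hP] := bop_bound bounded_P20.
have [d1 d10 h1] := rhs_cont t00 D0 ltr01.
have [d2 d20 h2] := cyt01 t0 Jt0' (Num.min 1 (d1 / 2)) ltac:(by rewrite lt_min ltr01 divr_gt0).
pose d := Num.min (t1 - t0) (Num.min (d1 / 2) (d2 / 2)).
have d0 : 0 < d by rewrite !lt_min subr_gt0 t01 !divr_gt0.
have [dt dd1 dd2] : [/\ d <= t1 - t0, d <= d1 / 2 & d <= d2 / 2].
  by rewrite /d !ge_min !lexx !orbT.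
pose tau := t0 + d.
(* Bounds the part of [w'] that does not involve [w]: near [t0] the value of [f] changes by at most
   [1], and so does [y] before [B \o P20], with bound [c], is applied. *)
pose H := (rnorm (f t0 (y t0)) + 1) + c * (rnorm (y t0) + 1).
have H0 : 0 <= H by rewrite !addr_ge0 ?mulr_ge0 ?addr_ge0 ?rnorm_ge0// ltW.
have [|||t tt|t tt|l [b' [C [tb' b'tau C0 Hl]]]] :=
    @linear_growth_limit R (realify Y) w g' t0 tau H kap.
- by rewrite ltrDl.
- exact: H0.
- exact: ltW.
- have tt1 : t0 < t <= t1.
    by case/andP: tt => -> /=; rewrite /tau; lra.
  apply: deriv_inW (dw t tt1) => s; rewrite /= !in_itv/= => /andP[/ltW -> /=].
  by rewrite /tau; lra.
- have tt1 : t0 < t <= t1.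
    by case/andP: tt => -> /=; rewrite /tau; lra.
  have tt1' : t0 <= t <= t1 by case/andP: tt1 => /ltW ->.
  have tJ : `[t0, t1]%classic t by rewrite /= in_itv.
  have td : `|t - t0| < d2 /\ `|t - t0| < d1.
    by case/andP: tt => h; rewrite /tau => h'; rewrite gtr0_norm ?subr_gt0//; split; lra.
  have yt := h2 t tJ td.1; rewrite le_min in yt; case/andP: yt => yt1 ytd.
  have Dyt : D (y t) by exact/Dy/mem.
  have [_ _ yE _] := solution_coordinates (Sy _ (mem t tt1')).
  have gE : g' t = f t (y t) - (B (S (w t)) + B (P20 (y t))).
    have <- := eqg t (memd t tt1); rewrite -(linD (opB_linear HB)).
    - by rewrite -yE addrK.
    - by case: (tS (w t)).
    - exact: dom_P20.
  rewrite gE opprD addrA -[`|_|]/(rnorm _) addrAC.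
  rewrite (le_trans (ler_rnormB _ _))// lerD//; last exact: hBS.
  rewrite (le_trans (ler_rnormB _ _))// /H lerD//.
    have := h1 t (y t) _ Dyt td.2 _ => /(_ _ _) h.
    have {}h : rnorm (f t (y t) - f t0 (y t0)) <= 1.
      apply: h; first by case/andP: tt1' => h _; exact: le_trans h.
      by rewrite (le_lt_trans ytd)//; lra.
    have := ler_rnormD (f t (y t) - f t0 (y t0)) (f t0 (y t0)); rewrite subrK; lra.
  rewrite (le_trans (hBP _))// ler_pM2l//.
  have yt1' : rnorm (y t - y t0) <= 1 := yt1.
  by have := ler_rnormD (y t - y t0) (y t0); rewrite subrK; lra.
have lE : l = w t0.
  suff SE : S l = S (w t0).
    by have [_ <-] := tS l; rewrite SE; have [_ ->] := tS (w t0).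
  apply/eqP; rewrite -subr_eq0; apply/eqP/rnorm0_eq0/eqP.
  rewrite eq_le rnorm_ge0 andbT; apply/ler_addgt0Pl => e e0; rewrite addr0.
  have e1 : 0 < e / 2 / (1 + cP) by rewrite !divr_gt0// addr_gt0.
  have [d3 d30 h3] := cyt01 t0 Jt0' _ e1.
  pose s := t0 + Num.min (Num.min (b' - t0) (d3 / 2)) (e / 2 / (cS * (C + 1))).
  have m0 : 0 < s - t0.
    rewrite /s addrAC subrr add0r !lt_min subr_gt0 tb' !divr_gt0//.
    by rewrite mulr_gt0// ltr_wpDl.
  have [sb sd se] : [/\ s - t0 <= b' - t0, s - t0 <= d3 / 2 & s - t0 <= e / 2 / (cS * (C + 1))].
    by rewrite /s [_ + _ - t0]addrAC subrr add0r !ge_min !lexx !orbT.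
  have ss : t0 <= s <= t1 by apply/andP; split; rewrite /tau in b'tau; lra.
  have [_ _ yE _] := solution_coordinates (Sy _ (mem s ss)).
  have b1 : rnorm (S l - S (w s)) <= e / 2.
    rewrite -(bopB bS) (le_trans (hS _))// rdistC.
    have : rnorm (w s - l) <= C * (s - t0) by apply: Hl; apply/andP; split; lra.
    move: se; rewrite ler_pdivlMr ?mulr_gt0 ?ltr_wpDl// => se h.
    have : cS * rnorm (w s - l) <= cS * (C * (s - t0)) by rewrite ler_pM2l.
    have : 0 <= cS * (s - t0) by rewrite mulr_ge0 ?ltW.
    lra.
  have b2 : rnorm (S (w s) - S (w t0)) <= e / 2.
    have -> : S (w s) - S (w t0) = (y s - y t0) - P20 (y s - y t0).
      have ysE : y s - P20 (y s) = S (w s) by rewrite {1}yE addrK.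
      have ytE : y t0 - P20 (y t0) = S (w t0) by rewrite {1}y0E addrK.
      by rewrite (bopB bounded_P20) addrBD -opprD ysE ytE.
    rewrite (le_trans (ler_rnormB _ _))//.
    have : rnorm (y s - y t0) <= e / 2 / (1 + cP).
      by apply: h3; rewrite /= ?in_itv//= gtr0_norm//; lra.
    by rewrite ler_pdivlMr ?addr_gt0//; have := hP (y s - y t0); lra.
  by rewrite (le_trans (ler_rdistD (S (w s)) _ _))//; lra.
move=> e e0; have C10 : 0 < C + 1 by rewrite ltr_wpDl.
exists (Num.min (b' - t0) (e / (C + 1))).
  by rewrite lt_min subr_gt0 tb' divr_gt0.
move=> s; rewrite /= in_itv/= => /andP[s0 s1]; rewrite lt_min => /andP[sb se].
have [->|sn] := eqVneq s t0; first by rewrite subrr normr0 ltW.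
have sg : t0 < s by rewrite lt_neqAle eq_sym sn.
rewrite gtr0_norm ?subr_gt0// in sb se; rewrite ltr_pdivlMr// in se.
have h : `|w s - w t0| <= C * (s - t0) by rewrite -lE; apply: Hl; apply/andP; split; lra.
by rewrite (le_trans h)//; lra.
Qed.

Lemma field_solution_unique (v w : R -> realify Y) (t0 t1 : R) :
  0 <= t0 -> t0 <= t1 -> v t0 = w t0 ->
  (forall t, t0 <= t <= t1 -> [/\ Mt (v t), Mt (w t), cont_in `[t0, t1] v t &
     cont_in `[t0, t1] w t]) ->
  (forall t, t0 < t < t1 -> deriv_in `[t0, t1] v t (field t (v t)) /\
     deriv_in `[t0, t1] w t (field t (w t))) ->
  v t1 = w t1.
Proof.
move=> t00 t01 vw0 cvw dvw.
apply: (@ode_unique R (realify Y) field Mt v w t0 t1) => // t /andP[tt0 tt1].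
have t_ge0 : 0 <= t by exact: le_trans tt0.
have [|Mv _ _ _] := cvw t; first by rewrite tt0 ltW.
have [d [L [d0 L0 H]]] := field_lip t_ge0 Mv.
exists (d / 2), L; split=> //; first by rewrite divr_gt0.
move=> s y y' /andP[ts sd] My My' yd y'd.
have hd : d / 2 < d by lra.
apply: H => //.
- exact: le_trans ts.
- by rewrite ger0_norm ?subr_ge0//; lra.
- exact: le_lt_trans yd hd.
- exact: le_lt_trans y'd hd.
Qed.

Lemma solution_unique (J J' : set R) (y z : R -> X) (t0 t1 : R) :
  solution_in T f Sol y J -> solution_in T f Sol z J' ->
  J t0 -> J t1 -> J' t0 -> J' t1 -> t0 <= t1 -> y t0 = z t0 -> y t1 = z t1.
Proof.
move=> sy sz J0 J1 J'0 J'1; rewrite le_eqVlt => /predU1P[<-//|t01] yz0.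
have t00 : 0 <= t0 by case: sy => -[_ JR _ _ _] _; exact: JR.
have [cy dy] := solution_reduced sy J0 J1 t01.
have [cz dz] := solution_reduced sz J'0 J'1 t01.
have t11 : t0 < t1 <= t1 by rewrite t01 lexx.
have [-> _] := dy t1 t11; have [-> _] := dz t1 t11; congr (reconstruct _ _).
apply: (@field_solution_unique (fun t => A (y t)) (fun t => A (z t)) t0 t1) => //.
- exact: ltW.
- by rewrite yz0.
- by move=> t tt; have [My cyt] := cy t tt; have [Mz czt] := cz t tt.
- move=> t /andP[tt0 tt1]; have tt : t0 < t <= t1 by rewrite tt0 ltW.
  by have [_ dyt] := dy t tt; have [_ dzt] := dz t tt.
Qed.

(** * Continuation and maximal solutions *)

Definition field_solution (w : R -> realify Y) (t0 t1 : R) : Prop :=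
  forall t, t0 <= t <= t1 -> Mt (w t) /\ deriv_in `[t0, t1] w t (field t (w t)).

Lemma field_solution_sub w (t0 t1 t : R) : field_solution w t0 t1 -> t <= t1 ->
  field_solution w t0 t.
Proof.
move=> sw tt1 s /andP[s0 st]; have [|Ms ds] := sw s; first by rewrite s0 (le_trans st).
split=> //; apply: deriv_inW ds => r /=; rewrite !in_itv/= => /andP[-> h].
exact: le_trans tt1.
Qed.

Lemma field_solutions_agree v w (t0 t1 : R) : 0 <= t0 -> t0 <= t1 ->
  field_solution v t0 t1 -> field_solution w t0 t1 -> v t0 = w t0 -> v t1 = w t1.
Proof.
move=> t00 t01 sv sw vw0; apply: (field_solution_unique t00 t01 vw0).
  move=> t tt; have [Mv dv] := sv t tt; have [Mw dw] := sw t tt.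
  by split=> //; [exact: deriv_in_cont dv | exact: deriv_in_cont dw].
move=> t /andP[/ltW h /ltW h']; have tt : t0 <= t <= t1 by rewrite h.
by split; [case: (sv t tt) | case: (sw t tt)].
Qed.

(** At the joint both one-sided derivatives equal [field] at the common value, so they combine into
    one derivative. *)
Lemma field_solution_glue v w (t0 t1 t2 : R) : t0 < t1 -> t1 < t2 ->
  field_solution v t0 t1 -> field_solution w t1 t2 -> v t1 = w t1 ->
  field_solution (fun t => if t <= t1 then v t else w t) t0 t2.
Proof.
move=> t01 t12 sv sw vw; set u := fun t => _ => t /andP[h0 h2].
have uv s : s <= t1 -> u s = v s by rewrite /u => ->.
have uw s : t1 <= s -> u s = w s.
  rewrite /u le_eqVlt => /predU1P[<-|h]; first by rewrite lexx.
  by rewrite leNgt h.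
have mem s a b : `[a, b]%classic s = (a <= s <= b) :> Prop by rewrite /= in_itv.
have [lt|gt|te] := ltgtP t t1.
- have [|Mv dv] := sv t; first by rewrite h0 ltW.
  rewrite uv ?(ltW lt)//; split=> //.
  apply: (deriv_in_local (d := t1 - t) _ _ _ dv); [by rewrite subr_gt0|by rewrite uv// ltW|].
  move=> s; rewrite !mem ltr_norml => /andP[s0 s2] /andP[_ sd].
  by have st1 : s <= t1 by [lra]; rewrite s0 uv.
- have [|Mw dw] := sw t; first by rewrite h2 ltW.
  rewrite uw ?(ltW gt)//; split=> //.
  apply: (deriv_in_local (d := t - t1) _ _ _ dw); [by rewrite subr_gt0|by rewrite uw// ltW|].
  move=> s; rewrite !mem ltr_norml => /andP[s0 s2] /andP[sd _].
  by have st1 : t1 <= s by [lra]; rewrite s2 uw// st1.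
- have [|Mv dv] := sv t1; first by rewrite lexx ltW.
  have [|Mw dw] := sw t1; first by rewrite lexx ltW.
  rewrite te uv//; split=> //.
  apply: (@deriv_in_glue _ _ _ `[t0, t1]%classic `[t1, t2]%classic).
  + move=> s; rewrite !mem => /andP[-> ->] /=; rewrite andbT.
    by have [|/ltW] := leP s t1; [left|right].
  + apply: (deriv_in_local (d := 1) _ _ _ dv) => //; first by rewrite uv.
    by move=> s; rewrite mem => /andP[s0 st1] _; rewrite uv// s0 st1.
  + rewrite vw; apply: (deriv_in_local (d := 1) _ _ _ dw) => //; first by rewrite uw.
    by move=> s; rewrite mem => /andP[st1 s2] _; rewrite uw// s2 st1.
Qed.

Lemma reconstruct_is_solution w (J : set R) : is_interval J -> J `<=` Rplus ->
  (forall t, J t -> Mt (w t) /\ deriv_in J (w : R -> realify Y) t (field t (w t))) ->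
  solution_in T f Sol (fun t => reconstruct t (w t)) J.
Proof.
move=> iJ JR sw.
have Mw t : J t -> Mt (w t) by move=> /sw[].
have cw t : J t -> cont_in J (w : R -> realify Y) t by move=> /sw[_]; exact: deriv_in_cont.
split; last by move=> t Jt; apply: reconstruct_Sol; [exact: JR | exact: Mw].
split=> //.
- apply/continuous_within_rnorm => t Jt e e0.
  have [d d0 H] := reconstruct_cont (JR t Jt) (Mw t Jt) e0.
  have [d' d'0 H'] := cw t Jt (d / 2) ltac:(by rewrite divr_gt0).
  exists (Num.min d d'); first by rewrite lt_min d0.
  move=> s Js; rewrite lt_min => /andP[sd sd'].
  apply: H => //; [exact: JR | exact: Mw |].
  by have := H' s Js sd'; rewrite -[`|_|]/(rnorm (w s - w t)); lra.
- by move=> t Jt; apply: reconstruct_dom; [exact: JR | exact: Mw].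
- exists (fun t => field t (w t)); split.
  + apply/derivative_onP => t [Jt t0]; have [_ dw] := sw t Jt.
    apply: (deriv_in_local (d := 1) _ _ _ dw) => //.
      by rewrite A_reconstruct//; [exact: JR | exact: Mw].
    by move=> s [Js _] _; rewrite A_reconstruct//; [exact: JR | exact: Mw].
  + apply/continuous_within_rnorm => t [Jt _] e e0.
    have [d d0 H] := field_cont (JR t Jt) (Mw t Jt) e0.
    have [d' d'0 H'] := cw t Jt (d / 2) ltac:(by rewrite divr_gt0).
    exists (Num.min d d'); first by rewrite lt_min d0.
    move=> s [Js _]; rewrite lt_min => /andP[sd sd'].
    apply: H => //; [exact: JR | exact: Mw |].
    by have := H' s Js sd'; rewrite -[`|_|]/(rnorm (w s - w t)); lra.
  + by move=> t _; rewrite /field subrK.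
Qed.

Theorem maximal_solution_exists (t0 : R) (x0 : X) : L0 t0 x0 ->
  M12 (P1 x0 + P2S x0) -> M20 (P20 x0) ->
  ivp_unique_maximal_solution_in T f Sol t0 x0.
Proof.
move=> Lx0 Mz0 Mu0; have t00 : 0 <= t0 by case: Lx0.
have x0E : x0 = P1 x0 + P2S x0 + P20 x0 by rewrite P_split subrK.
pose w0 := tA (P1 x0 + P2S x0).
have Mw0 : Mt w0 by case: Mz0.
have r0 : reconstruct t0 w0 = x0.
  have SE : S w0 = P1 x0 + P2S x0 by apply: St; exact: M12_dom.
  rewrite /reconstruct SE [RHS]x0E; congr (_ + _).
  by apply/esym/implicit_unique => //; rewrite -x0E.
pose reach := [set tau : R | t0 < tau /\
  exists2 w : R -> realify Y, w t0 = w0 & field_solution w t0 tau].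
have reach_sub tau s : reach tau -> t0 < s -> s <= tau -> reach s.
  move=> [_ [w ww sw]] s0 st; split=> //; exists w => //.
  exact: (field_solution_sub sw st).
have [a [w1 [a0 w10 sw1]]] := field_solution_exists t00 Mw0.
have reach1 : reach (t0 + a) by split; [rewrite ltrDl | exists w1].
pose tmax := ereal_sup [set tau%:E | tau in reach].
have tmaxP t : t0 <= t -> (t%:E < tmax)%E -> exists2 tau, reach tau & t < tau.
  move=> _ /ereal_sup_gt[_ [tau rtau <-]]; rewrite lte_fin => ttau.
  by exists tau.
have le_tmax tau : reach tau -> (tau%:E <= tmax)%E.
  by move=> rtau; apply: ereal_sup_ubound; exists tau.
have t0max : (t0%:E < tmax)%E.
  by apply: lt_le_trans (le_tmax _ reach1); rewrite lte_fin ltrDl.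
pose J := from_until t0 tmax.
have Jt0 : J t0 by split.
(* For each [t] a solution going strictly beyond [t] is chosen, so that it agrees with the diagonal
   [W] on a whole neighbourhood of [t] in [J] and gives its derivative there. Uniqueness makes all
   choices agree where they overlap. *)
have /choice[sel Hsel] t : exists w : R -> realify Y, J t ->
    exists tau : R, [/\ t < tau, w t0 = w0 & field_solution w t0 tau].
  have [[tt0 ttm]|nJ] := pselect (J t); last by exists w1.
  have [tau [_ [w ww sw]] ttau] := tmaxP t tt0 ttm.
  by exists w => _; exists tau.
pose W t := sel t t.
have Wsel t s tau : J t -> J s -> t <= tau -> s <= tau ->
    field_solution (sel t) t0 tau -> W s = sel t s.
  move=> Jt Js ttau stau st; have [sig [ssig ws0 ss]] := Hsel s Js.
  have [_ [_ wt0 _]] := Hsel t Jt; case: Js => s0 _.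
  apply: (@field_solutions_agree (sel s) (sel t) _ _ t00 s0).
  - exact: (field_solution_sub ss (ltW ssig)).
  - exact: (field_solution_sub st stau).
  - by rewrite ws0 wt0.
have WJ t : J t -> Mt (W t) /\ deriv_in J W t (field t (W t)).
  move=> Jt; have [tau [ttau wt0 st]] := Hsel t Jt; have [tt0 _] := Jt.
  have [|Mw dw] := st t; first by rewrite tt0 ltW.
  split=> //; apply: (deriv_in_local (d := tau - t) _ _ _ dw) => //.
    by rewrite subr_gt0.
  move=> s Js; rewrite ltr_norml => /andP[_ sd].
  have stau : s <= tau by lra.
  split; first by case: Js => s0 _; rewrite /= in_itv/= s0.
  exact: (Wsel t s tau Jt Js (ltW ttau) stau st).
have JR : J `<=` Rplus by move=> t [h _]; exact: le_trans h.
have iJ : is_interval J.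
  move=> u v [u0 _] [_ vm] t /andP[ut tv]; split; first exact: le_trans ut.
  by apply: le_lt_trans vm; rewrite lee_fin.
have solW := reconstruct_is_solution iJ JR WJ.
have W0 : W t0 = w0 by have [tau []] := Hsel t0 Jt0.
exists tmax; split=> //; exists (fun t => reconstruct t (W t)); split.
- by rewrite W0.
- split=> // J' y sy JJ' J'J yW; apply/seteqP; split=> // s J's.
  have [t [tt0 _] ts] := J'J s J's; split; first exact: le_trans ts.
  rewrite ltNge; apply/negP => ms.
  (* A strict extension contains the finite time [tau = tmax]. Its reduced value there is still in
     [Mt], so the reduced equation can be restarted at [tau] and reaches past [tmax]. *)
  have [tau tauE] : exists tau : R, tmax = tau%:E.
    exists (fine tmax); rewrite fineK// fin_real//.
    by rewrite (lt_trans (ltNyr _) t0max) (le_lt_trans ms (ltry _)).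
  have t0tau : t0 < tau by move: t0max; rewrite tauE lte_fin.
  have taus : tau <= s by move: ms; rewrite tauE lee_fin.
  have J't0 := JJ' t0 Jt0.
  have J'tau : J' tau.
    by case: sy => -[iJ' _ _ _ _] _; apply: (iJ' t0 s) => //; rewrite ltW.
  have [cy dy] := solution_reduced sy J't0 J'tau t0tau.
  pose v t : realify Y := A (y t).
  have vW r : t0 <= r -> r < tau -> J r /\ v r = W r.
    move=> r0' rtau; have Jr : J r by split=> //; rewrite tauE lte_fin.
    by split=> //; rewrite /v yW// A_reconstruct//; [exact: JR | case: (WJ r Jr)].
  have sv : field_solution v t0 tau.
    move=> r /andP[r0' rtau]; have [|Mv _] := cy r; first by rewrite r0'.
    split=> //; move: r0'; rewrite le_eqVlt => /predU1P[<-|r0']; last first.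
      by have [|_] := dy r; first by rewrite r0'.
    (* [solution_reduced] gives no derivative at [t0]; it is borrowed from [W], which coincides with
       [v] before [tau]. *)
    have [_ dW0] := WJ t0 Jt0; have [_ vW0] := vW t0 (lexx _) t0tau.
    rewrite vW0; apply: (deriv_in_local (d := tau - t0) _ _ _ dW0).
    + by rewrite subr_gt0.
    + by rewrite vW0.
    + move=> q; rewrite /= in_itv/= ltr_norml => /andP[q0 _] /andP[_ qd].
      by apply: vW => //; lra.
  have tau0 : 0 <= tau by rewrite (le_trans t00)// ltW.
  have [|Mvtau _] := sv tau; first by rewrite lexx ltW.
  have [b [u [b0 u0 su]]] := field_solution_exists tau0 Mvtau.
  have : reach (tau + b).
    split; first by rewrite (lt_trans t0tau)// ltrDl.
    exists (fun t => if t <= tau then v t else u t).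
      by rewrite (ltW t0tau); have [_ ->] := vW t0 (lexx _) t0tau.
    by apply: field_solution_glue => //; rewrite ltrDl.
  by move/le_tmax; rewrite tauE lee_fin leNgt ltrDl b0.
- move=> J' y J't0 J'J sy yx0 t J't; have [tt0 _] := J'J t J't.
  apply: (solution_unique sy solW J't0 J't Jt0 (J'J t J't) tt0).
  by rewrite yx0 W0.
Qed.
End ReducedEquation.
End ImplicitFunction.
End RootSystem.

Theorem theorem4p1 (R : realType) (k : scalar_kind)
    (X Y : completeNormedModType (scal R k))
    (T : pencil X Y) (f : R -> X -> Y) (nu n : nat)
    (rs : @root_data R k X Y n) (Mt : set Y) (M20 : set X) :
  closed_densely_defined (dom_A T) (op_A T) ->
  closed_densely_defined (dom_B T) (op_B T) ->
  closed (op_A T @` dom_A T) ->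
  (exists2 x : X, dom T x & x != 0) ->
  continuous_rhs T f ->
  dom_A T `<=` dom_B T ->
  (0 < nu)%N ->
  regular_pencil T nu ->
  root_system T nu rs ->
  open_in (dsum (Y1 T rs) (Y2S T rs)) Mt ->
  M20 `<=` D20 T rs ->
  unique_solvability T f rs Mt M20 ->
  locally_lipschitz T f rs ->
  approximate_invertibility T f rs Mt M20 ->
  M20_locally_stable T f rs Mt M20 ->
  forall (t0 : R) (x0 : X),
    L0 T f rs t0 x0 ->
    M12 T rs Mt (P1 T rs x0 + P2S T rs x0) ->
    M20 (P20 T rs x0) ->
    ivp_unique_maximal_solution_in T f (dsum (M12 T rs Mt) M20) t0 x0.
Proof.
move=> HA HB HAcl _ Hf HAB _ Hreg Hroot HMt HM20 Huniq Hlip Happrox Hstab.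
have [S [bS bBS tS St]] := tildeA_inverse HA HB HAcl HAB Hreg Hroot.
exact: (maximal_solution_exists HA HB Hroot Hf HMt HM20 Huniq Hlip Happrox Hstab
  bS bBS tS St).
Qed.
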